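(* Let $h\in C(\overline{\Omega})$ with $h\not\equiv0$ on $\overline{\Omega}$. If a solution $\{u,f\}$ of Inverse Problem 1 exists in the class $C^{\alpha,2}_{t,x}(\overline{\Omega}_T)\times C[0,T]$, then it is unique within this class of functions. That is, for given $\varphi,\psi,g$, there is at most one pair $\{u,f\}\in C^{\alpha,2}_{t,x}(\overline{\Omega}_T)\times C[0,T]$ satisfying $$\partial_t^{\alpha}u-Lu=f(t)h(x),\quad (t,x)\in\Omega_T,$$ $$u(0,x)=\varphi(x),\quad u_t(0,x)=\psi(x),\quad x\in\overline{\Omega},$$ $$u(t,x)=0,\quad (t,x)\in[0,T]\times\partial\Omega,$$ $$\int_{\Omega}h(x)u(t,x)\,dx=g(t),\quad 0\le t\le T.$$
   Context: Let $\alpha\in(1,2)$, $T>0$, $N\ge1$, and let $\Omega\subset\mathbb{R}^N$ be a bounded domain with smooth boundary $\partial\Omega$. Put $\Omega_T=(0,T]\times\Omega$ and $\overline{\Omega}_T=[0,T]\times\overline{\Omega}$. The operator $L$ acts in $x$ by $Lu=\operatorname{div}[\mathbf{A}(x)\nabla u]-c(x)u$, where $\mathbf{A}(x)=(a_{ij}(x))_{i,j=1,\dots,N}$ is a symmetric real matrix with $\sum_{i,j=1}^N a_{ij}(x)\xi_i\xi_j\ge\delta\sum_{i=1}^N\xi_i^2$ for all $x\in\Omega$, $\xi\in\mathbb{R}^N$, with a constant $\delta>0$, and $c(x)\ge0$. The first derivatives of the $a_{ij}$ and the function $c$ are Hölder continuous in $\Omega$. The Caputo derivative in $t$ of order $\alpha\in(1,2)$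 is $\partial_t^{\alpha}u(t,x)=I_{0+}^{2-\alpha}u_{tt}(t,x)=\frac{1}{\Gamma(2-\alpha)}\int_0^t\frac{u_{\tau\tau}(\tau,x)}{(t-\tau)^{\alpha-1}}\,d\tau$. Function classes: $C^{1,0}_{t,x}(\overline{\Omega}_T)=\{u\in C(\overline{\Omega}_T): u_t\in C(\overline{\Omega}_T)\}$; $C^{\alpha,2}_{t,x}(\overline{\Omega}_T)=\{u\in C^{1,0}_{t,x}(\overline{\Omega}_T): \partial_t^{\alpha}u,\ u_{xx}\in C(\overline{\Omega}_T)\}$, where $u_{xx}$ stands for the second-order spatial derivatives of $u$. Inverse Problem 1 is the problem of finding the pair $\{u,f\}$ from the four displayed relations, given $L,\varphi,\psi,\alpha,h,g$. *)

(* Defs.v *)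
From HB Require Import structures.
From mathcomp Require Import all_boot all_order all_algebra.
From mathcomp Require Import all_classical all_reals all_analysis.

Set Implicit Arguments.
Unset Strict Implicit.
Unset Printing Implicit Defensive.

Import Order.TTheory GRing.Theory Num.Theory.
Import numFieldNormedType.Exports.

Local Open Scope classical_set_scope.
Local Open Scope ring_scope.

Definition tuple_cons (T : Type) n (p : T * n.-tuple T) : n.+1.-tuple T :=
  [tuple of p.1 :: p.2].

Definition tuple_tail (T : Type) n (t : n.+1.-tuple T) : n.-tuple T :=
  [tuple of behead t].

Lemma tuple_consK (T : Type) n (x : T) (t : n.-tuple T) :
  thead (tuple_cons (x, t)) = x /\ tuple_tail (tuple_cons (x, t)) = t.
Proof. by split; [rewrite theadE|exact: val_inj]. Qed.

Lemma tnth_tail (T : Type) n (t : n.+1.-tuple T) i :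
  tnth (tuple_tail t) i = tnth t (lift ord0 i).
Proof. by rewrite [in RHS](tuple_eta t) tnthS. Qed.

Section lebesgue_tuple_step.
Context {R : realType} {n : nat}.
Variable m : {sigma_finite_measure set (n.-tuple (measurableTypeR R)) -> \bar R}.

Lemma measurable_tuple_cons :
  measurable_fun [set: measurableTypeR R * n.-tuple (measurableTypeR R)]
    (@tuple_cons (measurableTypeR R) n).
Proof. exact: measurable_cons. Qed.

Definition lebesgue_tuple_cons :
    set (n.+1.-tuple (measurableTypeR R)) -> \bar R :=
  pushforward (@lebesgue_measure R \x m)%E
    (@tuple_cons (measurableTypeR R) n).

Let cons0 : lebesgue_tuple_cons set0 = 0%E.
Proof. by rewrite /lebesgue_tuple_cons /pushforward preimage_set0 measure0. Qed.

Let cons_ge0 A : (0 <= lebesgue_tuple_cons A)%E.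
Proof. by apply: integral_ge0 => x _ /=; exact: measure_ge0. Qed.

Let cons_sigma_additive : semi_sigma_additive lebesgue_tuple_cons.
Proof.
move=> F mF tF mUF; rewrite /lebesgue_tuple_cons /pushforward preimage_bigcup.
apply: measure_semi_sigma_additive.
- by move=> i; rewrite -[X in measurable X]setTI; exact: measurable_tuple_cons.
- apply/trivIsetP => /= i j _ _ ij; rewrite -preimage_setI.
  by move/trivIsetP : tF => /(_ _ _ _ _ ij) ->//; rewrite preimage_set0.
- rewrite -preimage_bigcup -[X in measurable X]setTI.
  exact: measurable_tuple_cons.
Qed.

HB.instance Definition _ := isMeasure.Build _ _ _ lebesgue_tuple_cons
  cons0 cons_ge0 cons_sigma_additive.

Lemma lebesgue_tuple_consE (A : set (measurableTypeR R))
    (B : set (n.-tuple (measurableTypeR R))) :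
  measurable A -> measurable B ->
  lebesgue_tuple_cons [set t | A (thead t) /\ B (tuple_tail t)] =
  (lebesgue_measure A * m B)%E.
Proof.
move=> mA mB; rewrite /lebesgue_tuple_cons /pushforward.
rewrite (_ : _ @^-1` _ = A `*` B) ?product_measure1E//.
by apply/seteqP; split => -[x y] /=; have [-> ->] := tuple_consK x y.
Qed.

Let cons_sigma_finite : sigma_finite setT lebesgue_tuple_cons.
Proof.
have [F TF mF] := sigma_finiteT (@lebesgue_measure R).
have [G TG mG] := sigma_finiteT m.
pose H (k : nat * nat) : set (n.+1.-tuple (measurableTypeR R)) :=
  [set t | F k.1 (thead t) /\ G k.2 (tuple_tail t)].
exists (fun j => if unpickle j is Some k then H k else set0).
  apply/seteqP; split => // t _.
  have [i _ Fi] : (\bigcup_i F i) (thead t) by rewrite -TF.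
  have [j _ Gj] : (\bigcup_j G j) (tuple_tail t) by rewrite -TG.
  by exists (pickle (i, j)) => //; rewrite pickleK; split.
move=> l; case: unpickle => [[i j]|]; last by rewrite measure0.
have [[mFi Foo] [mGj Goo]] := (mF i, mG j); split.
  have mhd : measurable ((fun t : n.+1.-tuple (measurableTypeR R) => thead t)
      @^-1` F i).
    by rewrite -[X in measurable X]setTI; exact: measurable_tnth.
  have mtl : measurable (@tuple_tail (measurableTypeR R) n @^-1` G j).
    by rewrite -[X in measurable X]setTI; exact: measurable_behead.
  exact: (measurableI _ _ mhd mtl).
rewrite [ltLHS]lebesgue_tuple_consE// lte_mul_pinfty// ge0_fin_numE//.
Qed.

HB.instance Definition _ :=
  @Measure_isSigmaFinite.Build _ _ _ lebesgue_tuple_cons cons_sigma_finite.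

End lebesgue_tuple_step.

Fixpoint lebesgue_tuple (R : realType) (n : nat) :
    {sigma_finite_measure set (n.-tuple (measurableTypeR R)) -> \bar R} :=
  if n is n'.+1 then lebesgue_tuple_cons (lebesgue_tuple R n')
  else @dirac _ (0.-tuple (measurableTypeR R)) [tuple] R.

Lemma lebesgue_tuple_box (R : realType) n (A : 'I_n -> set (measurableTypeR R)) :
  (forall i, measurable (A i)) ->
  lebesgue_tuple R n [set t | forall i, A i (tnth t i)] =
  (\prod_(i < n) lebesgue_measure (A i))%E.
Proof.
elim: n A => [|n IH] A mA /=.
  by rewrite big_ord0 diracE mem_set// => -[].
rewrite big_ord_recl -IH// -lebesgue_tuple_consE//; last first.
  rewrite (_ : mkset _ = \bigcap_(i in [set: 'I_n])
      ((@tnth _ _ ^~ i) @^-1` A (lift ord0 i))); last first.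
    by apply/seteqP; split => t /= At i => [_|]; exact: At.
  apply: fin_bigcap_measurable => // i _.
  by rewrite -[X in measurable X]setTI; exact: measurable_tnth.
congr (lebesgue_tuple_cons _ _); apply/seteqP; split => t /=.
  by move=> At; split; [exact: At|move=> i; rewrite tnth_tail; exact: At].
move=> [A0 AS] i; have [j ->|->//] := unliftP ord0 i.
by rewrite -tnth_tail; exact: AS.
Qed.

Section R_n.
Context {R : realType} {n : nat}.
Local Notation Rn := 'rV[R]_n.
Implicit Types (Om U : set Rn) (v rho : Rn -> R).

Definition rV_of_tuple (t : n.-tuple (measurableTypeR R)) : Rn :=
  \row_i tnth t i.

Definition integral_Rn Om v : R :=
  \int[lebesgue_tuple R n]_(t in rV_of_tuple @^-1` Om) v (rV_of_tuple t).

Definition partial (i : 'I_n) v : Rn -> R := 'D_(delta_mx 0 i : Rn) v.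

Definition has_partial (i : 'I_n) v (x : Rn) : Prop :=
  derivable v x (delta_mx 0 i : Rn).

Definition boundary Om : set Rn := closure Om `\` Om°.

(* The list s is read from right to left: its last index is differentiated
   first. *)
Definition smooth_on U v : Prop :=
  forall (s : seq 'I_n) (x : Rn), U x ->
    {for x, continuous (foldr partial v s)} /\
    forall i, has_partial i (foldr partial v s) x.

(* Near each of its boundary points, Om is the sublevel set of a smooth local
   defining function with nonvanishing gradient. *)
Definition smooth_boundary Om : Prop :=
  forall p, boundary Om p -> exists U rho,
    [/\ open_nbhs p U, smooth_on U rho, exists i, partial i rho p != 0 &
        Om `&` U = [set x | U x /\ rho x < 0]].

Definition bounded_smooth_domain Om : Prop :=
  [/\ Om !=set0, open Om, connected Om, bounded_set Om & smooth_boundary Om].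

(* The norm of 'rV_n is the sup norm; since it is equivalent to the Euclidean
   one, only the constant C depends on this choice. *)
Definition holder_on Om v : Prop :=
  exists C gamma : R, [/\ 0 < gamma, gamma <= 1 &
    forall x y, Om x -> Om y -> `|v x - v y| <= C * `|x - y| `^ gamma].

Definition div_form_op (A : Rn -> 'M[R]_n) (c : Rn -> R) v (x : Rn) : R :=
  \sum_i partial i (fun y => \sum_j A y i j * partial j v y) x - c x * v x.

End R_n.

(* A function F defined on a dense part D of K belongs to C(K) when it has a
   continuous extension to K. *)
Definition continuous_up_to (R : realType) (X : topologicalType) (D K : set X)
    (F : X -> R) : Prop :=
  exists2 G : X -> R, {within K, continuous G} & forall p, D p -> F p = G p.

Section time_derivatives.
Context {R : realType}.
Implicit Types (y : R -> R) (T t tau alpha : R).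

Definition Gamma (z : R) : R :=
  \int[lebesgue_measure]_(t in `]0, +oo[) (t `^ (z - 1) * expR (- t)).

Definition diff_quotient y t : R -> R := fun s => (s - t)^-1 * (y s - y t).

(* Derivative relative to [0, T]: one-sided at 0 and T, the usual derivative on
   ]0, T[. *)
Definition derivable_in T y t : Prop :=
  cvg (diff_quotient y t @ within `[0, T] t^').

Definition derive_in T y t : R :=
  lim (diff_quotient y t @ within `[0, T] t^').

Definition caputo_integrand alpha y t tau : R :=
  y^`(2)%classic tau / (t - tau) `^ (alpha - 1).

Definition caputo alpha y t : R :=
  (Gamma (2 - alpha))^-1 *
  \int[lebesgue_measure]_(tau in `]0, t[) caputo_integrand alpha y t tau.

(* The formula for the Caputo derivative is meaningful on ]0, T]: y' is
   absolutely continuous on [0, T], i.e. it is the primitive of its almost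
   everywhere derivative y'' in L^1, and the singular integrals converge. *)
Definition caputo_defined T alpha y : Prop :=
  [/\ {ae lebesgue_measure, forall t, t \in `]0, T[ -> derivable y^`()%classic t 1},
      lebesgue_measure.-integrable `]0, T[ (EFin \o y^`(2)%classic),
      forall t, t \in `[0, T] -> derive_in T y t =
        derive_in T y 0 + \int[lebesgue_measure]_(tau in `]0, t[) y^`(2)%classic tau &
      forall t, t \in `]0, T] ->
        lebesgue_measure.-integrable `]0, t[
          (EFin \o caputo_integrand alpha y t)].

End time_derivatives.

Section function_classes.
Context {R : realType} {n : nat}.
Implicit Types (Om : set 'rV[R]_n) (u : R -> 'rV[R]_n -> R) (T alpha : R).

Definition cylinder (I : interval R) Om : set (R * 'rV[R]_n) :=
  [set` I] `*` Om.

Definition C10 T Om u : Prop :=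
  [/\ {within cylinder `[0, T] (closure Om), continuous (fun p => u p.1 p.2)},
      forall t x, t \in `[0, T] -> closure Om x -> derivable_in T (u^~ x) t &
      {within cylinder `[0, T] (closure Om), continuous
        (fun p => derive_in T (u^~ p.2) p.1)}].

(* The Caputo derivative is extended continuously to t = 0 rather than computed
   there: the integral over the empty interval is 0, whereas for instance
   t `^ alpha has the constant Caputo derivative Gamma (alpha + 1) for t > 0. *)
Definition C_alpha_2 alpha T Om u : Prop :=
  [/\ C10 T Om u,
      forall x, Om x -> caputo_defined T alpha (u^~ x),
      continuous_up_to (cylinder `]0, T] Om) (cylinder `[0, T] (closure Om))
        (fun p => caputo alpha (u^~ p.2) p.1),
      forall t x i j, t \in `[0, T] -> Om x ->
        has_partial i (u t) x /\ has_partial j (partial i (u t)) x &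
      forall i j,
        continuous_up_to (cylinder `[0, T] Om) (cylinder `[0, T] (closure Om))
          (fun p => partial j (partial i (u p.1)) p.2)].

Definition inverse_problem_1 alpha T Om
    (A : 'rV[R]_n -> 'M[R]_n) (c h phi psi : 'rV[R]_n -> R) (g : R -> R)
    u (f : R -> R) : Prop :=
  [/\ forall t x, t \in `]0, T] -> Om x ->
        caputo alpha (u^~ x) t - div_form_op A c (u t) x = f t * h x,
      forall x, closure Om x -> u 0 x = phi x /\ derive_in T (u^~ x) 0 = psi x,
      forall t x, t \in `[0, T] -> boundary Om x -> u t x = 0 &
      forall t, t \in `[0, T] -> integral_Rn Om (fun x => h x * u t x) = g t].

End function_classes.

(* Main.v *)
Require Import Defs.
From mathcomp Require Import all_boot all_order all_algebra.
From mathcomp Require Import all_classical all_reals all_analysis.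
From mathcomp Require Import measurable_realfun.
From mathcomp Require Import ring lra.

Set Implicit Arguments.
Unset Strict Implicit.
Unset Printing Implicit Defensive.

Import Order.TTheory GRing.Theory Num.Theory.
Import numFieldNormedType.Exports.

Local Open Scope classical_set_scope.
Local Open Scope ring_scope.

(** Let w = u1 - u2, v = w_t, D = the difference of the two Caputo derivatives
    (extended continuously to t = 0) and F = f1 - f2, so that D - L w = F(t) h
    in the domain, w and v vanish at t = 0, w vanishes on the boundary, and
    every w(s) is orthogonal to h because both solutions have the same
    observation g. The last fact is the point: the unknown source disappears
    when the equation at time t is tested against w(s),

      <D(t), w(s)> = <L w(t), w(s)>   for all s and t.

    The right-hand side is symmetric in (s, t), and nonpositive for s = t,
    since L is symmetric and nonpositive on functions vanishing on the
    boundary (div_form_symmetric, div_form_le0).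

    One would like to integrate 2 <D, v> = 2 <D, w_t> = d/dt <D, w>, an identity
    which the symmetry suggests, but D need not be differentiable in time. It is
    replaced by the functional

      Phi(t) = 2 int_0^t <D(s), v(s)> ds - <D(t), w(t)>.

    Expanding Phi(t) - Phi(s) with <D(s), w(t)> = <D(t), w(s)> leaves the
    integral over ]s, t[ of <(D(r) - D(t)) + (D(r) - D(s)), v(r)>, which is
    o(t - s) by uniform continuity of D. Hence Phi is constant, and the constant
    is 0. Consequently 2 int_0^t <D, v> = <D(t), w(t)> <= 0 (work_le0).

    In the other direction, for each fixed x the Caputo derivative of order
    alpha is the convolution of v' with the kernel t^(1 - alpha) divided by
    Gamma(2 - alpha) > 0. Such a memory term acts like friction
    (memory_energy): int_0^T D v >= C int_0^T v^2 with C > 0. So the work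
    int_0^T D v is nonnegative at every x and its integral over the domain is
    nonpositive; being continuous in x it vanishes, which forces v = 0, hence
    w = 0. Then D = 0 and L w = 0, so F(t) h = 0, and F = 0 since h is not
    identically zero.

    Positivity of the memory term is proved without transforms: the decreasing
    kernel is approximated from below by sums of indicators of intervals
    ]0, r[, and for such an indicator the memory term is the increment
    v(s) - v(s - r), for which
    2 v(s) (v(s) - v(s - r)) >= v(s)^2 - v(s - r)^2. Green's formula is
    proved with estimates on the gradient in the interior only: the test
    functions are multiplied by a cutoff of the squared size of the functions
    themselves, so that everything is supported in the interior, and
    the extra terms have a sign (green_le0) or are dominated by the energy
    density (green_symmetric). *)

(** * Integrable real-valued functions *)

Section real_integrals.
Context d (X : measurableType d) (R : realType) (mu : {measure set X -> \bar R}).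
Implicit Types (D : set X) (f g : X -> R).

Lemma le_norm_integrable D f g : measurable D -> measurable_fun D f ->
  mu.-integrable D (EFin \o g) -> (forall x, D x -> `|f x| <= g x) ->
  mu.-integrable D (EFin \o f).
Proof.
move=> mD mf ig fg; apply: (le_integrable _ _ _ ig) => //.
  exact/measurable_EFinP.
move=> x Dx /=; rewrite lee_fin; apply: (le_trans (fg _ Dx)).
exact: ler_norm.
Qed.

Lemma bounded_integrableR D f C : measurable D -> (mu D < +oo)%E ->
  measurable_fun D f -> (forall x, D x -> `|f x| <= C) ->
  mu.-integrable D (EFin \o f).
Proof.
move=> mD fD mf fC; apply: measurable_bounded_integrable => //.
exists C; split; first exact: num_real.
by move=> M CM x Dx /=; rewrite (le_trans (fC x Dx))// ltW.
Qed.

Lemma integrableZlR D f k : measurable D -> mu.-integrable D (EFin \o f) ->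
  mu.-integrable D (EFin \o (fun x => k * f x)).
Proof. by move=> mD intf; exact: (integrableZl mD k intf). Qed.

Lemma integrableDR D f g : measurable D -> mu.-integrable D (EFin \o f) ->
  mu.-integrable D (EFin \o g) ->
  mu.-integrable D (EFin \o (fun x => f x + g x)).
Proof. by move=> mD intf intg; exact: (integrableD mD intf intg). Qed.

Lemma integrableBR D f g : measurable D -> mu.-integrable D (EFin \o f) ->
  mu.-integrable D (EFin \o g) ->
  mu.-integrable D (EFin \o (fun x => f x - g x)).
Proof. by move=> mD intf intg; exact: (integrableB mD intf intg). Qed.

Lemma integrable_restrictR D f : measurable D ->
  mu.-integrable D (EFin \o f) -> mu.-integrable setT (EFin \o (f \_ D)).
Proof.
by move=> mD intf; rewrite -restrict_EFin -(@integrable_mkcond _ _ _ mu D).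
Qed.

Lemma integrable_sumR D (I : Type) (s : seq I) (F : I -> X -> R) :
  measurable D -> (forall i, mu.-integrable D (EFin \o F i)) ->
  mu.-integrable D (EFin \o (fun x => \sum_(i <- s) F i x)).
Proof.
move=> mD iF; elim: s => [|i s IH].
  by under eq_fun do rewrite big_nil; exact: integrable0.
by under eq_fun do rewrite big_cons; exact: integrableDR.
Qed.

Lemma Rintegral_sum D (I : Type) (s : seq I) (F : I -> X -> R) :
  measurable D -> (forall i, mu.-integrable D (EFin \o F i)) ->
  \int[mu]_(x in D) (\sum_(i <- s) F i x) =
  \sum_(i <- s) \int[mu]_(x in D) F i x.
Proof.
move=> mD iF; elim: s => [|i s IH].
  by under eq_Rintegral do rewrite big_nil; rewrite big_nil Rintegral_cst// mul0r.
under eq_Rintegral do rewrite big_cons.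
by rewrite RintegralD// ?big_cons ?IH//; exact: integrable_sumR.
Qed.

Lemma dominated_cvgR D (F : (X -> R)^nat) f g : measurable D ->
  (forall n, measurable_fun D (F n)) ->
  (forall x, D x -> F ^~ x @ \oo --> f x) ->
  mu.-integrable D (EFin \o g) ->
  (forall n x, D x -> `|F n x| <= g x) ->
  mu.-integrable D (EFin \o f) /\
  \int[mu]_(x in D) F n x @[n --> \oo] --> \int[mu]_(x in D) f x.
Proof.
move=> mD mF Ff ig Fg.
have mf : measurable_fun D f by exact: measurable_fun_cvg Ff.
have intf : mu.-integrable D (EFin \o f).
  apply: (le_norm_integrable mD mf ig) => x Dx.
  apply: (@closed_cvg _ _ \oo _ (fun n => `|F n x|) [set y | y <= g x]).
  - exact: closed_le.
  - by near=> n; exact: Fg.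
  - by apply: cvg_norm; exact: Ff.
split=> //.
have H : (\int[mu]_(x in D) (EFin \o F n) x @[n --> \oo] -->
    \int[mu]_(x in D) (EFin \o f) x)%E.
  apply: (@dominated_cvg _ _ _ mu D mD _ _ (EFin \o g)) => //.
  - by move=> n; exact/measurable_EFinP.
  - by move=> x Dx; apply: cvg_EFin; [near=> n|exact: Ff].
apply: fine_cvg.
by rewrite fineK//; exact: (integrable_fin_num mD intf).
Unshelve. all: by end_near.
Qed.

End real_integrals.

Lemma cvg_sqr (R : realType) (X : Type) (F : set_system X) {FF : Filter F}
  (f : X -> R) (a : R) : f @ F --> a -> f x ^+ 2 @[x --> F] --> a ^+ 2.
Proof.
by move=> fa; under eq_fun do rewrite expr2; rewrite expr2; exact: cvgM.
Qed.

(** * Positivity of the fractional memory term *)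

Section staircase.
Context {R : realType}.

(** A lower approximation of the identity on the half-line by a normalized sum of
    indicators of half-lines; composed with a decreasing kernel, they become
    indicators of intervals starting at 0. *)
Definition staircase (m : nat) (y : R) : R :=
  m.+1%:R^-1 * \sum_(i < m.+1 ^ 2) (i.+1%:R / m.+1%:R < y)%R%:R.

Lemma sum_thresholds (Y : R) (M : nat) : 0 <= Y ->
  let c : R := \sum_(i < M) (i.+1%:R < Y)%R%:R in
  [/\ c <= Y, c <= M%:R & Num.min M%:R (Y - 1) <= c].
Proof.
move=> Y0 /=; elim: M => [|M [cY cM Mc]].
  by rewrite big_ord0; split=> //; rewrite ge_min lexx.
rewrite big_ord_recr /=; set c := (\sum_(i < M) _) in cY cM Mc *.
have e : M.+1%:R = M%:R + 1 :> R by rewrite natr1.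
rewrite e; case: ltP => /= [MY|YM].
  split; [lra|lra|].
  move: Mc; rewrite !ge_min => /orP[?|?]; apply/orP; left; lra.
rewrite addr0; split; [by []|lra|].
by move: Mc; rewrite !ge_min => /orP[?|?]; apply/orP; right; lra.
Qed.

Lemma staircase_ge0 m y : 0 <= staircase m y.
Proof. by rewrite mulr_ge0// ?invr_ge0//; apply: sumr_ge0. Qed.

Lemma staircase_bounds m (y : R) : 0 <= y ->
  staircase m y <= y /\ (y <= m.+1%:R -> y - m.+1%:R^-1 <= staircase m y).
Proof.
move=> y0; have m0 : 0 < m.+1%:R :> R by [].
have Y0 : 0 <= m.+1%:R * y by rewrite mulr_ge0.
have [] := sum_thresholds (m.+1 ^ 2) Y0.
set c := (X in X <= _); move=> cY _ Mc.
have -> : staircase m y = m.+1%:R^-1 * c.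
  congr (_ * _); apply: eq_bigr => i _.
  by rewrite ltr_pdivrMr// mulrC.
rewrite ler_pdivrMl//; split=> // ym.
rewrite ler_pdivlMl// mulrBr divff ?gt_eqF//.
apply: le_trans Mc; rewrite le_min lexx andbT natrX expr2.
have := ler_wpM2l (ltW m0) ym; lra.
Qed.

Lemma cvg_staircase (y : R) : 0 <= y -> staircase m y @[m --> \oo] --> y.
Proof.
move=> y0; apply: (@squeeze_cvgr _ _ _ _ (fun m => y - m.+1%:R^-1) (cst y)).
- near=> m; have [? H] := staircase_bounds m y0; apply/andP; split => //.
  apply: H; near: m; exists (Num.bound y) => // m /= ym.
  rewrite (le_trans (ltW (archi_boundP y0)))// ler_nat.
  by rewrite (leq_trans ym).
- rewrite -[X in _ --> X]subr0; apply: cvgB; first exact: cvg_cst.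
  exact: cvg_harmonic.
- exact: cvg_cst.
Unshelve. all: by end_near.
Qed.

End staircase.

Section power_kernel.
Context {R : realType}.
Local Notation mu := (@lebesgue_measure R).

Lemma integral_is_derive (G g : R -> R) (a b : R) : a < b ->
  (forall s, a <= s <= b -> is_derive s (1 : R) G (g s)) ->
  {within `[a, b], continuous g} ->
  (\int[mu]_(s in `[a, b]) (g s)%:E = (G b - G a)%:E)%E.
Proof.
move=> ab dG cg.
have cG s : a <= s <= b -> {for s, continuous G}.
  move=> /dG[dGs _]; apply/differentiable_continuous.
  exact/derivable1_diffP.
rewrite (@continuous_FTC2 _ g G)//.
- split.
  + move=> s; rewrite in_itv /= => /andP[? ?].
    by have [] := dG s; rewrite ?(ltW _)//; apply/andP; split; apply: ltW.
  + by apply: cvg_at_right_filter; apply: cG; rewrite lexx ltW.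
  + by apply: cvg_at_left_filter; apply: cG; rewrite lexx ltW.
- move=> s; rewrite in_itv /= => /andP[? ?]; rewrite derive1E.
  by have [] := dG s; rewrite ?(ltW _)//; apply/andP; split; apply: ltW.
Qed.

Lemma lt_powRN (b l r : R) : 0 < b -> 0 < l -> 0 < r ->
  (l < r `^ (- b)) = (r < l `^ (- b^-1)).
Proof.
move=> b0 l0 r0.
rewrite -{1}[l]powRr1 ?ltW//.
have -> : l `^ 1 = (l `^ (- b^-1)) `^ (- b).
  by rewrite -powRrM mulrNN mulVf// gt_eqF.
rewrite !powRN ltf_pV2 ?posrE ?powR_gt0 ?invr_gt0 ?powR_gt0//.
have [lt|ge] := ltP r ((l `^ b^-1)^-1).
  by rewrite gt0_ltr_powR// nnegrE ?invr_ge0 ?powR_ge0// ltW.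
apply/negbTE; rewrite -leNgt.
by rewrite ge0_ler_powR// ?nnegrE ?invr_ge0 ?powR_ge0// ltW.
Qed.

Lemma le_integral_powR (b a t : R) : 0 < b < 1 -> a < t ->
  (\int[mu]_(s in `]a, t[) ((s - a) `^ (- b))%:E <=
    ((t - a) `^ (1 - b) / (1 - b))%:E)%E.
Proof.
move=> /andP[b0 b1] at_.
have mk : measurable_fun setT (fun s : R => ((s - a) `^ (- b))%:E).
  apply/measurable_EFinP; apply: (measurableT_comp (measurable_powR _)).
  exact: measurable_funB.
pose F (n : nat) : set R := [set` `[a + (t - a) / n.+1%:R, t]].
have mF n : measurable (F n) by exact: measurable_itv.
have ndF : nondecreasing_seq F.
  move=> m n mn; apply/subsetPset => x; rewrite /F /= !in_itv /= => /andP[h ->].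
  rewrite andbT (le_trans _ h)// lerD2l ler_wpM2l ?subr_ge0 ?(ltW at_)//.
  by rewrite lef_pV2 ?posrE// ler_nat ltnS.
have sub : `]a, t[ `<=` \bigcup_n F n.
  move=> x /=; rewrite in_itv /= => /andP[ax xt].
  exists (Num.bound ((t - a) / (x - a))) => //.
  rewrite /F /= in_itv /= (ltW xt) andbT -lerBrDl.
  rewrite ler_pdivrMr// mulrC -ler_pdivrMr ?subr_gt0//.
  apply: (le_trans (ltW (archi_boundP _))); last by rewrite ler_nat.
  by rewrite divr_ge0 ?subr_ge0 ?ltW.
apply: (@le_trans _ _ (\int[mu]_(s in \bigcup_n F n) ((s - a) `^ (- b))%:E)%E).
  apply: ge0_subset_integral => //.
  - by apply: bigcup_measurable => n _; exact: mF.
  - exact: measurable_funTS.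
  by move=> x _; rewrite lee_fin powR_ge0.
have H : (\int[mu]_(s in F i) ((s - a) `^ (- b))%:E @[i --> \oo] -->
    \int[mu]_(s in \bigcup_i F i) ((s - a) `^ (- b))%:E)%E.
  apply: ge0_nondecreasing_set_cvg_integral => //.
  - by move=> n; exact: measurable_funTS.
  - by move=> n x _; rewrite lee_fin powR_ge0.
rewrite -(cvg_lim _ H)//; apply: lime_le; first by apply: cvgP H.
apply: nearW => n /=.
pose G s := (s - a) `^ (1 - b) / (1 - b).
have dn : 0 < (t - a) / n.+1%:R by rewrite divr_gt0// subr_gt0.
have Gd s : a < s -> is_derive s (1 : R) G ((s - a) `^ (- b)).
  move=> as_; rewrite /G.
  have sa : 0 < s - a by rewrite subr_gt0.
  have D1 := @is_derive1_powR R (1 - b) (s - a) sa.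
  have D2 : is_derive s 1 (fun s : R => s - a) 1 by exact: is_derive_shift.
  have D3 : is_derive s 1 (fun s => (s - a) `^ (1 - b)) _ :=
    @is_derive1_comp _ _ _ s _ _ D1 D2.
  have D4 := is_deriveZ (1 - b)^-1 D3.
  rewrite [X in is_derive _ _ X _](_ : _ =
      (1 - b)^-1 \*: (fun s => (s - a) `^ (1 - b))); last first.
    by apply/funext => x /=; rewrite mulrC.
  apply: (is_derive_eq D4).
  rewrite mulr1 addrAC subrr add0r /GRing.scale /= mulrA mulVf ?mul1r//.
  by rewrite gt_eqF// subr_gt0.
have aat : a + (t - a) / n.+1%:R <= t.
  by rewrite -lerBrDl ler_pdivrMr// ler_peMr// ?ler1n// subr_ge0 ltW.
move: aat; rewrite le_eqVlt => /orP[/eqP e|aat].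
  rewrite /F e set_itv1 integral_set1 lee_fin divr_ge0 ?powR_ge0//.
  by rewrite subr_ge0 ltW.
have Gd' s : a + (t - a) / n.+1%:R <= s <= t ->
    is_derive s (1 : R) G ((s - a) `^ (- b)).
  by move=> /andP[h _]; apply: Gd; apply: lt_le_trans h; rewrite ltrDl.
rewrite (integral_is_derive aat Gd').
  rewrite lee_fin /G gerBl divr_ge0 ?powR_ge0//.
  by rewrite subr_ge0 ltW.
apply: continuous_in_subspaceT => s.
rewrite inE /= in_itv /= => /andP[h _].
have sa : 0 < s - a.
  by rewrite subr_gt0; apply: lt_le_trans h; rewrite ltrDl.
apply: differentiable_continuous; apply/derivable1_diffP.
have D1 := @is_derive1_powR R (- b) (s - a) sa.
have D2 : is_derive s 1 (fun s : R => s - a) 1 by exact: is_derive_shift.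
by have [] := @is_derive1_comp _ _ _ s _ _ D1 D2.
Qed.

End power_kernel.

Section memory.
Context {R : realType}.
Local Notation mu := (@lebesgue_measure R).

Lemma measurable_staircase m : measurable_fun setT (@staircase R m).
Proof.
apply: measurable_funM => //; apply: measurable_sum => i.
rewrite (_ : (fun x => _) = \1_[set` `]i.+1%:R / m.+1%:R, +oo[]); last first.
  apply/funext => x; rewrite indicE; congr (nat_of_bool _)%:R.
  by apply/idP/idP; rewrite inE/= in_itv/= andbT.
exact: measurable_indic.
Qed.

Lemma Rintegral_oo_cc (f : R -> R) (a b : R) :
  mu.-integrable `[a, b] (EFin \o f) ->
  \int[mu]_(s in `]a, b[) f s = \int[mu]_(s in `[a, b]) f s.
Proof.
move=> fi; have fi' : mu.-integrable `]a, b] (EFin \o f).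
  by apply: integrableS fi => //; apply: subset_itv; rewrite bnd_simp.
rewrite -Rintegral_itv_obnd_cbnd// -Rintegral_itv_bndo_bndc//.
by apply: integrableS fi => //; apply: subset_itv; rewrite bnd_simp.
Qed.

Lemma continuous_integrable_cc (f : R -> R) (a b : R) :
  {within `[a, b], continuous f} -> mu.-integrable `[a, b] (EFin \o f).
Proof. by apply: continuous_compact_integrable; exact: segment_compact. Qed.

Lemma continuous_integrable_oo (f : R -> R) (a b : R) :
  {within `[a, b], continuous f} -> mu.-integrable `]a, b[ (EFin \o f).
Proof.
move=> /continuous_integrable_cc; apply: integrableS => //.
by apply: subset_itv; rewrite bnd_simp.
Qed.

(** The shift pushes mass out of ]0, t[ on the right, and brings in only zeros on
    the left. *)
Lemma integral_shift_le (w : R -> R) (r t : R) : continuous w -> 0 <= r ->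
  (forall s, s <= 0 -> w s = 0) -> (forall s, 0 <= w s) -> 0 < t ->
  \int[mu]_(s in `]0, t[) w (s - r) <= \int[mu]_(s in `]0, t[) w s.
Proof.
move=> cw r0 w0 wge0 t0.
have cwi (a b : R) : mu.-integrable `[a, b] (EFin \o w).
  exact/continuous_integrable_cc/continuous_subspaceT.
have cws : continuous (fun s => w (s - r)).
  move=> s; apply: (@continuous_comp _ _ _ (fun s => s - r) w); last exact: cw.
  by apply: cvgB; [exact: cvg_id|exact: cvg_cst].
have cwsi (a b : R) : mu.-integrable `[a, b] (EFin \o (fun s => w (s - r))).
  exact/continuous_integrable_cc/continuous_subspaceT.
rewrite !Rintegral_oo_cc//.
have sub : (\int[mu]_(s in `[0%R, t]) (w (s - r))%:E =
            \int[mu]_(s in `[(- r)%R, (t - r)%R]) (w s)%:E)%E.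
  have D1 : (fun s : R => s - r)^`()%classic = cst 1.
    apply/funext => x; rewrite derive1E.
    by apply: (@derive_val _ _ _ _ _ _ _ (is_derive_shift x 1 (- r))).
  have := @integration_by_substitution_increasing R (fun s => s - r) w 0 t.
  rewrite D1 sub0r => ->//.
  - by apply: eq_integral => x _ /=; rewrite mulr1.
  - exact: ltW.
  - by move=> x y _ _; rewrite ltrD2r.
  - by move=> x _; exact: cvg_cst.
  - exact: is_cvg_cst.
  - exact: is_cvg_cst.
  - split.
    + by move=> x _; have [] := is_derive_shift x (1 : R) (- r).
    + by apply: cvg_at_right_filter; apply: cvgB; [exact: cvg_id|exact: cvg_cst].
    + by apply: cvg_at_left_filter; apply: cvgB; [exact: cvg_id|exact: cvg_cst].
  - exact: continuous_subspaceT.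
rewrite /Rintegral sub -!/(Rintegral _ _ _).
rewrite Rintegral_mkcond [leRHS]Rintegral_mkcond.
apply: le_Rintegral => //.
- exact/integrable_restrictR.
- exact/integrable_restrictR.
- move=> x _; rewrite !patchE; case: ifPn; case: ifPn => //.
  rewrite !inE /= !notin_setE /= !in_itv /= => /negP.
  rewrite negb_and -!ltNge => /orP[x0 _|tx /andP[_ xt]].
    by rewrite w0// ltW.
  by exfalso; move: xt; rewrite leNgt => /negP; apply; lra.
Qed.

End memory.

Section memory_positivity.
Context {R : realType}.
Local Notation mu := (@lebesgue_measure R).
Variables (T b : R) (p v : R -> R).
Hypotheses (b01 : 0 < b < 1) (ip : mu.-integrable `]0, T[ (EFin \o p)).
Hypotheses (cv : continuous v) (v0 : forall s, s <= 0 -> v s = 0).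
Hypothesis vE : forall t, 0 <= t <= T -> v t = \int[mu]_(s in `]0, t[) p s.
Hypothesis ipk : forall t, 0 < t <= T ->
  mu.-integrable `]0, t[ (EFin \o (fun s => p s * (t - s) `^ (- b))).

Let D t := \int[mu]_(s in `]0, t[) (p s * (t - s) `^ (- b)).

(* D is the memory term of v with the kernel r |-> r `^ (- b), Dm m that with
   the kernel replaced by its m-th staircase; width m i is the point where
   the kernel crosses the i-th level. *)
Let Dm m t := \int[mu]_(s in `]0, t[) (p s * staircase m ((t - s) `^ (- b))).

Let width m i : R := (i.+1%:R / m.+1%:R) `^ (- b^-1).

Let integrable_p t : t <= T -> mu.-integrable `]0, t[ (EFin \o p).
Proof. by move=> tT; apply: integrableS ip => //; apply: subset_itvl. Qed.

Let measurable_kernel t : measurable_fun setT (fun s : R => (t - s) `^ (- b)).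
Proof.
by apply: (measurableT_comp (measurable_powR _)); exact: measurable_funB.
Qed.

Let measurable_stairs t m :
  measurable_fun setT (fun s : R => staircase m ((t - s) `^ (- b))).
Proof.
exact: (measurableT_comp (measurable_staircase _) (measurable_kernel _)).
Qed.

(** An indicator kernel of ]0, r[ integrates p = v' over ]t - r, t[, which gives the
    increment of v; the value 0 of v at negative times accounts for r > t. *)
Lemma memory_staircaseE m t : 0 < t <= T ->
  Dm m t = m.+1%:R^-1 *
    \sum_(i < m.+1 ^ 2) (v t - v (t - width m i)).
Proof.
move=> /andP[t0 tT]; rewrite /Dm.
have ind (i : nat) s : s \in `]0, t[ ->
    (i.+1%:R / m.+1%:R < (t - s) `^ (- b))%R%:R = \1_[set` `]t - width m i, t[] s :> R.
  rewrite in_itv /= => /andP[s0 st].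
  rewrite lt_powRN ?subr_gt0//; last by case/andP: b01.
  rewrite indicE; congr (nat_of_bool _)%:R.
  by apply/idP/idP; rewrite inE /= in_itv /= st andbT; rewrite ltrBlDr ltrBlDl.
have W0 i : 0 < width m i by rewrite powR_gt0// divr_gt0.
have mJ i : measurable_fun setT (\1_[set` `]t - width m i, t[] : R -> R).
  by apply: measurable_indic; exact: measurable_itv.
have int1 i : mu.-integrable `]0, t[
    (EFin \o (fun s => p s * \1_[set` `]t - width m i, t[] s)).
  apply: (@le_norm_integrable _ _ _ mu _ _ (fun s : R => `|p s|)) => //.
  - apply: measurable_funM; last exact: measurable_funTS.
    by apply/measurable_EFinP/measurable_int; exact: integrable_p.
  - by apply: integrable_norm; exact: integrable_p.
  - move=> s _; rewrite normrM ler_piMr// indicE; case: (_ \in _) => /=.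
    + by rewrite normr1.
    + by rewrite normr0.
transitivity (\int[mu]_(s in `]0, t[) (m.+1%:R^-1 *
    \sum_(i < m.+1 ^ 2) (p s * \1_[set` `]t - width m i, t[] s))).
  apply: eq_Rintegral => s; rewrite inE /= => st.
  rewrite /staircase mulrCA mulr_sumr; congr (_ * _).
  by apply: eq_bigr => i _; rewrite ind.
rewrite RintegralZl//; last exact: integrable_sumR.
rewrite Rintegral_sum//; congr (_ * _); apply: eq_bigr => i _.
have v0' : v 0 = 0 by rewrite v0.
have [tw|wt] := ltP t (width m i).
  rewrite (v0 (_ : t - width m i <= 0)); last by rewrite subr_le0 ltW.
  rewrite subr0 vE ?(ltW t0)//; apply: eq_Rintegral => s.
  rewrite inE /= in_itv /= => /andP[s0 st].
  rewrite indicE mem_set ?mulr1//= in_itv /= st andbT.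
  by rewrite (lt_trans _ s0)// subr_lt0.
have tw0 : 0 <= t - width m i by rewrite subr_ge0.
rewrite !vE ?(ltW t0) ?tw0//; last by rewrite (le_trans _ tT)// gerBl ltW.
rewrite [\int[mu]_(s in `]0, t - width m i[) p s]Rintegral_itv_bndo_bndc; last first.
  by apply: integrable_p; rewrite (le_trans _ tT)// gerBl ltW.
rewrite Rintegral_itvB; last 3 first.
- exact: integrable_p.
- by rewrite bnd_simp.
- by rewrite bnd_simp gtrBl.
rewrite [RHS]Rintegral_mkcond [LHS]Rintegral_mkcond.
apply: eq_Rintegral => s _; rewrite !patchE !mem_setE !in_itv /= indicE mem_setE in_itv /=.
case: (ltP s t) => st; rewrite ?andbF//= ?andbT.
case: (ltP (t - width m i) s) => ws; rewrite ?mulr1 ?mulr0.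
  by rewrite (le_lt_trans tw0 ws).
by case: ifP.
Qed.

Lemma memory_staircase_cvg t : 0 < t <= T -> Dm m t @[m --> \oo] --> D t.
Proof.
move=> tT; have [_ tT'] := andP tT.
have [] // := @dominated_cvgR _ _ _ mu `]0, t[
  (fun m s => p s * staircase m ((t - s) `^ (- b)))
  (fun s => p s * (t - s) `^ (- b)) (fun s => `|p s * (t - s) `^ (- b)|).
- move=> m; apply: measurable_funM; last exact: measurable_funTS (measurable_stairs _ _).
  by apply/measurable_EFinP/measurable_int; exact: integrable_p.
- by move=> s ts; apply: cvgMr; apply: cvg_staircase; rewrite powR_ge0.
- by apply: integrable_norm; exact: ipk.
- move=> m s _; rewrite 2!(normrM (p s)) ler_wpM2l//.
  rewrite (ger0_norm (staircase_ge0 _ _)) (ger0_norm (powR_ge0 _ _)).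
  by have [] := @staircase_bounds R m ((t - s) `^ (- b)); rewrite ?powR_ge0.
Qed.

Let sqv_continuous : continuous (fun s => v s ^+ 2).
Proof. by move=> s; apply: cvg_sqr; exact: cv. Qed.

Let shift_continuous r : continuous (fun s => v (s - r)).
Proof.
move=> s; apply: (@continuous_comp _ _ _ (fun s => s - r) v); last exact: cv.
by apply: cvgB; [exact: cvg_id|exact: cvg_cst].
Qed.

Let cont_int (f : R -> R) t : continuous f -> mu.-integrable `]0, t[ (EFin \o f).
Proof. by move=> cf; exact/continuous_integrable_oo/continuous_subspaceT. Qed.

(** From 2 a (a - b) >= a^2 - b^2 and the fact that shifting decreases the integral
    of v^2. When r exceeds t, the shifted value is 0 and nothing is lost:
    these terms provide the coercive part of memory_energy. *)
Lemma increment_energy r t : 0 < r -> 0 < t ->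
  (t < r)%R%:R * \int[mu]_(s in `]0, t[) (v s ^+ 2) <=
  \int[mu]_(s in `]0, t[) (v s * (v s - v (s - r))).
Proof.
move=> r0 t0; have [tr|rt] := ltP t r.
  rewrite mul1r le_eqVlt; apply/orP; left; apply/eqP.
  apply: eq_Rintegral => s; rewrite inE /= in_itv /= => /andP[_ st].
  by rewrite [v (s - r)]v0 ?subr0// subr_le0 ltW// (lt_trans st).
rewrite mul0r.
have c2 : continuous (fun s => v (s - r) ^+ 2).
  by move=> s; apply: cvg_sqr; exact: shift_continuous.
have H := @integral_shift_le R (fun s => v s ^+ 2) r t sqv_continuous (ltW r0) _ _ t0.
have {}H : \int[mu]_(s in `]0, t[) (v (s - r) ^+ 2) <=
    \int[mu]_(s in `]0, t[) (v s ^+ 2).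
  apply: H => [s s0|s]; first by rewrite v0// expr0n.
  exact: sqr_ge0.
apply: (@le_trans _ _ (\int[mu]_(s in `]0, t[) (2^-1 *
    (v s ^+ 2 - v (s - r) ^+ 2)))).
  rewrite RintegralZl//; last by apply: integrableBR => //; exact: cont_int.
  rewrite RintegralB//; [|exact: cont_int|exact: cont_int].
  by rewrite mulr_ge0// subr_ge0.
apply: le_Rintegral => //.
- by apply: integrableZlR => //; apply: integrableBR => //; exact: cont_int.
- apply: cont_int => s; apply: cvgM; first exact: cv.
  by apply: cvgB; [exact: cv|exact: shift_continuous].
- move=> s _; have := sqr_ge0 (v s - v (s - r)); nra.
Qed.

(** The levels lying below the value of the kernel at t are crossed at points beyond
    t; their number, normalized, is the staircase at t `^ (- b). *)
Lemma memory_staircase_energy m t : 0 < t <= T ->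
  staircase m (t `^ (- b)) * \int[mu]_(s in `]0, t[) (v s ^+ 2) <=
  \int[mu]_(s in `]0, t[) (v s * Dm m s).
Proof.
move=> /andP[t0 tT]; rewrite /staircase -mulrA mulr_suml.
have ci i : continuous (fun s => v s * (v s - v (s - width m i))).
  move=> s; apply: cvgM; first exact: cv.
  by apply: cvgB; [exact: cv|exact: shift_continuous].
have -> : \int[mu]_(s in `]0, t[) (v s * Dm m s) =
    \int[mu]_(s in `]0, t[) (m.+1%:R^-1 *
      \sum_(i < m.+1 ^ 2) (v s * (v s - v (s - width m i)))).
  apply: eq_Rintegral => s; rewrite inE /= in_itv /= => /andP[s0 st].
  rewrite memory_staircaseE ?s0 ?(le_trans (ltW st))// mulrCA mulr_sumr.
  by [].
rewrite RintegralZl//; last first.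
  by apply: integrable_sumR => // i; exact: cont_int.
rewrite Rintegral_sum//; last by move=> i; exact: cont_int.
rewrite ler_wpM2l ?invr_ge0//; apply: ler_sum => i _.
rewrite lt_powRN//; last by case/andP: b01.
by apply: increment_energy => //; rewrite powR_gt0// divr_gt0.
Qed.

(** By Tonelli the inner integrals are dominated by the L^1 norm of p times the
    integral of the kernel; this is the dominating function that allows the
    staircase to be refined under the integral of v * Dm. *)
Lemma memory_dominated t : 0 < t <= T -> mu.-integrable `]0, t[
  (EFin \o (fun s => \int[mu]_(r in `]0, s[) `|p r * (s - r) `^ (- b)|)).
Proof.
move=> /andP[t0 tT].
pose q : R -> R := p \_ `]0, t[.
have iq : mu.-integrable setT (EFin \o q).
  by apply: integrable_restrictR => //; exact: integrable_p.
have mq : measurable_fun setT q.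
  by apply/measurable_EFinP; exact: (measurable_int mu iq).
pose k (r : R) : R := r `^ (- b) * \1_[set` `]0, +oo[] r.
have mk : measurable_fun setT k.
  apply: measurable_funM; first exact: measurable_powR.
  by apply: measurable_indic; exact: measurable_itv.
have k0 r : 0 <= k r by rewrite mulr_ge0 ?powR_ge0.
pose H (z : R * R) : \bar R :=
  (`|q z.2| * k (z.1 - z.2) * \1_[set` `]0, t[] z.1)%:E.
have mq' : measurable_fun setT (fun r : R => `|(q r)%:E|%E).
  by apply: measurableT_comp => //; exact/measurable_EFinP.
have H0 z : (0 <= H z)%E by rewrite lee_fin; apply: mulr_ge0 => //; apply: mulr_ge0.
have mH : measurable_fun setT H.
  apply/measurable_EFinP; apply: measurable_funM; last first.
    by apply: measurableT_comp.
  apply: measurable_funM.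
    apply: measurableT_comp => //; exact: (measurableT_comp mq measurable_snd).
  by apply: (measurableT_comp mk); exact: measurable_funB.
have HE s : s \in `]0, t[ ->
    (\int[mu]_r H (s, r) =
     \int[mu]_(r in `]0%R, s[) (`|p r * (s - r) `^ (- b)|%R)%:E)%E.
  rewrite in_itv /= => /andP[s0 st].
  rewrite [RHS]integral_mkcond; apply: eq_integral => r _.
  rewrite /H /= indicE mem_set ?mulr1; last by rewrite /= in_itv /= s0.
  rewrite /q /k !patchE indicE !mem_setE !in_itv /= andbT subr_gt0.
  have [rs|sr] := ltP r s; rewrite ?mulr0 ?andbF ?andbT ?mulr1//.
  rewrite (lt_trans rs st) andbT; case: (0 < r).
    by rewrite normrM [X in _ = (_ * X)%:E]ger0_norm ?powR_ge0.
  by rewrite normr0 mul0r.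
pose C := t `^ (1 - b) / (1 - b).
have C0 : 0 <= C by rewrite divr_ge0 ?powR_ge0// subr_ge0; case/andP: b01 => _ /ltW.
have Hfin : (\int[mu]_s \int[mu]_r H (s, r) < +oo)%E.
  have -> : (\int[mu]_s \int[mu]_r H (s, r) = \int[mu]_r \int[mu]_s H (s, r))%E.
    exact: (@fubini_tonelli _ _ _ _ _ mu mu H mH H0).
  apply: (@le_lt_trans _ _ (\int[mu]_r (C%:E * `|(q r)%:E|))%E); last first.
    rewrite ge0_integralZl//.
    by have /integrableP[_ ?] := iq; rewrite lte_mul_pinfty.
  apply: ge0_le_integral => //.
  - by move=> r _; apply: integral_ge0.
  - exact: (@measurable_fun_fubini_tonelli_G _ _ _ _ _ mu H mH H0).
  - exact: measurable_funeM.
  move=> r _; have [rt|] := boolP (r \in [set` `]0, t[]); last first.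
    move=> rt; rewrite integral0_eq; first by rewrite mule_ge0// lee_fin.
    by move=> s _; rewrite /H /q /= patchE (negbTE rt) normr0 !mul0r.
  move: (rt); rewrite inE /= in_itv /= => /andP[r0 rlt].
  have -> : (\int[mu]_s H (s, r) =
             \int[mu]_(s in `]r, t[) (`|q r|%:E * ((s - r) `^ (- b))%:E))%E.
    rewrite [RHS]integral_mkcond; apply: eq_integral => s _.
    rewrite /H /= patchE /k !indicE !mem_setE !in_itv /= andbT subr_gt0.
    have [rs|sr] := ltP r s; rewrite ?mulr0 ?mul0r//.
    by rewrite (lt_trans r0 rs) /=; case: (s < t); rewrite ?mulr1 ?mulr0// EFinM.
  rewrite ge0_integralZl//; last 2 first.
  - apply/measurable_EFinP/measurable_funTS.
    by apply: (measurableT_comp (measurable_powR _)); exact: measurable_funB.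
  - by move=> s _; rewrite lee_fin powR_ge0.
  rewrite muleC lee_wpmul2r ?lee_fin//.
  apply: (le_trans (le_integral_powR b01 rlt)).
  rewrite lee_fin ler_wpM2r//.
    by rewrite invr_ge0 subr_ge0; case/andP: b01 => _ /ltW.
  apply: ge0_ler_powR; rewrite ?nnegrE ?subr_ge0 ?(ltW rlt) ?(ltW t0)//.
    by case/andP: b01 => _ /ltW.
  by rewrite gerBl ltW.
have dE s : s \in `]0, t[ ->
    ((\int[mu]_(r in `]0, s[) `|p r * (s - r) `^ (- b)|)%:E =
     \int[mu]_r H (s, r))%E.
  move=> st; rewrite HE// /Rintegral fineK//.
  move: st; rewrite in_itv /= => /andP[s0 st].
  have := integrable_norm (ipk (t := s) _); rewrite s0 (le_trans (ltW st))//.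
  by move=> /(_ isT) h; exact: (integrable_fin_num _ h).
apply: (@eq_integrable _ _ _ mu _ _ (fun s => \int[mu]_r H (s, r))%E) => //.
  by move=> s; rewrite inE /= => st; rewrite /= dE.
apply: (@integrableS _ _ _ mu setT) => //.
apply/integrableP; split; first exact: (@measurable_fun_fubini_tonelli_F _ _ _ _ _ mu H mH H0).
apply: le_lt_trans Hfin; rewrite le_eqVlt; apply/orP; left; apply/eqP.
by apply: eq_integral => s _; rewrite gee0_abs// integral_ge0.
Qed.

(** The memory term dissipates energy, quantitatively: only t `^ (- b), the smallest
    value of the kernel on ]0, t[, is retained in the limit of
    memory_staircase_energy. *)
Lemma memory_energy t : 0 < t <= T ->
  mu.-integrable `]0, t[ (EFin \o (fun s => v s * D s)) /\
  t `^ (- b) * \int[mu]_(s in `]0, t[) (v s ^+ 2) <=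
  \int[mu]_(s in `]0, t[) (v s * D s).
Proof.
move=> /[dup] tT /andP[t0 tT'].
have cnv : continuous (fun s => `|v s|) by move=> s; apply: cvg_norm; exact: cv.
have [c _ vc] := EVT_max (ltW t0) (continuous_subspaceT cnv).
have sT s : s \in `]0, t[ -> 0 < s <= T.
  by rewrite in_itv /= => /andP[-> st]; rewrite (le_trans (ltW st)).
have [|||||iD cD] := @dominated_cvgR _ _ _ mu `]0, t[
  (fun m s => v s * Dm m s) (fun s => v s * D s)
  (fun s => `|v c| * \int[mu]_(r in `]0, s[) `|p r * (s - r) `^ (- b)|).
- exact: measurable_itv.
- move=> m; apply: (@eq_measurable_fun _ _ _ _ _ (fun s => v s * (m.+1%:R^-1 *
      \sum_(i < m.+1 ^ 2) (v s - v (s - width m i))))).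
    by move=> s; rewrite inE /= => st; rewrite memory_staircaseE// sT.
  apply: measurable_funTS; apply: measurable_funM.
    exact: continuous_measurable_fun.
  apply: measurable_funM => //; apply: measurable_sum => i.
  apply: measurable_funB; first exact: continuous_measurable_fun.
  apply: continuous_measurable_fun; exact: shift_continuous.
- by move=> s /= st; apply: cvgMr; exact/memory_staircase_cvg/sT.
- apply: integrableZlR => //; exact: memory_dominated.
- move=> m s /= st; rewrite normrM ler_pM//.
    by apply: vc; apply: subset_itv_oo_cc.
  have ist : mu.-integrable `]0, s[ (EFin \o (fun r => p r * (s - r) `^ (- b))).
    exact/ipk/sT.
  have ss r : `|p r * staircase m ((s - r) `^ (- b))| <=
      `|p r * (s - r) `^ (- b)|.
    rewrite 2!(normrM (p r)) ler_wpM2l//.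
    rewrite (ger0_norm (staircase_ge0 _ _)) (ger0_norm (powR_ge0 _ _)).
    by have [] := @staircase_bounds R m ((s - r) `^ (- b)); rewrite ?powR_ge0.
  have ism : mu.-integrable `]0, s[
      (EFin \o (fun r => p r * staircase m ((s - r) `^ (- b)))).
    apply: (le_norm_integrable _ _ (integrable_norm ist)) => //.
    apply: measurable_funM; last exact: measurable_funTS (measurable_stairs _ _).
    apply/measurable_EFinP/measurable_int; apply: integrable_p.
    by have /andP[] := sT _ st.
  apply: (le_trans (le_normr_Rintegral _ ism)) => //.
  by apply: le_Rintegral => //; exact: integrable_norm.
split => //.
have cL : staircase m (t `^ (- b)) * \int[mu]_(s in `]0, t[) (v s ^+ 2)
    @[m --> \oo] --> t `^ (- b) * \int[mu]_(s in `]0, t[) (v s ^+ 2).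
  by apply: cvgMl; apply: cvg_staircase; rewrite powR_ge0.
apply: (ler_cvg_to cL cD); apply: nearW => m.
exact: memory_staircase_energy.
Qed.

(** The memory term is an integral of p against the kernel, yet it is a limit of
    normalized sums of increments of v, all of which vanish. *)
Lemma memory_eq0 t : (forall s, v s = 0) -> 0 < t <= T -> D t = 0.
Proof.
move=> vz tT; have := @memory_staircase_cvg t tT.
under eq_fun do rewrite memory_staircaseE//.
under eq_fun do under eq_bigr do rewrite !vz subrr.
under eq_fun do rewrite big1// mulr0.
by move=> /cvg_lim <-//; rewrite lim_cst.
Qed.

End memory_positivity.

(** The real value of a divergent integral is 0, so convergence comes first: near 0
    it is that of the power kernel and at infinity that of the exponential
    density. Then the integrand is at least e^(-1) on ]0, 1[. *)
Lemma Gamma_gt0 (R : realType) (z : R) : 0 < z < 1 -> 0 < Gamma z.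
Proof.
move=> /andP[z0 z1]; rewrite /Gamma.
pose mu := @lebesgue_measure R.
pose f (t : R) := t `^ (z - 1) * expR (- t).
have mf : measurable_fun setT f.
  apply: measurable_funM; first exact: measurable_powR.
  by apply: measurableT_comp.
have ik : mu.-integrable `]0, 1[ (EFin \o (fun t => t `^ (z - 1))).
  apply/integrableP; split.
    by apply/measurable_EFinP/measurable_funTS; exact: measurable_powR.
  under eq_integral do rewrite /= ger0_norm ?powR_ge0//.
  have b01 : 0 < 1 - z < 1 by rewrite subr_gt0 z1 ltrBlDl ltrDr.
  apply: (le_lt_trans _ (le_lt_trans (le_integral_powR b01 ltr01) (ltry _))).
  rewrite le_eqVlt; apply/orP; left; apply/eqP.
  by apply: eq_integral => t _; rewrite subr0 opprB.
have ig : mu.-integrable `]0, +oo[ (EFin \o (fun t =>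
    ((fun t => t `^ (z - 1)) \_ `]0, 1[) t + exponential_pdf 1 t)).
  apply: (@integrableS _ _ _ mu setT) => //; apply: integrableDR => //.
    exact: integrable_restrictR.
  exact: integrable_exponential_pdf.
have if_ : mu.-integrable `]0, +oo[ (EFin \o f).
  apply: (le_norm_integrable _ _ ig) => //; first exact: measurable_funTS.
  move=> t; rewrite /= in_itv /= andbT => t0.
  rewrite exponential_pdfE ?(ltW t0)// mul1r mulN1r patchE mem_setE in_itv /= t0.
  rewrite ger0_norm ?mulr_ge0 ?powR_ge0 ?expR_ge0//.
  have [t1|t1] := ltP t 1.
    apply: (@le_trans _ _ (t `^ (z - 1))); last by rewrite lerDl expR_ge0.
    by rewrite ler_piMr ?powR_ge0// expR_le1// oppr_le0 ltW.
  rewrite /point /= add0r ler_piMl ?expR_ge0//.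
  by rewrite -[leRHS](powRr0 t) ler_powR// subr_le0 ltW.
apply: (@lt_le_trans _ _ (\int[mu]_(t in `]0, +oo[) (cst (expR (- 1)) \_ `]0, 1[) t)).
  rewrite -Rintegral_mkcondr setIidr; last by apply: subset_itvl; rewrite bnd_simp.
  rewrite Rintegral_cst//.
  have m01 : lebesgue_measure [set` `]0, 1[] = 1%E :> \bar R.
    by rewrite lebesgue_measure_itv /= lte_fin ltr01 oppr0 adde0.
  by rewrite [X in _ * X](congr1 fine m01) mulr1 expR_gt0.
apply: le_Rintegral => //.
  apply: (@integrableS _ _ _ mu setT) => //; apply: integrable_restrictR => //.
  by apply/continuous_integrable_oo/continuous_subspaceT => ?; exact: cvg_cst.
move=> t; rewrite /= in_itv /= andbT => t0.
rewrite patchE; case: ifPn => [t1|_]; last first.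
  by rewrite /point /= mulr_ge0 ?powR_ge0 ?expR_ge0.
move: t1; rewrite inE /= in_itv /= => /andP[_ t1].
rewrite /f /= -[leLHS]mul1r ler_pM ?expR_ge0//; last first.
  by rewrite ler_expR lerN2 ltW.
rewrite -opprB powRN invf_ge1 ?powR_gt0//
  -[leRHS](congr1 (fun f => f (1 - z)) (powR1 R)).
by rewrite ge0_ler_powR ?nnegrE ?subr_ge0 ?ler01// ltW.
Qed.

(** * Lebesgue measure on row vectors *)

Section tuple_vectors.
Context {R : realType} {n : nat}.
Local Notation Rn := 'rV[R]_n.
Local Notation tup := (n.-tuple (measurableTypeR R)).
Local Notation toV := (@rV_of_tuple R n).

Lemma ball_rV (x y : Rn) (e : R) : 0 < e ->
  (forall i, `|x 0 i - y 0 i| < e) -> ball x e y.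
Proof. by move=> e0 H; split=> // i j; rewrite !ord1; exact: H. Qed.

Lemma ball_rV_coord (x y : Rn) (e : R) i : ball x e y -> `|x 0 i - y 0 i| < e.
Proof. by move=> [_ /(_ 0 i)]. Qed.

Lemma toVE (t : tup) i : toV t 0 i = tnth t i.
Proof. by rewrite mxE. Qed.

Lemma measurable_box (A : 'I_n -> set (measurableTypeR R)) : (forall i, measurable (A i)) ->
  measurable [set t : tup | forall i, A i (tnth t i)].
Proof.
move=> mA; rewrite (_ : mkset _ = \bigcap_(i in [set: 'I_n])
    ((@tnth _ _ ^~ i) @^-1` A i)); last first.
  by apply/seteqP; split => t /= At i => [_|]; exact: At.
apply: fin_bigcap_measurable => // i _.
by rewrite -[X in measurable X]setTI; exact: measurable_tnth.
Qed.

Lemma measurable_dist_lt (a d : R) : measurable [set y : R | `|y - a| < d].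
Proof.
rewrite (_ : mkset _ = ball a d); first exact: measurable_ball.
by apply/seteqP; split => y; rewrite /ball /= distrC.
Qed.

(** An open set is the countable union of the rational boxes that it contains. *)
Lemma open_measurable_rV (U : set Rn) : open U -> measurable (toV @^-1` U).
Proof.
move=> oU.
pose box (z : 'rV[rat]_n * nat) : set tup := [set t | forall i,
  [set y : R | `|y - ratr (z.1 0 i)| < z.2.+1%:R^-1] (tnth t i)].
pose F (j : nat) : set tup := if unpickle j is Some z then
  (if pselect (box z `<=` toV @^-1` U) then box z else set0) else set0.
have -> : toV @^-1` U = \bigcup_j F j.
  apply/seteqP; split => [t /= Ut|t [j _]]; last first.
    by rewrite /F; case: (unpickle j) => // z; case: pselect => //= h /h.
  have := oU; rewrite openE => /(_ _ Ut) /nbhs_ballP[e /= e0 eU].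
  pose k := Num.bound (2 / e).
  have k0 : 0 < k.+1%:R^-1 :> R by rewrite invr_gt0.
  have ke : 2 * k.+1%:R^-1 < e.
    rewrite ltr_pdivrMr// mulrC -ltr_pdivrMr//.
    apply: (lt_le_trans (archi_boundP _)); first by rewrite divr_ge0// ltW.
    by rewrite ler_nat.
  have [i|q qP] := @choice _ _
      (fun (i : 'I_n) (q : rat) => `|tnth t i - ratr q| < k.+1%:R^-1).
    have : tnth t i - k.+1%:R^-1 < tnth t i + k.+1%:R^-1.
      by rewrite ltrBlDr -addrA ltrDl addr_gt0.
    move=> /rat_in_itvoo[q]; rewrite in_itv /= => qt.
    by exists q; rewrite distrC ltr_distl.
  exists (pickle ((\row_i q i)%R : 'rV[rat]_n, k)) => //; rewrite /F pickleK.
  case: pselect => [_ i /=|[]]; first by rewrite mxE.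
  move=> s /= bs; apply: eU; apply: ball_rV => // i; rewrite !toVE.
  have := bs i; rewrite /= mxE distrC => bsi.
  apply: (le_lt_trans (ler_distD (ratr (q i)) _ _)); apply: le_lt_trans ke.
  by rewrite mulr_natl mulr2n lerD// ltW.
apply: bigcup_measurable => j _; rewrite /F; case: (unpickle j) => // z.
case: (pselect (box z `<=` toV @^-1` U)) => //= _.
apply: (@measurable_box (fun i => [set y : R | `|y - ratr (z.1 0 i)| < z.2.+1%:R^-1])) => i.
exact: measurable_dist_lt.
Qed.

Lemma measurable_continuous_rV (U : set Rn) (f : Rn -> R) : open U ->
  (forall x, U x -> {for x, continuous f}) ->
  measurable_fun (toV @^-1` U) (f \o toV).
Proof.
move=> oU cf; apply: (measurability _ (RGenOpens.measurableE R)).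
move=> _ [_ [a [b ->] <-]].
rewrite (_ : _ `&` _ = toV @^-1` (U `&` f @^-1` `]a, b[)) //.
apply: open_measurable_rV; rewrite openE => x [Ux fx].
apply: filterI; first by move: oU; rewrite openE; exact.
by apply: (cf _ Ux); apply: open_nbhs_nbhs; split => //; exact: interval_open.
Qed.

Definition cube (K : R) : set tup :=
  [set t | forall i, [set` `[- K, K]] (tnth t i)].

Lemma measurable_cube K : measurable (cube K).
Proof. exact: (@measurable_box (fun=> [set` `[- K, K]])). Qed.

Lemma cube_finite K : (lebesgue_tuple R n (cube K) < +oo)%E.
Proof.
rewrite (@lebesgue_tuple_box R n (fun=> [set` `[- K, K]])) //.
suff : (0 <= \prod_(i < n) lebesgue_measure [set` `[(- K)%R, K]] < +oo)%E.
  by case/andP.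
elim/big_ind : _ => [|x y /andP[x0 xy] /andP[y0 yy]|i _].
- by rewrite lee_fin ler01 ltry.
- by rewrite mule_ge0//= lte_mul_pinfty// ge0_fin_numE.
- rewrite measure_ge0 lebesgue_measure_itv /= lte_fin.
  by case: ifP => _ //; rewrite -EFinB ltry.
Qed.

Lemma norm_coord (x : Rn) i : `|x 0 i| <= `|x|.
Proof. by rewrite [leRHS]/Num.norm /= mx_normrE; apply: (le_bigmax _ _ (0, i)). Qed.

Lemma bounded_in_cube (U : set Rn) : bounded_set U ->
  exists2 K, 0 <= K & forall x, U x -> forall i, `|x 0 i| <= K.
Proof.
move=> [M [_ MU]]; exists (`|M| + 1); first by rewrite addr_ge0.
move=> x Ux i; apply: (le_trans (norm_coord _ _)); apply: MU => //.
by rewrite (le_lt_trans (ler_norm M))// ltrDl.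
Qed.

Lemma bounded_rV_finite (U : set Rn) : bounded_set U ->
  measurable (toV @^-1` U) -> (lebesgue_tuple R n (toV @^-1` U) < +oo)%E.
Proof.
move=> /bounded_in_cube[K K0 UK] mU; apply: le_lt_trans (cube_finite K).
apply: le_measure; rewrite ?inE//; first exact: measurable_cube.
by move=> t /= Ut i; have := UK _ Ut i; rewrite toVE /= in_itv /= ler_norml.
Qed.
End tuple_vectors.

(** * Integration along one coordinate *)

Section slices.
Context {R : realType}.
Local Notation mu := (@lebesgue_measure R).
Local Notation tup n := (n.-tuple (measurableTypeR R)).

Definition tuple_set n (t : tup n) (i : 'I_n) (x : R) : tup n :=
  [tuple if j == i then x else tnth t j | j < n].

Lemma tnth_tuple_set n (t : tup n) i x j :
  tnth (tuple_set t i x) j = if j == i then x else tnth t j.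
Proof. by rewrite tnth_mktuple. Qed.

Lemma tuple_set_cons0 n (x y : R) (t : tup n) :
  tuple_set (tuple_cons (y, t)) ord0 x = tuple_cons (x, t) :> tup n.+1.
Proof.
apply: eq_from_tnth => j; rewrite tnth_tuple_set.
have [k ->|->] := unliftP ord0 j; last by rewrite eqxx.
by rewrite eq_sym (negbTE (neq_lift _ _)) !tnthS.
Qed.

Lemma tuple_set_consS n (x y : R) (t : tup n) (i : 'I_n) :
  tuple_set (tuple_cons (y, t)) (lift ord0 i) x =
  tuple_cons (y, tuple_set t i x) :> tup n.+1.
Proof.
apply: eq_from_tnth => j; rewrite tnth_tuple_set.
have [k ->|->] := unliftP ord0 j; last by rewrite (negbTE (neq_lift _ _)).
by rewrite (inj_eq lift_inj) !tnthS tnth_tuple_set.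
Qed.

Lemma integral_tuple_cons n (G : tup n.+1 -> \bar R) :
  (mu \x lebesgue_tuple R n)%E.-integrable setT (G \o @tuple_cons _ n) ->
  measurable_fun setT G ->
  (\int[lebesgue_tuple R n.+1]_t G t =
   \int[mu \x lebesgue_tuple R n]_z G (tuple_cons z))%E.
Proof.
move=> iG mG.
have mc := @measurable_tuple_cons R n.
by rewrite (@integral_pushforward _ _ _ _ _ _ mc _ setT G mG)// preimage_setT.
Qed.

(** A class of integrable functions stable under fixing the first coordinate, as required
    by the induction on the dimension in integral_eq0_slices. *)
Definition box_supported n (K C : R) (G : tup n -> R) :=
  [/\ measurable_fun setT G, forall t, `|G t| <= C &
      forall t i, K < `|tnth t i| -> G t = 0].

Lemma box_supported_integrable n K C (G : tup n -> R) : box_supported K C G ->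
  (lebesgue_tuple R n).-integrable setT (EFin \o G).
Proof.
move=> [mG bG sG].
have mB := @measurable_cube R n K.
have -> : G = G \_ (cube K).
  apply/funext => t; rewrite patchE; case: ifPn => //; rewrite notin_setE /cube /=.
  move=> /existsNP[i]; rewrite /= in_itv /= -ler_norml => /negP.
  by rewrite -ltNge => /sG.
apply: integrable_restrictR => //.
apply: (bounded_integrableR mB (cube_finite K)) => //.
exact: measurable_funTS.
Qed.

(** Fubini, by induction on the number of coordinates: the product measure is built by
    adding coordinates in front, so the i-th one is reached by peeling
    off those before it. *)
Lemma integral_eq0_slices n K C (G : tup n -> R) (i : 'I_n) :
  box_supported K C G ->
  (forall t, \int[mu]_x (G (tuple_set t i x))%:E = 0)%E ->
  (\int[lebesgue_tuple R n]_t (G t)%:E = 0)%E.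
Proof.
elim: n i G => [[] //|n IH] i G bG slice.
have iG := box_supported_integrable bG.
have [mG CG sG] := bG.
have mcons : measurable_fun setT (G \o @tuple_cons (measurableTypeR R) n).
  exact: (measurableT_comp mG measurable_tuple_cons).
have iGc : (mu \x lebesgue_tuple R n)%E.-integrable setT
    (EFin \o (G \o @tuple_cons (measurableTypeR R) n)).
  apply/integrableP; split; first exact/measurable_EFinP.
  have mc := @measurable_tuple_cons R n.
  have /integrableP[_] := iG; apply: le_lt_trans.
  have mnG : measurable_fun setT (fun t => `|(EFin \o G) t|%E).
    by apply: measurableT_comp => //; exact/measurable_EFinP.
  by rewrite (@ge0_integral_pushforward _ _ _ _ _ _ mc _ setT _ measurableT mnG).
rewrite integral_tuple_cons//; last exact/measurable_EFinP.
have [j|] := unliftP ord0 i => ei; subst i.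
  rewrite -(integral12_prod_meas1 iGc) integral0_eq// => x _.
  apply: (IH j (fun t => G (tuple_cons (x, t)))).
    split.
    - apply: (measurableT_comp mG).
      apply: (measurableT_comp measurable_tuple_cons).
      exact: measurable_pair1.
    - by move=> t; exact: CG.
    - move=> t k Kt; apply: (sG _ (lift ord0 k)); by rewrite tnthS.
  move=> t; rewrite -[RHS](slice (tuple_cons (x, t))).
  by apply: eq_integral => y _; rewrite tuple_set_consS.
rewrite -(integral21_prod_meas1 iGc) integral0_eq// => t _.
rewrite /fubini_G -[RHS](slice (tuple_cons (0, t))).
by apply: eq_integral => y _; rewrite tuple_set_cons0.
Qed.

End slices.

(** * Nonnegative continuous functions with zero integral *)

Section positivity.
Context {R : realType} {n : nat}.
Local Notation Rn := 'rV[R]_n.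
Local Notation toV := (@rV_of_tuple R n).
Local Notation lam := (lebesgue_tuple R n).

Lemma open_measure_gt0 (U : set Rn) x : open U -> U x -> (0 < lam (toV @^-1` U))%E.
Proof.
move=> oU Ux; have := oU; rewrite openE => /(_ _ Ux) /nbhs_ballP[e /= e0 eU].
pose A (i : 'I_n) : set (measurableTypeR R) := [set` `]x 0 i - e, x 0 i + e[].
have mA i : measurable (A i) by exact: measurable_itv.
apply: (@lt_le_trans _ _ (lam [set t | forall i, A i (tnth t i)])); last first.
  apply: le_measure; rewrite ?inE.
  - exact: measurable_box.
  - exact: open_measurable_rV.
  - move=> t /= At; apply: eU; apply: ball_rV => // i; rewrite toVE ltr_distlC.
    by have := At i; rewrite /A /= in_itv.
rewrite lebesgue_tuple_box//.
elim/big_ind : _ => [|a b|i _]; first by rewrite lte_fin ltr01.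
  exact: mule_gt0.
rewrite /A lebesgue_measure_itv /= lte_fin ifT; last by rewrite ltrBlDr -addrA ltrDl addr_gt0.
by rewrite -EFinB lte_fin subr_gt0 ltrBlDr -addrA ltrDl addr_gt0.
Qed.

Lemma continuous_integral_eq0 (U : set Rn) (f : Rn -> R) : open U -> bounded_set U ->
  (forall x, U x -> {for x, continuous f}) -> (forall x, U x -> 0 <= f x) ->
  lam.-integrable (toV @^-1` U) (EFin \o (f \o toV)) ->
  integral_Rn U f <= 0 -> forall x, U x -> f x = 0.
Proof.
move=> oU bU cf f0 intf If x Ux; apply/eqP; rewrite eq_le f0// andbT leNgt.
apply/negP => fx0; pose V := U `&` [set y | f x / 2 < f y].
have fx2 : f x / 2 < f x by rewrite ltr_pdivrMr// mulr_natr mulr2n ltrDl.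
have Vx : V x by split.
have oV : open V.
  rewrite openE => y [Uy fy]; apply: filterI.
    by move: oU; rewrite openE; exact.
  by apply: (cvgr_gt (f y) (cf _ Uy)).
have mV := open_measurable_rV oV; have mU := open_measurable_rV oU.
have VU : toV @^-1` V `<=` toV @^-1` U by move=> t [].
have fin : (lam (toV @^-1` V) < +oo)%E.
  apply: (le_lt_trans _ (bounded_rV_finite bU mU)).
  by apply: le_measure => //; rewrite inE.
have : 0 < integral_Rn U f; last by rewrite ltNge If.
apply: (@lt_le_trans _ _ (\int[lam]_(t in toV @^-1` V) (f x / 2))).
  rewrite Rintegral_cst// mulr_gt0 ?divr_gt0//.
  by rewrite fine_gt0// fin andbT; exact: open_measure_gt0 Vx.
apply: (@le_trans _ _ (\int[lam]_(t in toV @^-1` V) f (toV t))).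
  apply: le_Rintegral => //.
  - apply: (bounded_integrableR (C := `|f x / 2|)) => //; exact: measurable_cst.
  - exact: integrableS intf.
  - by move=> t [Ut /= ft]; exact: ltW.
rewrite /integral_Rn Rintegral_mkcond [leRHS]Rintegral_mkcond.
apply: le_Rintegral => //.
- by apply: integrable_restrictR => //; exact: integrableS intf.
- exact: integrable_restrictR.
- move=> t _; rewrite !patchE; case: ifPn; case: ifPn => //.
  + by rewrite notin_setE => nU; rewrite inE => /VU.
  + by rewrite inE => Ut _; exact: f0.
Qed.

End positivity.

(** * Compactly supported functions *)

Lemma is_derive_line (R : realType) (V : normedModType R) (f : V -> R) (y v : V)
  (x : R) : derivable f (y + x *: v) v ->
  is_derive x (1 : R) (fun s : R => f (y + s *: v)) ('D_v f (y + x *: v)).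
Proof.
have e : (fun h : R => h^-1 *: (((fun s : R => f (y + s *: v)) \o shift x) (h *: (1 : R)) -
    f (y + x *: v))) =
    (fun h : R => h^-1 *: ((f \o shift (y + x *: v)) (h *: v) - f (y + x *: v))).
  apply/funext => h /=; congr (_ *: (f _ - _)).
  by rewrite [h%:A]mulr1 scalerDl addrCA.
by move=> df; apply: DeriveDef; rewrite /derivable /derive e.
Qed.

Lemma line_continuous (R : realType) (V : normedModType R) (y v : V) :
  continuous (fun s : R => y + s *: v).
Proof.
by move=> s; apply: cvgD; [exact: cvg_cst|apply: cvgZr_tmp; exact: cvg_id].
Qed.

Lemma continuous_on_line (R : realType) (V : normedModType R) (f : V -> R)
  (y v : V) : continuous f -> continuous (fun s : R => f (y + s *: v)).
Proof.
move=> cf s; apply: (@cvg_comp _ _ _ (fun x : R => y + x *: v) f _ _ _ _ (cf _)).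
exact: line_continuous.
Qed.

Section compact_support.
Context {R : realType} {n : nat}.
Local Notation Rn := 'rV[R]_n.
Local Notation toV := (@rV_of_tuple R n).
Local Notation lam := (lebesgue_tuple R n).
Local Notation mu := (@lebesgue_measure R).

Lemma toV_set (t : n.-tuple (measurableTypeR R)) (i : 'I_n) (x : R) :
  toV (tuple_set t i x) = toV (tuple_set t i 0) + x *: (delta_mx 0 i : Rn).
Proof.
apply/rowP => j; rewrite !mxE !tnth_tuple_set eqxx /=.
by case: eqP => _; rewrite ?mulr1 ?mulr0 ?add0r ?addr0.
Qed.

Lemma partial_eq0_near (i : 'I_n) (v : Rn -> R) (x : Rn) :
  (\forall y \near x, v y = 0) -> partial i v x = 0.
Proof.
move=> v0; rewrite /partial (@near_eq_derive _ _ _ v (cst 0))//.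
exact: derive_cst.
Qed.

Lemma open_coord_gt (K : R) (j : 'I_n) : open [set x : Rn | K < `|x 0 j|].
Proof.
have cj : continuous (fun x : Rn => `|x 0 j|).
  have cj := @coord_continuous R 1 n 0 j.
  by move=> x; exact: (cvg_norm (cj x)).
by move/continuousP: cj => /(_ [set y | K < y]); apply; exact: open_gt.
Qed.

Lemma compact_rV_cube (K : R) : compact [set x : Rn | forall i, `|x 0 i| <= K].
Proof.
rewrite (_ : mkset _ = [set x : Rn | forall i, [set` `[- K, K]] (x 0 i)]).
  apply: (@rV_compact R n (fun=> [set` `[- K, K]])) => i.
  exact: segment_compact.
by apply/seteqP; split => x /= Hx i; have := Hx i; rewrite /= in_itv /= ler_norml.
Qed.

Lemma compact_bound (X : topologicalType) (A : set X) (f : X -> R) :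
  compact A -> {within A, continuous f} ->
  exists2 C, 0 <= C & forall x, A x -> `|f x| <= C.
Proof.
move=> cA cf; have := compact_bounded (continuous_compact cf cA).
move=> [M [_ MA]]; exists (`|M| + 1); first by rewrite addr_ge0.
move=> x Ax; apply: (MA _ _ (f x)); last by exists x.
by rewrite (le_lt_trans (ler_norm M))// ltrDl.
Qed.

Lemma compact_closure_rV (U : set Rn) : bounded_set U -> compact (closure U).
Proof.
move=> /bounded_in_cube[K _ UK]; apply: subclosed_compact (@compact_rV_cube K) _.
  exact: closed_closure.
have clK : closed [set x : Rn | forall i, `|x 0 i| <= K].
  by apply: compact_closed; [exact: norm_hausdorff|exact: compact_rV_cube].
by rewrite closureEbigcap => x; apply; split => // y Uy; exact: UK.
Qed.

Lemma box_supported_continuous (K : R) (G : Rn -> R) :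
  continuous G -> (forall (x : Rn) j, K < `|x 0 j| -> G x = 0) ->
  exists C, box_supported K C (G \o toV).
Proof.
move=> cG sG.
have [C C0 CG] := compact_bound (@compact_rV_cube K) (continuous_subspaceT cG).
exists C; split.
- rewrite -(preimage_setT toV); apply: measurable_continuous_rV.
    exact: openT.
  by move=> x _; exact: cG.
- move=> t /=; have [|/existsNP[j]] := pselect (forall j, `|toV t 0 j| <= K).
    exact: CG.
  by move=> /negP; rewrite -ltNge => /sG ->; rewrite normr0.
- by move=> t j Kt /=; rewrite (sG _ j)// toVE.
Qed.

Lemma partial_eq0_outside (i : 'I_n) (K : R) (F : Rn -> R) :
  (forall (x : Rn) j, K < `|x 0 j| -> F x = 0) ->
  forall (x : Rn) j, K < `|x 0 j| -> partial i F x = 0.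
Proof.
move=> sF x j Kx; apply: partial_eq0_near; near=> y; apply: (sF _ j).
near: y; apply: open_nbhs_nbhs.
by split; [exact: (@open_coord_gt K j)|exact: Kx].
Unshelve. all: by end_near.
Qed.

(** On each line parallel to the i-th axis this is the fundamental theorem of
    calculus, the values at both ends being 0. *)
Lemma integral_partial_eq0 (i : 'I_n) (K : R) (F : Rn -> R) :
  (forall x, has_partial i F x) -> continuous (partial i F) ->
  (forall (x : Rn) j, K < `|x 0 j| -> F x = 0) ->
  (\int[lam]_t (partial i F (toV t))%:E = 0)%E.
Proof.
move=> dF cF sF; have sG j := partial_eq0_outside j sF.
have [C bF] := box_supported_continuous cF (sG i).
apply: (@integral_eq0_slices R n K C (partial i F \o toV) i) => //.
move=> t; pose y := toV (tuple_set t i 0); pose e := delta_mx 0 i : Rn.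
pose K' : R := `|K| + 1.
have KK' : K < K' by rewrite (le_lt_trans (ler_norm K))// ltrDl.
have K'0 : 0 < K' by rewrite ltr_pwDr.
have line x : toV (tuple_set t i x) = y + x *: e by rewrite toV_set.
have coordE x : (y + x *: e) 0 i = x by rewrite -line toVE tnth_tuple_set eqxx.
have out x : K' <= `|x| -> F (y + x *: e) = 0.
  by move=> Kx; apply: (sF _ i); rewrite coordE; exact: lt_le_trans Kx.
transitivity (\int[mu]_(x in `[(- K')%R, K']) (partial i F (y + x *: e))%:E)%E.
  rewrite [RHS]integral_mkcond; apply: eq_integral => x _.
  rewrite patchE /= line; case: ifPn => //; rewrite mem_setE in_itv /= -ler_norml.
  rewrite -ltNge => Kx; rewrite (sG i _ i)// coordE; exact: lt_trans Kx.
have dl (s : R) : - K' <= s <= K' ->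
    is_derive s (1 : R) (fun s : R => F (y + s *: e)) (partial i F (y + s *: e)).
  by move=> _; exact: (is_derive_line (dF _)).
rewrite (integral_is_derive _ dl).
- by rewrite !out ?subrr ?normrN// ler_norm.
- by rewrite gtrN.
- by apply: continuous_subspaceT; exact: continuous_on_line.
Unshelve. all: by end_near.
Qed.

End compact_support.

(** * Truncation near the boundary *)

Lemma continuous_sum_at (R : realType) (X : topologicalType) (I : Type)
  (r : seq I) (f : I -> X -> R) x : (forall i, {for x, continuous (f i)}) ->
  {for x, continuous (fun y => \sum_(i <- r) f i y)}.
Proof.
move=> cf; elim: r => [|i r IH].
  rewrite (_ : (fun _ => _) = cst 0); first exact: cst_continuous.
  by apply/funext => y; rewrite big_nil.
rewrite (_ : (fun _ => _) = (fun y => f i y + \sum_(j <- r) f j y)).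
  exact: (cvgD (cf i) IH).
by apply/funext => y; rewrite big_cons.
Qed.

Lemma continuous_near_eq (X Y : topologicalType) (f g : X -> Y) x :
  (\forall y \near x, f y = g y) -> {for x, continuous g} -> {for x, continuous f}.
Proof.
move=> fg cg A; rewrite (nbhs_singleton fg) => /cg gA.
have {}gA : \forall y \near x, A (g y) := gA.
have : \forall y \near x, A (f y) by apply: filterS2 fg gA => y ->.
by [].
Qed.

Lemma near_open (X : topologicalType) (U : set X) x : open U -> U x ->
  \forall y \near x, U y.
Proof. by move=> oU Ux; apply: open_nbhs_nbhs. Qed.

Lemma within_closure_continuous (X Y : topologicalType) (U : set X) (f : X -> Y) :
  open U -> {within closure U, continuous f} ->
  forall x, U x -> {for x, continuous f}.
Proof.
move=> oU /subspace_continuousP cf x Ux A /(cf x (subset_closure Ux)) HA.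
have {}HA : \forall y \near x, closure U y -> A (f y) := HA.
have : \forall y \near x, A (f y).
  apply: filterS2 HA (near_open oU Ux) => y h Uy.
  exact/h/subset_closure.
by [].
Qed.

Section truncation.
Context {R : realType} {n : nat}.
Local Notation Rn := 'rV[R]_n.
Local Notation toV := (@rV_of_tuple R n).
Local Notation lam := (lebesgue_tuple R n).
(* Since q vanishes on the boundary, it is smaller than e near the complement of
   Om. Functions that vanish where q <= e can therefore be extended by 0 to
   the whole space without losing regularity. *)
Variables (Om : set Rn) (q : Rn -> R) (e : R).
Hypotheses (oOm : open Om) (bOm : bounded_set Om) (e0 : 0 < e).
Hypotheses (cq : {within closure Om, continuous q}).
Hypotheses (q0 : forall x, boundary Om x -> q x = 0).

Lemma near_outside x : ~ Om x -> \forall y \near x, Om y -> q y <= e.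
Proof.
move=> nOm; have [clx|nclx] := pselect (closure Om x); last first.
  have : \forall y \near x, (~` closure Om) y.
    by apply: open_nbhs_nbhs; split => //; exact/closed_openC/closed_closure.
  by apply: filterS => y ncl Oy; case: ncl; exact: subset_closure.
have qx : q x = 0.
  by apply: q0; split=> //; move/interior_id: oOm => ->.
have /subspace_continuousP/(_ _ clx) /(cvgr_lt (q x)) := cq.
move=> /(_ e); rewrite qx => /(_ e0) H.
have {}H : \forall y \near x, closure Om y -> q y < e := H.
apply: filterS H => y h Oy.
by apply: ltW; apply: h; exact: subset_closure.
Qed.

Lemma truncated_near0 (g : Rn -> R) : (forall x, Om x -> q x <= e -> g x = 0) ->
  forall x, ~ Om x -> \forall y \near x, (g \_ Om) y = 0.
Proof.
move=> g0 x /near_outside; apply: filterS => y Oy; rewrite patchE.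
by case: ifPn => //; rewrite inE => Oy'; rewrite g0// Oy.
Qed.

Lemma truncated_near (g : Rn -> R) x : Om x -> \forall y \near x, (g \_ Om) y = g y.
Proof. by move=> /(near_open oOm); apply: filterS => y Oy; rewrite patchT// inE. Qed.

Lemma truncated_continuous (g : Rn -> R) : (forall x, Om x -> {for x, continuous g}) ->
  (forall x, Om x -> q x <= e -> g x = 0) -> continuous (g \_ Om).
Proof.
move=> cg g0 x; have [Ox|nOx] := pselect (Om x).
  by apply: continuous_near_eq (truncated_near g Ox) _; exact: cg.
apply: (@continuous_near_eq _ _ _ (cst 0)); first exact: truncated_near0.
exact: cst_continuous.
Qed.

Lemma truncated_integrable (g : Rn -> R) : (forall x, Om x -> {for x, continuous g}) ->
  (forall x, Om x -> q x <= e -> g x = 0) ->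
  lam.-integrable (toV @^-1` Om) (EFin \o (g \o toV)).
Proof.
move=> cg g0; have cgO := truncated_continuous cg g0.
have [K K0 OK] := bounded_in_cube bOm.
have [|C bG] := @box_supported_continuous R n K _ cgO.
  move=> x j; rewrite ltNge => /negP Kx; rewrite patchN// notin_setE => Ox.
  exact/Kx/OK.
have mO := open_measurable_rV oOm.
have := integrableS measurableT mO (@subsetT _ _) (box_supported_integrable bG).
apply: eq_integrable => // t; rewrite inE /= => Ot.
by rewrite patchT// inE.
Qed.

Lemma truncated_partial (i : 'I_n) (g : Rn -> R) :
  (forall x, Om x -> has_partial i g x) ->
  (forall x, Om x -> q x <= e -> g x = 0) ->
  forall x, has_partial i (g \_ Om) x /\
    partial i (g \_ Om) x = (partial i g \_ Om) x.
Proof.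
move=> dg g0 x; have [Ox|nOx] := pselect (Om x).
  have nO := truncated_near g Ox; rewrite [RHS]patchT ?inE//; split.
    apply: (@near_eq_derivable _ _ _ g); last exact: dg.
    by apply: filterS nO => y ->.
  exact: near_eq_derive.
have nO := truncated_near0 g0 nOx; rewrite [RHS]patchN ?notin_setE//; split.
  apply: (@near_eq_derivable _ _ _ (cst 0)); last exact: derivable_cst.
  by apply: filterS nO => y ->.
exact: partial_eq0_near.
Qed.

(** Divergence theorem with no boundary term: the fields G vanish where q <= e. *)
Lemma integral_div_truncated (G : 'I_n -> Rn -> R) :
  (forall i x, Om x -> has_partial i (G i) x) ->
  (forall i x, Om x -> {for x, continuous (partial i (G i))}) ->
  (forall i x, Om x -> q x <= e -> G i x = 0 /\ partial i (G i) x = 0) ->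
  integral_Rn Om (fun x => \sum_i partial i (G i) x) = 0.
Proof.
move=> dG cG G0; rewrite /integral_Rn Rintegral_sum; last 2 first.
- exact: open_measurable_rV.
- move=> i; apply: (@truncated_integrable (partial i (G i))); first exact: cG.
  by move=> x Ox qx; have [] := G0 i _ Ox qx.
rewrite big1// => i _.
have G0i x : Om x -> q x <= e -> G i x = 0 by move=> Ox /(G0 i _ Ox)[].
have pG0i x : Om x -> q x <= e -> partial i (G i) x = 0 by move=> Ox /(G0 i _ Ox)[].
have T := truncated_partial (dG i) G0i.
have TE : partial i (G i \_ Om) = partial i (G i) \_ Om.
  by apply/funext => x; have [] := T x.
have [K K0 OK] := bounded_in_cube bOm.
rewrite Rintegral_mkcond /Rintegral.
transitivity (fine (\int[lam]_t (partial i (G i \_ Om) (toV t))%:E)).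
  by congr fine; apply: eq_integral => t _; rewrite TE.
rewrite (@integral_partial_eq0 R n i K (G i \_ Om))//.
- by move=> x; have [] := T x.
- by rewrite TE; apply: truncated_continuous => // x Ox; exact: cG.
- move=> x j; rewrite ltNge => /negP Kx; rewrite patchN// notin_setE => Ox.
  exact/Kx/OK.
Qed.

End truncation.

(** * The cutoff function *)

Lemma is_derive_comp_dir (R : realType) (V : normedModType R) (phi : R -> R)
  (f : V -> R) (x v : V) (dphi df : R) :
  is_derive (f x) (1 : R) phi dphi -> is_derive x v f df ->
  is_derive x v (phi \o f) (dphi * df).
Proof.
move=> Dphi Df.
have x0 : x + (0 : R) *: v = x by rewrite scale0r addr0.
have e (g : V -> R) : (fun h : R => h^-1 *: ((g \o shift x) (h *: v) - g x)) =
    (fun h : R => h^-1 *: (((fun s : R => g (x + s *: v)) \o shift 0) (h *: (1 : R)) -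
      g (x + (0 : R) *: v))).
  apply/funext => h /=; congr (_ *: (g _ - g _)); last by rewrite x0.
  by rewrite addr0 [h%:A]mulr1 addrC.
have L : is_derive (0 : R) (1 : R) (fun s : R => f (x + s *: v)) df.
  have H := @is_derive_line R V f x v 0; rewrite x0 in H.
  by case: Df => dfx <-; exact: (H dfx).
have Dphi' : is_derive ((fun s : R => f (x + s *: v)) 0) (1 : R) phi dphi.
  by rewrite x0.
have [D1 D2] := is_derive1_comp Dphi' L.
by apply: DeriveDef; rewrite /derivable /derive e.
Qed.

(** Used at the point q = e where the two formulas for the cutoff meet. *)
Lemma is_derive0_quadratic (R : realType) (f : R -> R) (x C : R) :
  (forall y, `|f y - f x| <= C * (y - x) ^+ 2) -> is_derive x (1 : R) f 0.
Proof.
move=> fC.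
have L : (fun h : R => h^-1 *: ((f \o shift x) (h *: (1 : R)) - f x)) @ 0^' --> (0 : R).
  apply/cvgr0Pnorm_le => eps eps0; near=> h.
  have h0 : h != 0 by near: h; exact: nbhs_dnbhs_neq.
  rewrite /= [h%:A]mulr1 normrM normfV ler_pdivrMl ?normr_gt0//.
  apply: (le_trans (fC _)); rewrite addrK -real_normK ?num_real// expr2 mulrA.
  rewrite mulrC ler_wpM2l//.
  have hC : `|h| <= eps / (`|C| + 1).
    by near: h; apply: dnbhs0_le; rewrite divr_gt0// ltr_pwDr.
  rewrite (@le_trans _ _ ((`|C| + 1) * `|h|))//.
    by rewrite ler_wpM2r// (le_trans (ler_norm C))// lerDl.
  by rewrite -ler_pdivlMl 1?mulrC// ltr_pwDr.
by apply: DeriveDef; [exact: cvgP L|exact: cvg_lim L].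
Unshelve. all: by end_near.
Qed.

Section cutoff.
Context {R : realType}.
Variable e : R.
Hypothesis e0 : 0 < e.

(** A C^1 function, 0 on q <= e and (1 - e / q)^2 for q >= e. It increases to the
    indicator of q > 0 as e decreases to 0, while for q > 0 the product of q and
    its derivative stays bounded by 1 and tends to 0; these are the properties
    that the limit in Green's formula uses. *)
Definition cutoff (q : R) : R := (1 - e / Num.max q e) ^+ 2.
Definition cutoff_derive (q : R) : R :=
  2 * (1 - e / Num.max q e) * (e / Num.max q e ^+ 2).

Let max_gt0 q : 0 < Num.max q e.
Proof. by rewrite lt_max e0 orbT. Qed.

Let ratio01 q : 0 < e / Num.max q e <= 1.
Proof. by rewrite divr_gt0//= ler_pdivrMr// mul1r le_max lexx orbT. Qed.

Lemma cutoff_le q : q <= e -> cutoff q = 0 /\ cutoff_derive q = 0.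
Proof.
move=> qe; rewrite /cutoff /cutoff_derive max_r// divff ?gt_eqF// subrr.
by rewrite expr0n mulr0 mul0r.
Qed.

Lemma cutoff_itv q : 0 <= cutoff q <= 1.
Proof.
rewrite /cutoff sqr_ge0 /= expr_le1 ?subr_ge0 ?gerBl//.
  by have /andP[/ltW] := ratio01 q.
by have /andP[] := ratio01 q.
Qed.

Lemma cutoff_derive_ge0 q : 0 <= cutoff_derive q.
Proof.
apply: mulr_ge0; last by rewrite divr_ge0 ?exprn_ge0 ?(ltW (max_gt0 _)) ?(ltW e0).
by rewrite mulr_ge0// subr_ge0; have /andP[] := ratio01 q.
Qed.

Lemma cutoff_deriveM q : 0 < q -> q * cutoff_derive q <= 2 * (e / q) /\
  q * cutoff_derive q <= 1.
Proof.
move=> q0; have [qe|eq_] := leP q e.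
  have [_ ->] := cutoff_le qe; rewrite mulr0; split => //.
  by rewrite mulr_ge0// divr_ge0 ?ltW.
have -> : q * cutoff_derive q = 2 * (1 - e / q) * (e / q).
  by rewrite /cutoff_derive max_l ?ltW// ; field; rewrite gt_eqF.
have := divr_gt0 e0 q0; set r := e / q => r0.
by split; nra.
Qed.

Lemma continuous_max_e : continuous (fun q : R => Num.max q e).
Proof. by move=> q; apply: continuous_max; [exact: cvg_id|exact: cvg_cst]. Qed.

Lemma continuous_cutoff_derive : continuous cutoff_derive.
Proof.
move=> q; have m0 : Num.max q e != 0 by rewrite gt_eqF.
have cm : Num.max x e @[x --> q] --> Num.max q e by exact: continuous_max_e.
apply: cvgM; first apply: cvgMr; first apply: cvgB; first exact: cvg_cst.
  by apply: cvgMr; apply: cvgV.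
apply: cvgMr; apply: cvgV; first by rewrite expf_neq0.
exact: cvg_sqr.
Qed.

Lemma is_derive_cutoff q : is_derive q (1 : R) cutoff (cutoff_derive q).
Proof.
have [qe|eq_|->] := ltgtP q e.
- have [_ ->] := cutoff_le (ltW qe).
  apply: (@near_eq_is_derive R R R (cst 0)).
  near=> y; have [|->//] := @cutoff_le y.
  by apply: ltW; near: y; exact: lt_nbhsl.
- have q0 : 0 < q by exact: lt_trans eq_.
  apply: (@near_eq_is_derive R R R (fun y => (1 - e * y^-1) ^+ 2)).
    near=> y; rewrite /cutoff max_l//; apply: ltW.
    by near: y; exact: lt_nbhsr.
  have D1 := @is_deriveV R id q 1 1 (lt0r_neq0 q0) (is_derive_id _ _).
  have D2 := is_deriveZ e D1.
  have D3 := is_deriveB (is_derive_cst (1 : R) q (1 : R)) D2.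
  have D4 := is_deriveX 2 D3.
  apply: (is_derive_eq D4); rewrite /cutoff_derive max_l ?ltW// /GRing.scale /=.
  by rewrite expr1 [X in 2 * X * _ = _](_ : _ = 1 - e / q)//; field; rewrite gt_eqF.
- have [_ ->] := cutoff_le (lexx e).
  apply: (@is_derive0_quadratic R _ _ (e ^- 2)) => y.
  have [-> _] := cutoff_le (lexx e); rewrite subr0.
  have [ye|ey] := leP y e.
    have [-> _] := cutoff_le ye.
    by rewrite normr0 mulr_ge0 ?sqr_ge0// invr_ge0 exprn_ge0// ltW.
  have y0 : 0 < y by exact: lt_trans ey.
  rewrite ger0_norm; last by have /andP[] := cutoff_itv y.
  rewrite /cutoff max_l ?(ltW ey)//.
  have -> : 1 - e / y = (y - e) / y by field; rewrite gt_eqF.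
  rewrite expr_div_n mulrC ler_wpM2r ?sqr_ge0// lef_pV2 ?posrE ?exprn_gt0//.
  by rewrite ler_pXn2r ?nnegrE ?(ltW e0) ?(ltW y0) ?(ltW ey).
Unshelve. all: by end_near.
Qed.

End cutoff.

Lemma cutoff_anti (R : realType) (e e' q : R) : 0 < e -> e <= e' -> 0 <= q ->
  cutoff e' q <= cutoff e q.
Proof.
move=> e0 ee' q0; have e'0 : 0 < e' by exact: lt_le_trans ee'.
have m0 : 0 < Num.max q e by rewrite lt_max e0 orbT.
have m'0 : 0 < Num.max q e' by rewrite lt_max e'0 orbT.
have m1 : e' / Num.max q e' <= 1.
  by rewrite ler_pdivrMr// mul1r le_max lexx orbT.
have r : e / Num.max q e <= e' / Num.max q e'.
  rewrite ler_pdivrMr// mulrAC ler_pdivlMr// !maxr_pMr ?(ltW e0) ?(ltW e'0)//.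
  rewrite ge_max !le_max ler_wpM2r//= mulrC lexx orbT//.
have r0 : 0 <= e / Num.max q e by rewrite divr_ge0// ltW.
rewrite /cutoff ler_pXn2r ?nnegrE ?subr_ge0//; last exact: le_trans m1.
by rewrite lerD2l lerN2.
Qed.

Section cutoff_limits.
Context {R : realType}.
Variable q : R.
Hypothesis q0 : 0 < q.

Lemma cvg_cutoff : cutoff n.+1%:R^-1 q @[n --> \oo] --> (1 : R).
Proof.
apply: (@squeeze_cvgr _ _ _ _ (fun n => 1 - 2 / q * n.+1%:R^-1) (cst 1)).
- apply: nearW => n; have e0 : 0 < n.+1%:R^-1 :> R by rewrite invr_gt0.
  have /andP[_ ->] := cutoff_itv e0 q; rewrite andbT /cutoff.
  set m := Num.max _ _; have qm : q <= m by rewrite le_max lexx.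
  have m0 : 0 < m by exact: lt_le_trans qm.
  have : n.+1%:R^-1 / m <= q^-1 * n.+1%:R^-1.
    by rewrite mulrC ler_wpM2r ?(ltW e0)// lef_pV2 ?posrE.
  set r := _ / m; set s := _ * _ => rs; have : 2 / q * n.+1%:R^-1 = 2 * s.
    by rewrite /s mulrA.
  by move=> ->; have := sqr_ge0 r; nra.
- rewrite -[X in _ --> X]subr0 -[X in _ --> _ - X](mulr0 (2 / q)).
  apply: cvgB; first exact: cvg_cst.
  by apply: cvgMr; exact: cvg_harmonic.
- exact: cvg_cst.
Qed.

Lemma cvg_cutoff_derive : q * cutoff_derive n.+1%:R^-1 q @[n --> \oo] --> (0 : R).
Proof.
apply: (@squeeze_cvgr _ _ _ _ (cst 0) (fun n => 2 / q * n.+1%:R^-1)).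
- apply: nearW => n; have e0 : 0 < n.+1%:R^-1 :> R by rewrite invr_gt0.
  rewrite mulr_ge0 ?(ltW q0) ?cutoff_derive_ge0//=.
  have [h _] := cutoff_deriveM e0 q0.
  by apply: (le_trans h); rewrite mulrA mulrAC.
- exact: cvg_cst.
- rewrite -[X in _ --> X](mulr0 (2 / q)).
  by apply: cvgMr; exact: cvg_harmonic.
Qed.

End cutoff_limits.

(** * Green's formula by truncation *)

Lemma energy_algebra (R : realType) (a b c a' b' c' : R) : a + b + c = 0 ->
  a' + b' + c' = 0 -> 0 <= c + c' -> b + b' <= - (a + a').
Proof. lra. Qed.

Lemma symmetry_algebra (R : realType) (a b c a' b' c' : R) : a + b + c = 0 ->
  a' + b' + c' = 0 -> b = b' -> a - a' = c' - c.
Proof. lra. Qed.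

(** For a nonnegative quadratic form on pairs with matrix (E11, E12; E12, E22), the value
    of the bilinear form at (a, b) and its rotation (- b, a) is at most |(a, b)|^2
    times the trace: test the form at the two diagonals of the square spanned by
    (a, b) and (- b, a). *)
Lemma skew_algebra (R : realType) (a b E11 E12 E22 : R) :
  (forall s r, 0 <= s * (s * E11 + r * E12) + r * (s * E12 + r * E22)) ->
  `|a * (a * E12 + b * E22) - b * (a * E11 + b * E12)| <=
    (a ^+ 2 + b ^+ 2) * (E11 + E22).
Proof.
move=> H; have p1 := H 1 0; have p2 := H 0 1.
have p : 0 <= (a ^+ 2 + b ^+ 2) * (E11 + E22).
  by rewrite mulr_ge0 ?addr_ge0 ?sqr_ge0//; lra.
have := H (a + b) (b - a); have := H (a - b) (a + b).
by rewrite ler_norml => h1 h2; apply/andP; split; lra.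
Qed.

Section green.
Context {R : realType} {n : nat}.
Local Notation Rn := 'rV[R]_n.
Local Notation toV := (@rV_of_tuple R n).
Local Notation lam := (lebesgue_tuple R n).
(* The two functions v true and v false are treated together, so that the matrix
   of pairings is a nonnegative form. In the application F k = A grad (v k).
   The functions v k are continuous up to the boundary and vanish there, but
   their gradients are controlled in the interior only. *)
Variables (Om : set Rn) (v : bool -> Rn -> R) (F : bool -> 'I_n -> Rn -> R) (M : R).
Hypotheses (oOm : open Om) (bOm : bounded_set Om).
Hypothesis cv : forall k, {within closure Om, continuous (v k)}.
Hypothesis v0 : forall k x, boundary Om x -> v k x = 0.
Hypothesis dv : forall k i x, Om x -> has_partial i (v k) x.
Hypothesis cdv : forall k i x, Om x -> {for x, continuous (partial i (v k))}.
Hypothesis cF : forall k i x, Om x -> {for x, continuous (F k i)}.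
Hypothesis dF : forall k i x, Om x -> has_partial i (F k i) x.
Hypothesis cdF : forall k i x, Om x -> {for x, continuous (partial i (F k i))}.

Definition divergence (G : 'I_n -> Rn -> R) (x : Rn) : R :=
  \sum_i partial i (G i) x.

Definition pairing k l (x : Rn) : R := \sum_i F k i x * partial i (v l) x.

Hypothesis divM : forall k x, Om x -> `|divergence (F k) x| <= M.
Hypothesis pairingC : forall x, Om x -> pairing true false x = pairing false true x.
Hypothesis pairing_ge0 : forall x, Om x -> forall a b : R,
  0 <= a * (a * pairing true true x + b * pairing true false x) +
       b * (a * pairing false true x + b * pairing false false x).

(* The cutoff is a function of q rather than of the distance to the boundary:
   the derivative of the cutoff then combines with the pairings into terms
   that have a sign or are bounded by the energy density. *)
Let q x := v true x ^+ 2 + v false x ^+ 2.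

Let cvO k x : Om x -> {for x, continuous (v k)}.
Proof. exact: (within_closure_continuous oOm (@cv k)). Qed.

Let cq : {within closure Om, continuous q}.
Proof.
apply/subspace_continuousP => x clx; apply: cvgD; apply: cvg_sqr.
  by have /subspace_continuousP/(_ x clx) := @cv true.
by have /subspace_continuousP/(_ x clx) := @cv false.
Qed.

Let q0 x : boundary Om x -> q x = 0.
Proof. by move=> bx; rewrite /q !v0// expr0n addr0. Qed.

Let cqO x : Om x -> {for x, continuous q}.
Proof.
by move=> Ox; exact: (cvgD (cvg_sqr (@cvO true x Ox)) (cvg_sqr (@cvO false x Ox))).
Qed.

Let cpairing k l x : Om x -> {for x, continuous (pairing k l)}.
Proof.
move=> Ox; apply: continuous_sum_at => i.
exact: (cvgM (@cF k i x Ox) (@cdv l i x Ox)).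
Qed.

Let cdiv k x : Om x -> {for x, continuous (divergence (F k))}.
Proof. by move=> Ox; apply: continuous_sum_at => i; exact: cdF. Qed.

Let is_dv k i x : Om x -> is_derive x (delta_mx 0 i : Rn) (v k) (partial i (v k) x).
Proof. by move=> Ox; apply/derivableP; exact: dv. Qed.

Let is_dF k i x : Om x -> is_derive x (delta_mx 0 i : Rn) (F k i) (partial i (F k i) x).
Proof. by move=> Ox; apply/derivableP; exact: dF. Qed.

Let is_dq i x : Om x -> is_derive x (delta_mx 0 i : Rn) q
  (2 * (v true x * partial i (v true) x + v false x * partial i (v false) x)).
Proof.
move=> Ox.
have D := is_deriveD (is_deriveX 2 (is_dv true i Ox)) (is_deriveX 2 (is_dv false i Ox)).
apply: (is_derive_eq D); rewrite /GRing.scale /= !expr1; ring.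
Qed.

(* S is the energy density. With (a, b) = (v true, v false), skew and quad below are
   the pairings of (a, b) with (- b, a) and with itself; they appear when the
   cutoff is differentiated. *)
Let S x := pairing true true x + pairing false false x.

Let skew x :=
  v true x * (v true x * pairing false true x + v false x * pairing false false x) -
  v false x * (v true x * pairing true true x + v false x * pairing true false x).

Section at_level.
Variable e : R.
Hypothesis e0 : 0 < e.

Let theta x := cutoff e (q x).
Let theta' x := cutoff_derive e (q x).

Let G k l i x := F k i x * (theta x * v l x).

Let dGE k l i x := F k i x *
    (theta x * partial i (v l) x + v l x * (theta' x *
    (2 * (v true x * partial i (v true) x + v false x * partial i (v false) x)))) +
  theta x * v l x * partial i (F k i) x.

Let is_dG k l i x : Om x -> is_derive x (delta_mx 0 i : Rn) (G k l i) (dGE k l i x).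
Proof.
move=> Ox.
have Dt : is_derive x (delta_mx 0 i : Rn) theta _ :=
  is_derive_comp_dir (is_derive_cutoff e0 (q x)) (is_dq i Ox).
exact: (is_deriveM (is_dF k i Ox) (is_deriveM Dt (is_dv l i Ox))).
Qed.

Let ctheta x : Om x -> {for x, continuous theta}.
Proof.
move=> Ox; apply: continuous_comp; first exact: cqO.
apply/differentiable_continuous/derivable1_diffP.
by have [] := is_derive_cutoff e0 (q x).
Qed.

Let ctheta' x : Om x -> {for x, continuous theta'}.
Proof.
move=> Ox; apply: continuous_comp; first exact: cqO.
exact: continuous_cutoff_derive.
Qed.

Let theta_le x : q x <= e -> theta x = 0 /\ theta' x = 0.
Proof. exact: cutoff_le. Qed.

Let partialG k l i x : Om x -> partial i (G k l i) x = dGE k l i x.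
Proof. by move=> Ox; rewrite /partial; have D := is_dG k l i Ox; rewrite derive_val. Qed.

(** By the product rule the integrand is the divergence of cutoff(q) * v l * F k, a
    field that vanishes near the boundary. *)
Lemma green_at_level k l :
  integral_Rn Om (fun x => theta x * (divergence (F k) x * v l x) +
    theta x * pairing k l x +
    2 * theta' x * v l x * (v true x * pairing k true x + v false x * pairing k false x)) = 0.
Proof.
rewrite -(@integral_div_truncated R n Om q e oOm bOm e0 cq q0 (G k l)).
- apply: eq_Rintegral => t; rewrite inE /= => Ot; set x := toV t in Ot *.
  under eq_bigr do rewrite partialG//.
  rewrite /divergence /pairing !mulr_suml !mulr_sumr -!big_split /=.
  rewrite mulr_sumr -big_split /=; apply: eq_bigr => i _; rewrite /dGE; ring.
- by move=> i x Ox; have [] := is_dG k l i Ox.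
- move=> i x Ox; apply: (@continuous_near_eq _ _ _ (dGE k l i)).
    by apply: filterS (near_open oOm Ox) => y; exact: partialG.
  have [ct ct'] := (ctheta Ox, ctheta' Ox).
  have [ctr cfa cl] := And3 (@cvO true x Ox) (@cvO false x Ox) (@cvO l x Ox).
  have [dtr dfa dl] := And3 (@cdv true i x Ox) (@cdv false i x Ox) (@cdv l i x Ox).
  have cq' : {for x, continuous (fun x => 2 * (v true x * partial i (v true) x +
      v false x * partial i (v false) x))}.
    exact: (cvgM (cvg_cst (2 : R)) (cvgD (cvgM ctr dtr) (cvgM cfa dfa))).
  exact: (cvgD (cvgM (@cF k i x Ox) (cvgD (cvgM ct dl) (cvgM cl (cvgM ct' cq'))))
    (cvgM (cvgM ct cl) (@cdF k i x Ox))).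
- move=> i x Ox qx; have [t0 t0'] := theta_le qx.
  by rewrite partialG// /G /dGE t0 t0'; split; ring.
Qed.

Let quad x := v true x * (v true x * pairing true true x + v false x * pairing true false x) +
  v false x * (v true x * pairing false true x + v false x * pairing false false x).

Let level_integrable (g : Rn -> R) : (forall x, Om x -> {for x, continuous g}) ->
  (forall x, Om x -> q x <= e -> g x = 0) ->
  lam.-integrable (toV @^-1` Om) (EFin \o (g \o toV)).
Proof. exact: (@truncated_integrable R n Om q e oOm bOm e0 cq q0). Qed.

Let ctest k l x : Om x ->
  {for x, continuous (fun x => theta x * (divergence (F k) x * v l x))}.
Proof.
by move=> Ox; exact: (cvgM (ctheta Ox) (cvgM (@cdiv k x Ox) (@cvO l x Ox))).
Qed.

Let cwork k l x : Om x ->  {for x, continuous (fun x => 2 * theta' x * v l x *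
  (v true x * pairing k true x + v false x * pairing k false x))}.
Proof.
move=> Ox.
have ct : {for x, continuous (fun x => 2 * theta' x)}.
  exact: (cvgM (cvg_cst (2 : R)) (ctheta' Ox)).
exact: (cvgM (cvgM ct (@cvO l x Ox)) (cvgD (cvgM (@cvO true x Ox) (@cpairing k true x Ox))
  (cvgM (@cvO false x Ox) (@cpairing k false x Ox)))).
Qed.

Lemma energy_integrable k l : lam.-integrable (toV @^-1` Om)
  (EFin \o ((fun x => theta x * pairing k l x) \o toV)).
Proof.
apply: level_integrable => x Ox.
  exact: (cvgM (ctheta Ox) (@cpairing k l x Ox)).
by move=> /theta_le[-> _]; rewrite mul0r.
Qed.

Lemma test_integrable k l : lam.-integrable (toV @^-1` Om)
  (EFin \o ((fun x => theta x * (divergence (F k) x * v l x)) \o toV)).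
Proof.
apply: level_integrable => x Ox; first exact: ctest.
by move=> /theta_le[-> _]; rewrite mul0r.
Qed.

Let iwork k l : lam.-integrable (toV @^-1` Om) (EFin \o ((fun x => 2 * theta' x * v l x *
  (v true x * pairing k true x + v false x * pairing k false x)) \o toV)).
Proof.
apply: level_integrable => x Ox; first exact: cwork.
by move=> /theta_le[_ ->]; rewrite mulr0 !mul0r.
Qed.

Let mOm : measurable (toV @^-1` Om).
Proof. exact: open_measurable_rV. Qed.

Lemma green_at_level_split k l :
  integral_Rn Om (fun x => theta x * (divergence (F k) x * v l x)) +
  integral_Rn Om (fun x => theta x * pairing k l x) +
  integral_Rn Om (fun x => 2 * theta' x * v l x *
    (v true x * pairing k true x + v false x * pairing k false x)) = 0.
Proof.
rewrite -[RHS](green_at_level k l) /integral_Rn -RintegralD//; last 2 first.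
- exact: test_integrable.
- exact: energy_integrable.
rewrite -RintegralD//; last exact: iwork.
by apply: integrableDR => //; [exact: test_integrable|exact: energy_integrable].
Qed.

(** Summing the identities (true, true) and (false, false), the terms with the
    derivative of the cutoff form a nonnegative multiple of quad. *)
Lemma energy_at_level :
  integral_Rn Om (fun x => theta x * S x) <=
  - integral_Rn Om (fun x => theta x *
      (divergence (F true) x * v true x + divergence (F false) x * v false x)).
Proof.
have H1 := green_at_level_split true true; have H2 := green_at_level_split false false.
have -> : integral_Rn Om (fun x => theta x * S x) =
    integral_Rn Om (fun x => theta x * pairing true true x) +
    integral_Rn Om (fun x => theta x * pairing false false x).
  rewrite /integral_Rn -RintegralD//; [|exact: energy_integrable|exact: energy_integrable].
  by apply: eq_Rintegral => t _; rewrite mulrDr.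
have -> : integral_Rn Om (fun x => theta x *
      (divergence (F true) x * v true x + divergence (F false) x * v false x)) =
    integral_Rn Om (fun x => theta x * (divergence (F true) x * v true x)) +
    integral_Rn Om (fun x => theta x * (divergence (F false) x * v false x)).
  rewrite /integral_Rn -RintegralD//; [|exact: test_integrable|exact: test_integrable].
  by apply: eq_Rintegral => t _; rewrite mulrDr.
have : 0 <= integral_Rn Om (fun x => 2 * theta' x * v true x *
    (v true x * pairing true true x + v false x * pairing true false x)) +
  integral_Rn Om (fun x => 2 * theta' x * v false x *
    (v true x * pairing false true x + v false x * pairing false false x)).
  rewrite /integral_Rn -RintegralD//; [|exact: iwork|exact: iwork].
  apply: Rintegral_ge0 => t Ot.
  rewrite [X in 0 <= X](_ : _ = 2 * theta' (toV t) * quad (toV t)); last first.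
    by rewrite /quad; ring.
  apply: mulr_ge0; last exact: pairing_ge0.
  by apply: mulr_ge0 => //; exact: cutoff_derive_ge0.
exact: energy_algebra H1 H2.
Qed.

(** In the difference of the identities (true, false) and (false, true) the pairings
    cancel by symmetry, and only the derivative of the cutoff remains. *)
Lemma symmetry_at_level :
  integral_Rn Om (fun x => theta x *
      (divergence (F true) x * v false x - divergence (F false) x * v true x)) =
  integral_Rn Om (fun x => 2 * theta' x * skew x).
Proof.
have H1 := green_at_level_split true false; have H2 := green_at_level_split false true.
have -> : integral_Rn Om (fun x => theta x *
      (divergence (F true) x * v false x - divergence (F false) x * v true x)) =
    integral_Rn Om (fun x => theta x * (divergence (F true) x * v false x)) -
    integral_Rn Om (fun x => theta x * (divergence (F false) x * v true x)).
  rewrite /integral_Rn -RintegralB//; [|exact: test_integrable|exact: test_integrable].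
  by apply: eq_Rintegral => t _; rewrite mulrBr.
have -> : integral_Rn Om (fun x => 2 * theta' x * skew x) =
  integral_Rn Om (fun x => 2 * theta' x * v true x *
    (v true x * pairing false true x + v false x * pairing false false x)) -
  integral_Rn Om (fun x => 2 * theta' x * v false x *
    (v true x * pairing true true x + v false x * pairing true false x)).
  rewrite /integral_Rn -RintegralB//; [|exact: iwork|exact: iwork].
  by apply: eq_Rintegral => t _; rewrite /skew; ring.
have : integral_Rn Om (fun x => theta x * pairing true false x) =
       integral_Rn Om (fun x => theta x * pairing false true x).
  by apply: eq_Rintegral => t; rewrite inE /= => Ot; rewrite pairingC.
exact: symmetry_algebra H1 H2.
Qed.

Lemma skew_integrable : lam.-integrable (toV @^-1` Om)
  (EFin \o ((fun x => 2 * theta' x * skew x) \o toV)).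
Proof.
apply: eq_integrable (integrableBR mOm (iwork false true) (iwork true false)) => //.
by move=> t _ /=; congr EFin; rewrite /skew; ring.
Qed.

End at_level.

Let lambda := fine (lam (toV @^-1` Om)).

Let finOm : (lam (toV @^-1` Om) < +oo)%E.
Proof. by apply: bounded_rV_finite => //; exact: open_measurable_rV. Qed.

Let mOm : measurable (toV @^-1` Om).
Proof. exact: open_measurable_rV. Qed.

Let v_bounded : exists2 B, 0 <= B & forall k x, Om x -> `|v k x| <= B.
Proof.
have cO := compact_closure_rV bOm.
have [B1 B10 HB1] := compact_bound cO (@cv true).
have [B2 B20 HB2] := compact_bound cO (@cv false).
exists (B1 + B2); first exact: addr_ge0.
move=> [] x /subset_closure clx.
  by rewrite (le_trans (HB1 _ clx))// lerDl.
by rewrite (le_trans (HB2 _ clx))// lerDr.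
Qed.

Let S_ge0 x : Om x -> 0 <= S x.
Proof.
move=> Ox; have h := pairing_ge0 Ox; rewrite /S; apply: addr_ge0.
  by have := h 1 0; rewrite !mul1r !mul0r !addr0.
by have := h 0 1; rewrite !mul1r !mul0r !add0r.
Qed.

Let skew_le x : Om x -> `|skew x| <= q x * S x.
Proof.
move=> Ox; rewrite /skew -pairingC//; apply: skew_algebra => a b.
by rewrite {2}pairingC//; exact: pairing_ge0.
Qed.

Let test_bound e : 0 < e -> forall x, Om x -> forall B, (forall k x, Om x -> `|v k x| <= B) ->
  forall k l, `|cutoff e (q x) * (divergence (F k) x * v l x)| <= M * B.
Proof.
move=> e0 x Ox B vB k l; have /andP[t0 t1] := cutoff_itv e0 (q x).
rewrite normrM ger0_norm// -[leRHS]mul1r ler_pM// normrM ler_pM//.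
  exact: divM.
exact: vB.
Qed.

(** The divergences and the functions are bounded, so the truncated energies are bounded
    uniformly in the level. *)
Lemma energy_bounded : exists C, forall n,
  integral_Rn Om (fun x => cutoff n.+1%:R^-1 (q x) * S x) <= C.
Proof.
have [B B0 vB] := v_bounded; exists ((M * B + M * B) * lambda) => m.
have e0 : 0 < m.+1%:R^-1 :> R by rewrite invr_gt0.
apply: (le_trans (energy_at_level e0)).
apply: (le_trans (ler_norm _)); rewrite normrN.
have it k := test_integrable e0 k k.
have i2 : lam.-integrable (toV @^-1` Om) (EFin \o ((fun x => cutoff m.+1%:R^-1 (q x) *
  (divergence (F true) x * v true x + divergence (F false) x * v false x)) \o toV)).
  apply: eq_integrable (integrableDR mOm (it true) (it false)) => //.
  by move=> t _ /=; rewrite -mulrDr.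
apply: (le_trans (le_normr_Rintegral mOm i2)).
rewrite -Rintegral_cst//; apply: le_Rintegral => //.
- exact: integrable_norm.
- by apply: (bounded_integrableR mOm finOm (C := `|M * B + M * B|)) => //;
    exact: measurable_cst.
- move=> t Ot /=; rewrite mulrDr (le_trans (ler_normD _ _))// lerD//;
    exact: test_bound.
Qed.

(* The limit of cutoff (q x) * S x: the points where both functions vanish are
   never reached by the cutoff. *)
Let S' x := if 0 < q x then S x else 0.

Let q_ge0 x : 0 <= q x.
Proof. by rewrite addr_ge0 ?sqr_ge0. Qed.

Let cvg_theta x : 0 < q x -> cutoff m.+1%:R^-1 (q x) @[m --> \oo] --> (1 : R).
Proof. exact: cvg_cutoff. Qed.

(** Monotone convergence: the energy inherits the uniform bound of its truncations. *)
Lemma energy_integrable_limit :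
  lam.-integrable (toV @^-1` Om) (EFin \o (S' \o toV)).
Proof.
have [C HC] := energy_bounded.
pose g (m : nat) (t : n.-tuple (measurableTypeR R)) : \bar R :=
  (cutoff m.+1%:R^-1 (q (toV t)) * S (toV t))%:E.
have e0 m : 0 < m.+1%:R^-1 :> R by rewrite invr_gt0.
have ig m : lam.-integrable (toV @^-1` Om) (g m).
  apply: eq_integrable (integrableDR mOm (energy_integrable (e0 m) true true)
    (energy_integrable (e0 m) false false)) => //.
  by move=> t _ /=; rewrite -mulrDr.
have mg m : measurable_fun (toV @^-1` Om) (g m) by exact: measurable_int (ig m).
have gS t : (toV @^-1` Om) t -> g ^~ t @ \oo --> (S' (toV t))%:E.
  move=> Ot; apply: cvg_EFin; first exact: nearW.
  rewrite /S'; case: ltP => qt.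
    rewrite -[X in _ --> X]mul1r; apply: cvgM; last exact: cvg_cst.
    exact: cvg_theta.
  rewrite (_ : _ \o _ = cst 0); first exact: cvg_cst.
  apply/funext => m; rewrite /g /=.
  by have [-> _] := cutoff_le (e0 m) (le_trans qt (ltW (e0 m))); rewrite mul0r.
have mS' : measurable_fun (toV @^-1` Om) (EFin \o (S' \o toV)).
  apply: (emeasurable_fun_cvg g) => //; exact: gS.
apply/integrableP; split => //.
have H := @cvg_monotone_convergence _ _ _ lam _ mOm g mg.
have gge0 m t : (toV @^-1` Om) t -> (0 <= g m t)%E.
  move=> Ot; rewrite lee_fin mulr_ge0 ?S_ge0//.
  by have /andP[] := cutoff_itv (e0 m) (q (toV t)).
have {}H := H gge0.
have gmono t : (toV @^-1` Om) t -> {homo g ^~ t : i j / (i <= j)%N >-> (i <= j)%E}.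
  move=> Ot i j ij; rewrite lee_fin ler_wpM2r ?S_ge0//.
  by apply: cutoff_anti => //; rewrite lef_pV2 ?posrE// ler_nat ltnS.
have {}H := H gmono.
apply: (@le_lt_trans _ _ C%:E); last by rewrite ltry.
rewrite (eq_integral (fun t => limn (g ^~ t))); last first.
  move=> t; rewrite inE => Ot; rewrite (cvg_lim _ (gS _ Ot))//= ger0_norm//.
  by rewrite /S'; case: ifP => // _; exact: S_ge0.
rewrite -(cvg_lim _ H)//; apply: lime_le; first by apply: cvgP H.
apply: nearW => m; have := HC m; rewrite -lee_fin /integral_Rn /Rintegral fineK//.
exact: (integrable_fin_num mOm (ig m)).
Qed.

Let q_eq0 x : q x <= 0 -> forall k, v k x = 0.
Proof.
move=> qx; have : q x == 0 by rewrite eq_le qx q_ge0.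
by rewrite /q paddr_eq0 ?sqr_ge0// !sqrf_eq0 => /andP[/eqP ? /eqP ?] [].
Qed.

Lemma cvg_test k l :
  lam.-integrable (toV @^-1` Om)
    (EFin \o ((fun x => divergence (F k) x * v l x) \o toV)) /\
  integral_Rn Om (fun x => cutoff n.+1%:R^-1 (q x) * (divergence (F k) x * v l x))
    @[n --> \oo] --> integral_Rn Om (fun x => divergence (F k) x * v l x).
Proof.
have [B B0 vB] := v_bounded.
have e0 m : 0 < m.+1%:R^-1 :> R by rewrite invr_gt0.
apply: (@dominated_cvgR _ _ _ lam _
  (fun m => (fun x => cutoff m.+1%:R^-1 (q x) * (divergence (F k) x * v l x)) \o toV)
  ((fun x => divergence (F k) x * v l x) \o toV) (cst (M * B))) => //.
- by move=> m; apply/measurable_EFinP; exact: (measurable_int _ (test_integrable (e0 m) k l)).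
- move=> t Ot /=; have [qt|qt] := ltP 0 (q (toV t)).
    rewrite -[X in _ --> X]mul1r; apply: cvgM; last exact: cvg_cst.
    exact: cvg_theta.
  rewrite q_eq0// mulr0.
  by rewrite (_ : (fun m => _) = cst 0);
    [exact: cvg_cst|apply/funext => m; rewrite mulr0].
- by apply: (bounded_integrableR mOm finOm (C := `|M * B|)) => //; exact: measurable_cst.
- by move=> m t Ot /=; exact: test_bound.
Qed.

(** The right-hand side of symmetry_at_level is dominated by 2 S', since
    |skew| <= q S and q * cutoff_derive q <= 1, and it tends to 0 pointwise. *)
Lemma green_symmetric :
  integral_Rn Om (fun x => divergence (F true) x * v false x) =
  integral_Rn Om (fun x => divergence (F false) x * v true x).
Proof.
have e0 m : 0 < m.+1%:R^-1 :> R by rewrite invr_gt0.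
have [_ c1] := cvg_test true false; have [_ c2] := cvg_test false true.
apply/eqP; rewrite -subr_eq0; apply/eqP.
apply: (@cvg_unique _ (@Rhausdorff R) _ _ _ _ (cvgB c1 c2)).
have [_ c3] : lam.-integrable (toV @^-1` Om) (EFin \o cst (0 : R)) /\
    integral_Rn Om (fun x => 2 * cutoff_derive m.+1%:R^-1 (q x) * skew x)
    @[m --> \oo] --> \int[lam]_(t in toV @^-1` Om) cst (0 : R) t.
  apply: (@dominated_cvgR _ _ _ lam _
    (fun m => (fun x => 2 * cutoff_derive m.+1%:R^-1 (q x) * skew x) \o toV)
    (cst 0) (fun t => 2 * S' (toV t))) => //.
  - by move=> m; apply/measurable_EFinP; exact: (measurable_int _ (skew_integrable (e0 m))).
  - move=> t Ot /=; have [qt|qt] := ltP 0 (q (toV t)); last first.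
      rewrite (_ : (fun m => _) = cst 0); first exact: cvg_cst.
      by apply/funext => m; rewrite /skew !q_eq0// !mul0r subrr mulr0.
    have c0 : 2 * S (toV t) * (q (toV t) * cutoff_derive m.+1%:R^-1 (q (toV t)))
        @[m --> \oo] --> (0 : R).
      by rewrite -[X in _ --> X](mulr0 (2 * S (toV t))); apply: cvgMr; exact: cvg_cutoff_derive.
    apply/norm_cvg0P; apply: (@squeeze_cvgr _ _ _ _ (cst 0) _ _ _ _ _ c0).
      apply: nearW => m; rewrite normr_ge0 /= normrM.
      have d0 := cutoff_derive_ge0 (e0 m) (q (toV t)).
      have d2 := mulr_ge0 (ler0n R 2) d0.
      rewrite (ger0_norm d2) (le_trans (ler_wpM2l d2 (skew_le Ot)))//.
      by rewrite le_eqVlt; apply/orP; left; apply/eqP; ring.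
    exact: cvg_cst.
  - by apply: integrableZlR => //; exact: energy_integrable_limit.
  - move=> m t Ot /=; rewrite /S'; case: ltP => qt; last first.
      by rewrite /skew !q_eq0// !mul0r subrr mulr0 normr0 mulr0.
    have d0 := cutoff_derive_ge0 (e0 m) (q (toV t)).
    rewrite normrM (ger0_norm (mulr_ge0 (ler0n R 2) d0)) -mulrA ler_wpM2l//.
    apply: (le_trans (ler_wpM2l d0 (skew_le Ot))).
    rewrite mulrA ler_piMl ?S_ge0// mulrC.
    by have [] := cutoff_deriveM (e0 m) qt.
rewrite Rintegral_cst// mul0r in c3.
rewrite (_ : (fun m => _) - (fun m => _) = (fun m => integral_Rn Om
  (fun x => 2 * cutoff_derive m.+1%:R^-1 (q x) * skew x))) //.
apply/funext => m; rewrite !fctE.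
rewrite -(symmetry_at_level (e0 m)) /integral_Rn.
rewrite -RintegralB//; [|exact: (test_integrable (e0 m) true false)|
  exact: (test_integrable (e0 m) false true)].
by apply: eq_Rintegral => t _; rewrite mulrBr.
Qed.

Lemma green_le0 :
  integral_Rn Om (fun x => divergence (F true) x * v true x) +
  integral_Rn Om (fun x => divergence (F false) x * v false x) <= 0.
Proof.
have e0 m : 0 < m.+1%:R^-1 :> R by rewrite invr_gt0.
have [_ c1] := cvg_test true true; have [_ c2] := cvg_test false false.
apply: (ler_cvg_to (cvgD c1 c2) (cvg_cst (0 : R))); apply: nearW => m /=.
have E : 0 <= integral_Rn Om (fun x => cutoff m.+1%:R^-1 (q x) * S x).
  apply: Rintegral_ge0 => t Ot; apply: mulr_ge0; last exact: S_ge0.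
  by have /andP[] := cutoff_itv (e0 m) (q (toV t)).
have := le_trans E (energy_at_level (e0 m)); rewrite oppr_ge0; apply: le_trans.
rewrite le_eqVlt; apply/orP; left; apply/eqP; rewrite fctE /integral_Rn.
rewrite -RintegralD//; [|exact: (test_integrable (e0 m) true true)|
  exact: (test_integrable (e0 m) false false)].
by apply: eq_Rintegral => t _; rewrite mulrDr.
Qed.

End green.

(** * Continuity from bounded partial derivatives *)

Lemma continuous_at_dist (R : realType) (X : topologicalType) (g : X -> R) x :
  (forall eps, 0 < eps -> \forall y \near x, `|g x - g y| < eps) <->
  {for x, continuous g}.
Proof. by split=> [H|cg]; [apply/cvgrPdist_lt|exact/cvgrPdist_lt]. Qed.

Lemma is_derive_lipschitz (R : realType) (f df : R -> R) (C d : R) :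
  (forall s, `|s| <= `|d| -> is_derive s (1 : R) f (df s) /\ `|df s| <= C) ->
  `|f d - f 0| <= C * `|d|.
Proof.
move=> fC.
have cf s : `|s| <= `|d| -> {for s, continuous f}.
  move=> /fC[[dfs _] _]; exact/differentiable_continuous/derivable1_diffP.
have mvt (a b : R) : a <= b -> (forall s, a <= s <= b -> `|s| <= `|d|) ->
    exists2 c, a <= c <= b & f b - f a = df c * (b - a).
  move=> ab abd; have [||c cab ->] := @MVT_segment R f df a b ab.
  - move=> s; rewrite in_itv /= => /andP[/ltW as_ /ltW sb].
    by have [] := fC s (abd s _); rewrite ?as_ ?sb.
  - apply: continuous_in_subspaceT => s; rewrite inE /= in_itv /= => sab.
    exact/cf/abd.
  - by exists c => //; move: cab; rewrite in_itv.
have [d0|d0] := leP 0 d.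
  have [s /andP[s0 sd]|c /andP[c0 cd] ->] := mvt 0 d d0.
    by rewrite !ger0_norm// (le_trans s0).
  rewrite subr0 normrM ler_wpM2r//.
  by have [] := fC c; rewrite // !ger0_norm.
have [s /andP[ds s0]|c /andP[dc c0] e] := mvt d 0 (ltW d0).
  by rewrite !ler0_norm ?lerN2// ltW.
rewrite distrC e sub0r normrM normrN ler_wpM2r//.
by have [] := fC c; rewrite // !ler0_norm ?lerN2// ltW.
Qed.

Section regularity.
Context {R : realType} {n : nat}.
Local Notation Rn := 'rV[R]_n.

(* The path from x to y that changes one coordinate at a time. *)
Let mix (x y : Rn) (k : nat) : Rn := \row_j (if (j < k)%N then y 0 j else x 0 j).

Lemma bounded_partials_lipschitz (U : set Rn) (g : Rn -> R) (C r : R) (x y : Rn) :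
  (forall i z, U z -> has_partial i g z) ->
  (forall i z, U z -> `|partial i g z| <= C) ->
  ball x r `<=` U -> ball x r y -> `|g y - g x| <= n%:R * (C * `|x - y|).
Proof.
move=> dg gC rU xy; have r0 : 0 < r by case: xy.
have xyi i : `|x 0 i - y 0 i| < r by exact: ball_rV_coord.
have step k : (k <= n)%N -> `|g (mix x y k) - g x| <= k%:R * (C * `|x - y|).
  elim: k => [_|k IH kn].
    rewrite (_ : mix x y 0 = x) ?subrr ?normr0 ?mul0r//.
    by apply/rowP => j; rewrite mxE.
  pose i := Ordinal kn; pose d := y 0 i - x 0 i.
  have mixS : mix x y k.+1 = mix x y k + d *: delta_mx 0 i.
    apply/rowP => j; rewrite !mxE eqxx /= ltnS leq_eqVlt.
    have [->|ji] := eqVneq j i.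
      by rewrite eqxx /= ltnn /= mulr1 addrC subrK.
    by rewrite (negbTE (_ : (j : nat) != k)) ?mulr0 ?addr0//; apply: contra ji => /eqP jk; apply/eqP/val_inj.
  have inb s : `|s| <= `|d| -> U (mix x y k + s *: delta_mx 0 i).
    move=> sd; apply: rU; apply: ball_rV => // j; rewrite !mxE eqxx /=.
    have [->|ji] := eqVneq j i.
      rewrite ltnn mulr1 opprD addrA subrr sub0r normrN.
      by rewrite (le_lt_trans sd)// distrC.
    by rewrite mulr0 addr0; case: ifP => _; [exact: xyi|rewrite subrr normr0].
  have L : `|g (mix x y k.+1) - g (mix x y k)| <= C * `|d|.
    have := @is_derive_lipschitz R (fun s => g (mix x y k + s *: delta_mx 0 i))
      (fun s => partial i g (mix x y k + s *: delta_mx 0 i)) C d.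
    rewrite scale0r addr0 mixS; apply => s /inb Us; split; last exact: gC.
    exact: (is_derive_line (dg _ _ Us)).
  have C0 : 0 <= C by apply: le_trans (gC i x _) => //; exact/rU/ballxx.
  apply: (le_trans (ler_distD (g (mix x y k)) _ _)).
  rewrite -natr1 mulrDl mul1r addrC lerD//; first exact/IH/ltnW.
  apply: (le_trans L); rewrite ler_wpM2l// /d distrC.
  by have := norm_coord (x - y) i; rewrite !mxE.
rewrite (_ : y = mix x y n); last by apply/rowP => j; rewrite mxE ltn_ord.
rewrite {2}(_ : mix x y n = y); first exact: step.
by apply/rowP => j; rewrite mxE ltn_ord.
Qed.

(** Partial derivatives alone do not give continuity; bounded ones give a local
    Lipschitz estimate. It supplies the continuity of the coefficients and of the
    gradients, only the next derivatives of which are assumed bounded. *)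
Lemma bounded_partials_continuous (U : set Rn) (g : Rn -> R) : open U ->
  (forall i z, U z -> has_partial i g z) ->
  (forall i, exists C, forall z, U z -> `|partial i g z| <= C) ->
  forall x, U x -> {for x, continuous g}.
Proof.
move=> oU dg /choice[C gC] x Ux.
pose K := \sum_i `|C i|.
have K0 : 0 <= K by apply: sumr_ge0.
have gK i z : U z -> `|partial i g z| <= K.
  move=> Uz; apply: (le_trans (gC i z Uz)); apply: (le_trans (ler_norm _)).
  by rewrite /K (bigD1 i)//= lerDl sumr_ge0.
have := oU; rewrite openE => /(_ _ Ux) /nbhs_ballP[r /= r0 rU].
apply/continuous_at_dist => eps eps0.
near=> y.
have xy : ball x r y by near: y; exact: nbhsx_ballx.
rewrite distrC.
apply: (le_lt_trans (bounded_partials_lipschitz dg gK rU xy)).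
have h : `|x - y| < eps / (n%:R * K + 1).
  near: y; apply: (@cvgr_dist_lt _ _ _ (nbhs x) _ id x) => //.
  by rewrite divr_gt0// ltr_wpDl// mulr_ge0.
rewrite mulrA; apply: (@le_lt_trans _ _ ((n%:R * K + 1) * `|x - y|)).
  by rewrite ler_wpM2r// lerDl.
by rewrite -ltr_pdivlMl ?ltr_wpDl ?mulr_ge0// mulrC.
Unshelve. all: by end_near.
Qed.

End regularity.

(** * The elliptic operator *)

Lemma quadratic_algebra (R : realType) (m a b p q r s : R) :
  m * (a * p + b * q) * (a * r + b * s) =
  a * (a * (m * p * r) + b * (m * q * r)) + b * (a * (m * p * s) + b * (m * q * s)).
Proof. by ring. Qed.

Section holder.
Context {R : realType} {n : nat}.
Local Notation Rn := 'rV[R]_n.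
Variables (Om : set Rn) (g : Rn -> R).
Hypothesis hg : holder_on Om g.

Lemma holder_continuous : open Om -> forall x, Om x -> {for x, continuous g}.
Proof.
move=> oOm x Ox; have [C [gam [g0 g1 gC]]] := hg.
apply/continuous_at_dist => eps eps0.
pose d := (eps / (`|C| + 1)) `^ gam^-1.
have C1 : 0 < `|C| + 1 by rewrite ltr_wpDl.
have d0 : 0 < d by rewrite powR_gt0// divr_gt0.
near=> y.
have Oy : Om y by near: y; exact: (near_open oOm Ox).
have xy : `|x - y| < d by near: y; apply: (@cvgr_dist_lt _ _ _ (nbhs x) _ id x).
apply: (le_lt_trans (gC _ _ Ox Oy)).
apply: (@le_lt_trans _ _ ((`|C| + 1) * `|x - y| `^ gam)).
  by rewrite ler_wpM2r ?powR_ge0// (le_trans (ler_norm C))// lerDl.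
rewrite -ltr_pdivlMl//.
have -> : (`|C| + 1)^-1 * eps = d `^ gam.
  by rewrite /d -powRrM mulVf ?gt_eqF// powRr1 ?divr_ge0 1?ltW// mulrC.
by rewrite gt0_ltr_powR// nnegrE// ltW.
Unshelve. all: by end_near.
Qed.

Lemma holder_bounded : bounded_set Om -> exists C, forall x, Om x -> `|g x| <= C.
Proof.
move=> [K [_ KO]]; have [C [gam [g0 g1 gC]]] := hg.
have [[x0 Ox0]|Om0] := pselect (exists x, Om x); last first.
  by exists 0 => x Ox; case: Om0; exists x.
pose K' := `|K| + 1.
have OK x : Om x -> `|x| <= K'.
  by move=> Ox; apply: KO => //; rewrite (le_lt_trans (ler_norm K))// ltrDl.
exists (`|g x0| + `|C| * (K' + K') `^ gam) => x Ox.
rewrite -[g x](subrK (g x0)) addrC (le_trans (ler_normD _ _))// lerD2l.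
apply: (le_trans (gC _ _ Ox Ox0)).
apply: (@le_trans _ _ (`|C| * `|x - x0| `^ gam)).
  by rewrite ler_wpM2r ?powR_ge0// ler_norm.
rewrite ler_wpM2l// ge0_ler_powR ?nnegrE ?(ltW g0)//.
  by rewrite addr_ge0// /K' addr_ge0.
by rewrite (le_trans (ler_normB _ _))// lerD// OK.
Qed.

End holder.

Section elliptic.
Context {R : realType} {n : nat}.
Local Notation Rn := 'rV[R]_n.
Local Notation toV := (@rV_of_tuple R n).
Local Notation lam := (lebesgue_tuple R n).
Variables (Om : set Rn) (A : Rn -> 'M[R]_n) (c : Rn -> R) (delta : R).
Hypotheses (oOm : open Om) (bOm : bounded_set Om).
Hypothesis symA : forall x, Om x -> (A x)^T = A x.
Hypothesis delta0 : 0 < delta.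
Hypothesis ellA : forall (x xi : Rn), Om x ->
  delta * (\sum_i xi 0 i ^+ 2) <= \sum_i \sum_j A x i j * xi 0 i * xi 0 j.
Hypothesis c0 : forall x, Om x -> 0 <= c x.
Hypothesis hA : forall i j k, (forall x, Om x -> has_partial k (fun y => A y i j) x) /\
  holder_on Om (partial k (fun y => A y i j)).
Hypothesis hc : holder_on Om c.

(** What is known of a solution at a fixed time. *)
Definition dirichlet_C2 (v : Rn -> R) :=
  [/\ {within closure Om, continuous v}, forall x, boundary Om x -> v x = 0,
      forall i j x, Om x -> has_partial i v x /\ has_partial j (partial i v) x,
      forall i j x, Om x -> {for x, continuous (partial j (partial i v))} &
      forall i j, exists C, forall x, Om x -> `|partial j (partial i v) x| <= C].

Definition flux (v : Rn -> R) (i : 'I_n) (x : Rn) : R :=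
  \sum_j A x i j * partial j v x.

Let cA i j x : Om x -> {for x, continuous (fun y => A y i j)}.
Proof.
apply: bounded_partials_continuous => //.
  by move=> k z Oz; have [H _] := hA i j k; exact: H.
by move=> k; have [_ H] := hA i j k; exact: holder_bounded.
Qed.

Let cdA i j k x : Om x -> {for x, continuous (partial k (fun y => A y i j))}.
Proof. by have [_ H] := hA i j k; exact: holder_continuous. Qed.

Let cp v i x : dirichlet_C2 v -> Om x -> {for x, continuous (partial i v)}.
Proof.
move=> [_ _ d2 _ b2]; apply: bounded_partials_continuous => //.
by move=> j z Oz; have [] := d2 i j z Oz.
Qed.

Let is_dflux v i k x : dirichlet_C2 v -> Om x ->
  is_derive x (delta_mx 0 k : Rn) (flux v i)
    (\sum_j (A x i j * partial k (partial j v) x +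
             partial j v x * partial k (fun y => A y i j) x)).
Proof.
move=> [_ _ d2 _ _] Ox.
have E : flux v i = \sum_j ((fun y => A y i j) * partial j v).
  by apply/funext => y; rewrite /flux fct_sumE.
rewrite E; apply: is_derive_sum => j.
have DA : is_derive x (delta_mx 0 k : Rn) (fun y => A y i j) (partial k (fun y => A y i j) x).
  by apply/derivableP; have [H _] := hA i j k; exact: H.
have Dv : is_derive x (delta_mx 0 k : Rn) (partial j v) (partial k (partial j v) x).
  by apply/derivableP; have [] := d2 j k x Ox.
exact: is_deriveM.
Qed.

Let partial_flux v i k x : dirichlet_C2 v -> Om x -> partial k (flux v i) x =
  \sum_j (A x i j * partial k (partial j v) x +
          partial j v x * partial k (fun y => A y i j) x).
Proof. by move=> vP Ox; rewrite /partial; have D := is_dflux i k vP Ox; rewrite derive_val. Qed.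

Let cflux v i x : dirichlet_C2 v -> Om x -> {for x, continuous (flux v i)}.
Proof.
move=> vP Ox; apply: continuous_sum_at => j.
exact: (cvgM (@cA i j x Ox) (@cp v j x vP Ox)).
Qed.

Let cdflux v i k x : dirichlet_C2 v -> Om x -> {for x, continuous (partial k (flux v i))}.
Proof.
move=> vP Ox; apply: (@continuous_near_eq _ _ _ (fun x => \sum_j
    (A x i j * partial k (partial j v) x + partial j v x * partial k (fun y => A y i j) x))).
  by apply: filterS (near_open oOm Ox) => y; exact: partial_flux.
apply: continuous_sum_at => j; have [_ _ _ c2 _] := vP.
exact: (cvgD (cvgM (@cA i j x Ox) (@c2 j k x Ox)) (cvgM (@cp v j x vP Ox) (@cdA i j k x Ox))).
Qed.

Lemma div_form_opE v x : div_form_op A c v x = divergence (flux v) x - c x * v x.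
Proof. by []. Qed.

Let C0 v : dirichlet_C2 v -> exists2 B, 0 <= B & forall x, Om x -> `|v x| <= B.
Proof.
move=> [cv _ _ _ _]; have [B B0 HB] := compact_bound (compact_closure_rV bOm) cv.
by exists B => // x Ox; exact/HB/subset_closure.
Qed.

Let cc x : Om x -> {for x, continuous c}.
Proof. exact: holder_continuous. Qed.

Let cv v x : dirichlet_C2 v -> Om x -> {for x, continuous v}.
Proof. by move=> [cv _ _ _ _]; exact: within_closure_continuous. Qed.

Let partialB i (f g : Rn -> R) x : has_partial i f x -> has_partial i g x ->
  has_partial i (fun y => f y - g y) x /\
  partial i (fun y => f y - g y) x = partial i f x - partial i g x.
Proof. by move=> df dg; split; [exact: (@derivableB _ _ _ f g x _ df dg)|
  exact: (@deriveB _ _ _ f g x _ df dg)]. Qed.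

Let partial_near_eq i (f g : Rn -> R) x : (forall y, Om y -> f y = g y) -> Om x ->
  has_partial i g x -> has_partial i f x /\ partial i f x = partial i g x.
Proof.
move=> fg Ox dg; have nfg : \forall y \near x, f y = g y.
  by apply: filterS (near_open oOm Ox) => y; exact: fg.
split; last exact: near_eq_derive.
apply: (@near_eq_derivable _ _ _ g); last exact: dg.
by apply: filterS nfg => y ->.
Qed.

Let second_partialB v v' i j x : dirichlet_C2 v -> dirichlet_C2 v' -> Om x ->
  has_partial j (partial i (fun y => v y - v' y)) x /\
  partial j (partial i (fun y => v y - v' y)) x =
  partial j (partial i v) x - partial j (partial i v') x.
Proof.
move=> [_ _ d2 _ _] [_ _ d2' _ _] Ox.
have [_ dv] := d2 i j x Ox; have [_ dv'] := d2' i j x Ox.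
have [dB eB] := partialB dv dv'.
have e y : Om y -> partial i (fun y => v y - v' y) y = partial i v y - partial i v' y.
  move=> Oy; have [d _] := d2 i j y Oy; have [d' _] := d2' i j y Oy.
  by have [] := partialB d d'.
by have [? ->] := partial_near_eq e Ox dB.
Qed.

Lemma dirichlet_C2B v v' : dirichlet_C2 v -> dirichlet_C2 v' ->
  dirichlet_C2 (fun x => v x - v' x).
Proof.
move=> vP v'P; have [kv v0 d2 k2 b2] := vP; have [kv' v0' d2' k2' b2'] := v'P.
split.
- by move=> x; apply: cvgB; [exact: kv|exact: kv'].
- by move=> x bx; rewrite v0// v0'// subrr.
- move=> i j x Ox; have [dd _] := second_partialB i j vP v'P Ox.
  split; last exact: dd.
  have [d _] := d2 i j x Ox; have [d' _] := d2' i j x Ox.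
  by have [] := partialB d d'.
- move=> i j x Ox; apply: (@continuous_near_eq _ _ _ (fun x =>
      partial j (partial i v) x - partial j (partial i v') x)).
    apply: filterS (near_open oOm Ox) => y Oy.
    by have [] := second_partialB i j vP v'P Oy.
  exact: (cvgB (@k2 i j x Ox) (@k2' i j x Ox)).
- move=> i j; have [C CP] := b2 i j; have [C' CP'] := b2' i j.
  exists (C + C') => x Ox; have [_ ->] := second_partialB i j vP v'P Ox.
  by apply: (le_trans (ler_normB _ _)); apply: lerD; [exact: CP|exact: CP'].
Qed.

Lemma div_form_opB v v' x : dirichlet_C2 v -> dirichlet_C2 v' -> Om x ->
  div_form_op A c (fun y => v y - v' y) x = div_form_op A c v x - div_form_op A c v' x.
Proof.
move=> vP v'P Ox; have [_ _ d2 _ _] := vP; have [_ _ d2' _ _] := v'P.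
have fluxB i y : Om y -> flux (fun y => v y - v' y) i y = flux v i y - flux v' i y.
  move=> Oy; rewrite /flux -sumrB; apply: eq_bigr => j _; rewrite -mulrBr.
  have [d _] := d2 j j y Oy; have [d' _] := d2' j j y Oy.
  by have [_ ->] := partialB d d'.
rewrite !div_form_opE mulrBr.
suff -> : divergence (flux (fun y => v y - v' y)) x =
    divergence (flux v) x - divergence (flux v') x.
  by rewrite (opprD (c x * v x)) addrACA -opprD.
rewrite /divergence -sumrB; apply: eq_bigr => i _.
have [df _] := is_dflux i i vP Ox; have [df' _] := is_dflux i i v'P Ox.
have [dB <-] := partialB df df'.
by have [_ ->] := partial_near_eq (fluxB i) Ox dB.
Qed.

Lemma div_form_op_eq v v' x : dirichlet_C2 v' -> (forall y, Om y -> v y = v' y) -> Om x ->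
  div_form_op A c v x = div_form_op A c v' x.
Proof.
move=> v'P vv' Ox; have [_ _ d2' _ _] := v'P.
rewrite !div_form_opE (vv' _ Ox).
suff e : divergence (flux v) x = divergence (flux v') x by rewrite e.
apply: eq_bigr => i _.
have fluxe y : Om y -> flux v i y = flux v' i y.
  move=> Oy; apply: eq_bigr => j _; congr (_ * _).
  have [d _] := d2' j j y Oy.
  by have [_ ->] := partial_near_eq vv' Oy d.
have [df _] := is_dflux i i v'P Ox.
by have [_ ->] := partial_near_eq fluxe Ox df.
Qed.

Variables (v1 v2 : Rn -> R) (M : R).
Hypotheses (v1P : dirichlet_C2 v1) (v2P : dirichlet_C2 v2).
Hypothesis L1 : forall x, Om x -> `|div_form_op A c v1 x| <= M.
Hypothesis L2 : forall x, Om x -> `|div_form_op A c v2 x| <= M.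

Let div_bounded : exists C, (forall x, Om x -> `|divergence (flux v1) x| <= C) /\
  forall x, Om x -> `|divergence (flux v2) x| <= C.
Proof.
have [Cc HCc] := holder_bounded hc bOm.
have [B1 B10 HB1] := C0 v1P; have [B2 B20 HB2] := C0 v2P.
have key v B x : Om x -> `|div_form_op A c v x| <= M -> `|v x| <= B ->
    `|divergence (flux v) x| <= M + Cc * B.
  move=> Ox Lv vB; rewrite -[divergence _ _](subrK (c x * v x)) -div_form_opE.
  by rewrite (le_trans (ler_normD _ _))// lerD// normrM ler_pM// HCc.
exists (M + Cc * (B1 + B2)); split=> x Ox; apply: key => //; first exact: L1.
- by rewrite (le_trans (HB1 _ Ox))// lerDl.
- exact: L2.
- by rewrite (le_trans (HB2 _ Ox))// lerDr.
Qed.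

Let pairingE w (k l : bool) x :
  pairing w (fun k => flux (w k)) k l x =
  \sum_i \sum_j A x i j * partial i (w l) x * partial j (w k) x.
Proof.
apply: eq_bigr => i _; rewrite mulr_suml; apply: eq_bigr => j _.
by rewrite mulrAC.
Qed.

Let pairing_sym w k l x : Om x ->
  pairing w (fun k => flux (w k)) k l x = pairing w (fun k => flux (w k)) l k x.
Proof.
move=> Ox; rewrite !pairingE exchange_big; apply: eq_bigr => i _; apply: eq_bigr => j _.
by rewrite -{1}symA// mxE mulrAC.
Qed.

Let pairing_nonneg w x : Om x -> forall a b : R,
  let P := pairing w (fun k => flux (w k)) in
  0 <= a * (a * P true true x + b * P true false x) +
       b * (a * P false true x + b * P false false x).
Proof.
move=> Ox a b; cbv zeta.
pose xi : Rn := \row_i (a * partial i (w true) x + b * partial i (w false) x).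
have : 0 <= \sum_i \sum_j A x i j * xi 0 i * xi 0 j.
  apply: le_trans (ellA xi Ox); rewrite mulr_ge0 ?(ltW delta0)//.
  by apply: sumr_ge0 => i _; exact: sqr_ge0.
move=> /le_trans; apply; rewrite le_eqVlt; apply/orP; left; apply/eqP.
rewrite !pairingE !mulr_sumr -!big_split /= !mulr_sumr -big_split /=.
apply: eq_bigr => i _.
rewrite !mulr_sumr -!big_split /= !mulr_sumr -big_split /=.
by apply: eq_bigr => j _; rewrite !mxE; exact: quadratic_algebra.
Qed.

Let green_hyps (w : bool -> Rn -> R) (wP : forall k, dirichlet_C2 (w k)) :
  (forall k, {within closure Om, continuous (w k)}) /\
  (forall k x, boundary Om x -> w k x = 0).
Proof. by split=> k; have [] := wP k. Qed.

Let dwP (w : bool -> Rn -> R) (wP : forall k, dirichlet_C2 (w k)) k i x :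
  Om x -> has_partial i (w k) x.
Proof. by move=> Ox; have [_ _ d2 _ _] := wP k; have [] := d2 i i x Ox. Qed.

Let dflux v i k x : dirichlet_C2 v -> Om x -> has_partial k (flux v i) x.
Proof. by move=> vP Ox; have [] := is_dflux i k vP Ox. Qed.

Let div_pair_integrable (w : bool -> Rn -> R) (C : R) k l :
  (forall k, dirichlet_C2 (w k)) ->
  (forall k x, Om x -> `|divergence (flux (w k)) x| <= C) ->
  lam.-integrable (toV @^-1` Om)
    (EFin \o ((fun x => divergence (flux (w k)) x * w l x) \o toV)).
Proof.
move=> wP wC; have [cw w0] := green_hyps wP.
have [] // := @cvg_test R n Om w (fun k => flux (w k)) C oOm bOm cw w0
  (fun k i x Ox => cdflux (wP k) Ox) wC k l.
Qed.

Let mOm : measurable (toV @^-1` Om).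
Proof. exact: open_measurable_rV. Qed.

Let cpot_integrable v v' : dirichlet_C2 v -> dirichlet_C2 v' ->
  lam.-integrable (toV @^-1` Om) (EFin \o ((fun x => c x * v x * v' x) \o toV)).
Proof.
move=> vP v'P; have [Cc HCc] := holder_bounded hc bOm.
have [B _ HB] := C0 vP; have [B' _ HB'] := C0 v'P.
apply: (bounded_integrableR mOm _ (C := Cc * B * B')).
- exact: bounded_rV_finite.
- apply: (measurable_continuous_rV oOm) => x Ox.
  exact: (cvgM (cvgM (cc Ox) (cv vP Ox)) (cv v'P Ox)).
- by move=> t Ot /=; rewrite !normrM !ler_pM//; [exact: HCc|exact: HB|exact: HB'].
Qed.

(** The potential term is symmetric by itself; the rest is Green's formula for the fluxes
    A grad v1 and A grad v2, whose divergences are bounded because L v1, L v2 and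
    c are. *)
Lemma div_form_symmetric :
  integral_Rn Om (fun x => div_form_op A c v1 x * v2 x) =
  integral_Rn Om (fun x => div_form_op A c v2 x * v1 x).
Proof.
have [C [C1 C2]] := div_bounded.
pose w (k : bool) := if k then v1 else v2.
have wP k : dirichlet_C2 (w k).
  by case: k; [exact: v1P|exact: v2P].
have wC k x : Om x -> `|divergence (flux (w k)) x| <= C.
  by case: k => Ox; [exact: C1|exact: C2].
have [cw w0] := green_hyps wP.
have G := @green_symmetric R n Om w (fun k => flux (w k)) C oOm bOm cw w0 (dwP wP)
  (fun k i x Ox => cp (wP k) Ox) (fun k i x Ox => cflux (wP k) Ox)
  (fun k i x Ox => @dflux (w k) i i x (wP k) Ox) (fun k i x Ox => cdflux (wP k) Ox) wC
  (fun x Ox => pairing_sym w true false Ox) (fun x Ox => pairing_nonneg w Ox).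
have I12 := div_pair_integrable true false wP wC.
have I21 := div_pair_integrable false true wP wC.
have split_ u u' : lam.-integrable (toV @^-1` Om)
    (EFin \o ((fun x => divergence (flux u) x * u' x) \o toV)) ->
    dirichlet_C2 u -> dirichlet_C2 u' ->
    integral_Rn Om (fun x => div_form_op A c u x * u' x) =
    integral_Rn Om (fun x => divergence (flux u) x * u' x) -
    integral_Rn Om (fun x => c x * u x * u' x).
  move=> I uP u'P; rewrite /integral_Rn -RintegralB//; last exact: cpot_integrable.
  by apply: eq_Rintegral => t _; rewrite div_form_opE mulrBl.
rewrite !split_//; congr (_ - _); first exact: G.
by apply: eq_Rintegral => t _; rewrite mulrAC.
Qed.

Lemma div_form_le0 : integral_Rn Om (fun x => div_form_op A c v1 x * v1 x) <= 0.
Proof.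
have [C [C1 _]] := div_bounded.
pose w (k : bool) := v1.
have wP k : dirichlet_C2 (w k) := v1P.
have wC k x : Om x -> `|divergence (flux (w k)) x| <= C by exact: C1.
have [cw w0] := green_hyps wP.
have G := @green_le0 R n Om w (fun k => flux (w k)) C oOm bOm cw w0 (dwP wP)
  (fun k i x Ox => cp (wP k) Ox) (fun k i x Ox => cflux (wP k) Ox)
  (fun k i x Ox => @dflux (w k) i i x (wP k) Ox) (fun k i x Ox => cdflux (wP k) Ox) wC
  (fun x Ox => pairing_nonneg w Ox).
have I := div_pair_integrable true true wP wC.
have {}G : integral_Rn Om (fun x => divergence (flux v1) x * v1 x) <= 0.
  by move: G; rewrite -mulr2n pmulrn_lle0.
apply: le_trans G; apply: le_Rintegral => //.
- apply: eq_integrable (integrableBR mOm I (cpot_integrable v1P v1P)) => //.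
  by move=> t _ /=; rewrite div_form_opE mulrBl.
- move=> t Ot; rewrite div_form_opE mulrBl gerBl -mulrA -expr2.
  by rewrite mulr_ge0 ?sqr_ge0// c0.
Qed.

End elliptic.

(** * The energy identity in time *)

Lemma compact_unif_continuous (R : realType) (X : pseudoMetricType R) (K : set X)
  (f : X -> R) : compact K -> {within K, continuous f} ->
  forall eps, 0 < eps -> exists2 d, 0 < d &
    forall x y, K x -> K y -> ball x d y -> `|f x - f y| < eps.
Proof.
move=> cK cf eps eps0.
have eps2 : 0 < eps / 2 by rewrite divr_gt0.
have := (compact_near_coveringP K).1 cK R (0^'+)
  (fun d x => K x -> forall y, K y -> ball x d y -> `|f x - f y| < eps) _.
case.
  move=> x Kx.
  have : \forall y \near x, K y -> `|f x - f y| < eps / 2.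
    have /subspace_continuousP/(_ x Kx) := cf.
    by move=> /cvgrPdist_lt/(_ _ eps2).
  move=> /nbhs_ballP[r /= r0 rP].
  exists (ball x (r / 2), [set d | d < r / 2]).
    split; first by apply: nbhsx_ballx; rewrite divr_gt0.
    by apply: nbhs_right_lt; rewrite divr_gt0.
  move=> [y d] [/= xy dr] Ky z Kz yz.
  have xy' : ball x r y by apply: le_ball xy; rewrite ler_pdivrMr// ler_pMr// ler1n.
  have xz : ball x r z.
    rewrite [r]splitr; apply: ball_triangle xy _.
    by apply: le_ball yz; exact: ltW.
  have h1 := rP _ xy' Ky; have h2 := rP _ xz Kz.
  apply: (le_lt_trans (ler_distD (f x) _ _)); rewrite [eps]splitr ltrD//.
  by rewrite distrC.
move=> d /= d0 H; have d2 : 0 < d / 2 by rewrite divr_gt0.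
exists (d / 2) => // x y Kx Ky; apply: (H (d / 2)) => //=.
by rewrite sub0r normrN gtr0_norm// ltr_pdivrMr// ltr_pMr// ltr1n.
Qed.

Section increments.
Context {R : realType}.
Local Notation mu := (@lebesgue_measure R).

Lemma continuous_within_sub (a b : R) (f : R -> R) (A : set R) : [set` `[a, b]] `<=` A ->
  {within A, continuous f} -> {within `[a, b], continuous f}.
Proof. by move=> sub cf; exact: continuous_subspaceW sub cf. Qed.

Lemma Rintegral_increment (f : R -> R) (T s t : R) :
  {within `[0, T], continuous f} -> 0 <= s -> s <= t -> t <= T ->
  \int[mu]_(r in `]0, t[) f r - \int[mu]_(r in `]0, s[) f r =
  \int[mu]_(r in `]s, t[) f r.
Proof.
move=> cf s0 st tT.
have i0 u : 0 <= u -> u <= T -> mu.-integrable `[0, u] (EFin \o f).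
  move=> u0 uT; apply/continuous_integrable_cc/(continuous_within_sub _ cf).
  by apply: subset_itvl; rewrite bnd_simp.
have i0t := i0 _ (le_trans s0 st) tT; have i0s := i0 _ s0 (le_trans st tT).
have ist : mu.-integrable `[s, t] (EFin \o f).
  by apply: integrableS i0t => //; apply: subset_itvr; rewrite bnd_simp.
have ist' : mu.-integrable `]s, t] (EFin \o f).
  by apply: integrableS ist => //; apply: subset_itv; rewrite bnd_simp.
rewrite !Rintegral_oo_cc// -[RHS]Rintegral_itv_obnd_cbnd//.
by rewrite Rintegral_itvB//; rewrite bnd_simp.
Qed.

Lemma le_norm_Rintegral_oo (f : R -> R) (s t C : R) :
  {within `[s, t], continuous f} -> s <= t ->
  (forall r, s <= r <= t -> `|f r| <= C) ->
  `|\int[mu]_(r in `]s, t[) f r| <= C * (t - s).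
Proof.
move=> cf st fC.
have fi := continuous_integrable_oo cf.
apply: (le_trans (le_normr_Rintegral _ fi)) => //.
apply: (@le_trans _ _ (\int[mu]_(r in `]s, t[) cst C r)).
  apply: le_Rintegral => //; first exact: integrable_norm.
    by apply/continuous_integrable_oo/continuous_subspaceT => ?; exact: cvg_cst.
  move=> r; rewrite /= in_itv /= => /andP[sr rt].
  by apply: fC; rewrite !ltW.
rewrite Rintegral_cst//.
have -> : fine (mu [set` `]s, t[]) = t - s; last by [].
have e : lebesgue_measure [set` `]s, t[] = (t - s)%:E :> \bar R.
  rewrite lebesgue_measure_itv /= lte_fin; case: ltP => // ts.
  by rewrite (le_anti (_ : s <= t <= s)) ?subrr// st.
exact: (congr1 fine e).
Qed.

(** A function with increments o(t - s), uniformly, is constant: add up the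
    increments over a fine subdivision. *)
Lemma small_increments_constant (f : R -> R) (T : R) :
  (forall eps, 0 < eps -> exists2 d, 0 < d &
    forall s t, 0 < s -> s <= t -> t <= T -> t - s < d -> `|f t - f s| <= eps * (t - s)) ->
  forall s t, 0 < s -> s <= t -> t <= T -> f t = f s.
Proof.
move=> H s t s0 st tT; apply/eqP; rewrite -subr_eq0 -normr_eq0 eq_le normr_ge0 andbT.
apply/ler_addgt0Pl => eps eps0; rewrite addr0.
have ts1 : 0 < t - s + 1 by rewrite ltr_wpDl// subr_ge0.
have [d d0 Hd] := H (eps / (t - s + 1)) (divr_gt0 eps0 ts1).
set e' := eps / (t - s + 1) in Hd.
have e'0 : 0 < e' by rewrite divr_gt0.
pose m := Num.bound ((t - s) / d).
pose h := (t - s) / m.+1%:R.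
have h0 : 0 <= h by rewrite divr_ge0// subr_ge0.
have hd : h < d.
  rewrite /h ltr_pdivrMr// mulrC -ltr_pdivrMr//.
  apply: (lt_le_trans (archi_boundP _)); first by rewrite divr_ge0 ?subr_ge0// ltW.
  by rewrite ler_nat.
have mh : m.+1%:R * h = t - s by rewrite /h mulrC divfK.
have step k : (k <= m.+1)%N -> `|f (s + k%:R * h) - f s| <= e' * (k%:R * h).
  elim: k => [_|k IH km]; first by rewrite !mul0r mulr0 addr0 subrr normr0.
  apply: (le_trans (ler_distD (f (s + k%:R * h)) _ _)).
  have e : k.+1%:R * h = k%:R * h + h by rewrite -natr1 mulrDl mul1r.
  have kh0 : 0 <= k%:R * h by rewrite mulr_ge0.
  have eh : s + k.+1%:R * h - (s + k%:R * h) = h by rewrite e; ring.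
  rewrite e mulrDr addrC lerD//; first exact/IH/ltnW.
  rewrite -e -{3}eh; apply: Hd.
  - by rewrite ltr_pwDl.
  - by rewrite -subr_ge0 eh.
  - by apply: le_trans tT; rewrite -lerBrDl -mh ler_wpM2r// ler_nat.
  - by rewrite eh.
have := step m.+1 (leqnn _); rewrite mh (addrC s) subrK => /le_trans; apply.
rewrite /e' mulrAC ler_pdivrMr// ler_wpM2l ?(ltW eps0)//.
by rewrite lerDl.
Qed.

End increments.

Lemma near_prod_ball (R : realType) (X Y : pseudoMetricType R) (x : X) (y : Y)
  (P : X * Y -> Prop) : (\forall p \near (x, y), P p) ->
  exists2 r, 0 < r & forall x' y', ball x r x' -> ball y r y' -> P (x', y').
Proof.
move=> /nbhs_ballP[r /= r0 rP]; exists r => // x' y' xx' yy'.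
by apply: rP; split.
Qed.

Lemma Phi_algebra (R : realType) (jt js tt ts st ss : R) : ts = st ->
  2 * jt - tt - (2 * js - ss) = 2 * (jt - js) - (tt - ts + (st - ss)).
Proof. by move=> ->; ring. Qed.

Lemma work_algebra (R : realType) (j d : R) : 2 * j - d = 0 -> d <= 0 -> j <= 0.
Proof. lra. Qed.

Lemma Phi_bound_algebra (R : realType) (j d B : R) : `|j| <= B -> `|d| <= B ->
  `|2 * j - d| <= 3 * B.
Proof.
rewrite !ler_norml => /andP[? ?] /andP[? ?]; apply/andP; split; lra.
Qed.

Section energy_identity.
Context {R : realType} {n : nat}.
Local Notation Rn := 'rV[R]_n.
Local Notation toV := (@rV_of_tuple R n).
Local Notation lam := (lebesgue_tuple R n).
Local Notation mu := (@lebesgue_measure R).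
(* D stands for the difference of the Caputo derivatives, v for the velocity and w for
   the displacement; sym and neg are what the equation and the ellipticity
   leave of the operator L. *)
Variables (Om : set Rn) (T : R) (D v w : R -> Rn -> R).
Hypotheses (oOm : open Om) (bOm : bounded_set Om) (T0 : 0 < T).
Local Notation K := (cylinder `[0, T] (closure Om)).
Hypothesis cD : {within K, continuous (fun p => D p.1 p.2)}.
Hypothesis cv : {within K, continuous (fun p => v p.1 p.2)}.
Hypothesis wE : forall t x, 0 <= t <= T -> Om x ->
  w t x = \int[mu]_(s in `]0, t[) v s x.
Hypothesis sym : forall s t, 0 < s <= T -> 0 < t <= T ->
  integral_Rn Om (fun x => D t x * w s x) = integral_Rn Om (fun x => D s x * w t x).
Hypothesis neg : forall t, 0 < t <= T -> integral_Rn Om (fun x => D t x * w t x) <= 0.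

Let compactK : compact K.
Proof.
apply: compact_setX; first exact: segment_compact.
exact: compact_closure_rV.
Qed.

Let inK t x : 0 <= t <= T -> Om x -> K (t, x).
Proof. by move=> tT Ox; split; [rewrite /= in_itv|exact: subset_closure]. Qed.

Let mOm : measurable (toV @^-1` Om).
Proof. exact: open_measurable_rV. Qed.

Let finOm : (lam (toV @^-1` Om) < +oo)%E.
Proof. exact: bounded_rV_finite. Qed.

Lemma within_cylinder_slice (u : R -> Rn -> R) x : Om x ->
  {within K, continuous (fun p => u p.1 p.2)} -> {within `[0, T], continuous (u ^~ x)}.
Proof.
move=> Ox /subspace_continuousP cu; apply/subspace_continuousP => t tT.
have Kt : K (t, x) by split => //; exact: subset_closure.
move=> B /(cu _ Kt) HB.
have {}HB : \forall p \near (t, x), K p -> B (u p.1 p.2) := HB.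
have [r r0 rP] := near_prod_ball HB.
have : \forall s \near t, `[0, T]%classic s -> B (u s x).
  apply/nbhs_ballP; exists r => //= s ts sT.
  by apply: (rP s x ts (ballxx _ r0)); split => //; exact: subset_closure.
by [].
Qed.

Lemma within_cylinder_section (u : R -> Rn -> R) t x : 0 <= t <= T -> Om x ->
  {within K, continuous (fun p => u p.1 p.2)} -> {for x, continuous (u t)}.
Proof.
move=> tT Ox /subspace_continuousP/(_ _ (inK tT Ox)) cu B /cu HB.
have {}HB : \forall p \near (t, x), K p -> B (u p.1 p.2) := HB.
have [r r0 rP] := near_prod_ball HB.
have : \forall y \near x, B (u t y).
  have : \forall y \near x, ball x r y by exact: nbhsx_ballx.
  apply: filterS2 (near_open oOm Ox) => y Oy xy.
  by apply: (rP t y (ballxx _ r0) xy); exact: inK.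
by [].
Qed.

Lemma primitive_continuous (u : R -> Rn -> R) t x : 0 <= t <= T -> Om x ->
  {within K, continuous (fun p => u p.1 p.2)} ->
  {for x, continuous (fun x => \int[mu]_(s in `]0, t[) u s x)}.
Proof.
move=> /andP[t0 tT] Ox cu; apply/continuous_at_dist => eps eps0.
have t1 : 0 < t + 1 by rewrite ltr_wpDl.
have [d d0 ud] := compact_unif_continuous compactK cu (divr_gt0 eps0 t1).
have slice y : Om y -> {within `[0, t], continuous (u ^~ y)}.
  move=> Oy; apply: continuous_within_sub (within_cylinder_slice Oy cu).
  by apply: subset_itvl; rewrite bnd_simp.
near=> y.
have Oy : Om y by near: y; exact: (near_open oOm Ox).
have xy : ball x d y by near: y; exact: nbhsx_ballx.
rewrite -RintegralB//; [|exact: continuous_integrable_oo (slice _ Ox)|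
  exact: continuous_integrable_oo (slice _ Oy)].
apply: (@le_lt_trans _ _ (eps / (t + 1) * (t - 0))).
  apply: le_norm_Rintegral_oo => //.
    by move=> s; apply: cvgB; [exact: slice|exact: slice].
  move=> s /andP[s0 st]; have sT : 0 <= s <= T by rewrite s0 (le_trans st).
  apply/ltW/(ud (s, x) (s, y)); [exact: inK|exact: inK|].
  by split => //; exact: ballxx.
rewrite subr0 mulrAC ltr_pdivrMr// ltr_pM2l// ltrDl//.
Unshelve. all: by end_near.
Qed.

Lemma primitive_bound (u : R -> Rn -> R) (C t : R) x : 0 <= t <= T -> Om x ->
  {within K, continuous (fun p => u p.1 p.2)} ->
  (forall p, K p -> `|u p.1 p.2| <= C) ->
  `|\int[mu]_(s in `]0, t[) u s x| <= C * t.
Proof.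
move=> /andP[t0 tT] Ox cu uC; rewrite -[X in _ <= _ * X](subr0 t).
apply: le_norm_Rintegral_oo => //.
  apply: continuous_within_sub (within_cylinder_slice Ox cu).
  by apply: subset_itvl; rewrite bnd_simp.
move=> s /andP[s0 st]; apply: (uC (s, x)); apply: inK => //.
by rewrite s0 (le_trans st).
Qed.

Lemma section_integrable (g : Rn -> R) C : (forall x, Om x -> {for x, continuous g}) ->
  (forall x, Om x -> `|g x| <= C) ->
  lam.-integrable (toV @^-1` Om) (EFin \o (g \o toV)).
Proof.
move=> cg gC; apply: (bounded_integrableR mOm finOm (C := C)).
  exact: measurable_continuous_rV.
by move=> t; exact: gC.
Qed.

Let DV s x := D s x * v s x.

Let J t x := \int[mu]_(s in `]0, t[) DV s x.

Let cDv : {within K, continuous (fun p => DV p.1 p.2)}.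
Proof. by move=> p; apply: cvgM; [exact: cD|exact: cv]. Qed.

Let bounds : exists2 B, 0 <= B & forall p, K p -> `|D p.1 p.2| <= B /\ `|v p.1 p.2| <= B.
Proof.
have [B1 B10 H1] := compact_bound compactK cD.
have [B2 B20 H2] := compact_bound compactK cv.
exists (B1 + B2); first exact: addr_ge0.
move=> p Kp; split; first by rewrite (le_trans (H1 _ Kp))// lerDl.
by rewrite (le_trans (H2 _ Kp))// lerDr.
Qed.

Let cw t x : 0 <= t <= T -> Om x -> {for x, continuous (w t)}.
Proof.
move=> tT Ox; apply: continuous_near_eq (primitive_continuous tT Ox cv).
by apply: filterS (near_open oOm Ox) => y Oy; exact: wE.
Qed.

Let wC B t x : (forall p, K p -> `|D p.1 p.2| <= B /\ `|v p.1 p.2| <= B) ->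
  0 <= t <= T -> Om x -> `|w t x| <= B * t.
Proof.
by move=> H tT Ox; rewrite wE//; apply: primitive_bound => // p /H[].
Qed.

Let iDw s t : 0 <= s <= T -> 0 <= t <= T ->
  lam.-integrable (toV @^-1` Om) (EFin \o ((fun x => D s x * w t x) \o toV)).
Proof.
move=> sT tT; have [B B0 H] := bounds.
apply: (@section_integrable _ (B * (B * t))) => x Ox.
  exact: (cvgM (within_cylinder_section sT Ox cD) (cw tT Ox)).
rewrite normrM ler_pM//; last exact: wC.
by have [] := H (s, x) (inK sT Ox).
Qed.

Let iJ t : 0 <= t <= T -> lam.-integrable (toV @^-1` Om) (EFin \o (J t \o toV)).
Proof.
move=> tT; have [B B0 H] := bounds.
apply: (@section_integrable _ (B * B * t)) => x Ox.
  exact: (primitive_continuous tT Ox cDv).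
apply: (primitive_bound tT Ox cDv) => p Kp.
by rewrite normrM; have [? ?] := H _ Kp; rewrite ler_pM.
Qed.

(* Twice the work done up to time t minus the pairing that it would equal if D were
   differentiable in time. *)
Let Phi t := 2 * integral_Rn Om (J t) - integral_Rn Om (fun x => D t x * w t x).

Let PhiE s t : 0 < s -> s <= t -> t <= T -> Phi t - Phi s =
  integral_Rn Om (fun x => 2 * (J t x - J s x) - (D t x + D s x) * (w t x - w s x)).
Proof.
move=> s0 st tT.
have sT1 : 0 < s <= T by rewrite s0 (le_trans st).
have tT1 : 0 < t <= T by rewrite (lt_le_trans s0 st).
have sT : 0 <= s <= T by rewrite (ltW s0) (le_trans st).
have tT' : 0 <= t <= T by rewrite (le_trans (ltW s0) st).
have [it is_] := (iJ tT', iJ sT).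
have itt := iDw tT' tT'; have its := iDw tT' sT; have ist := iDw sT tT'; have iss := iDw sT sT.
have iJJ : lam.-integrable (toV @^-1` Om) (EFin \o ((fun x => 2 * (J t x - J s x)) \o toV)).
  exact: (integrableZlR 2 mOm (integrableBR mOm it is_)).
have iA : lam.-integrable (toV @^-1` Om)
  (EFin \o ((fun x => D t x * w t x - D t x * w s x) \o toV)) := integrableBR mOm itt its.
have iB : lam.-integrable (toV @^-1` Om)
  (EFin \o ((fun x => D s x * w t x - D s x * w s x) \o toV)) := integrableBR mOm ist iss.
transitivity (integral_Rn Om (fun x => 2 * (J t x - J s x) -
  ((D t x * w t x - D t x * w s x) + (D s x * w t x - D s x * w s x)))); last first.
  by apply: eq_Rintegral => y _; congr (_ - _); rewrite mulrDl !mulrBr.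
rewrite /integral_Rn RintegralB//; last exact: (integrableDR mOm iA iB).
rewrite RintegralZl//; last exact: (integrableBR mOm it is_).
rewrite RintegralB// RintegralD// RintegralB// RintegralB//.
have := sym sT1 tT1; rewrite /Phi /integral_Rn.
exact: Phi_algebra.
Qed.

(* The integrand of PhiE is the integral over ]s, t[ of
   ((D r - D t) + (D r - D s)) * v r, where D oscillates little. *)
Let Phi_increment eps : 0 < eps -> exists2 d, 0 < d &
  forall s t, 0 < s -> s <= t -> t <= T -> t - s < d -> `|Phi t - Phi s| <= eps * (t - s).
Proof.
move=> eps0; have [B B0 H] := bounds.
pose L := fine (lam (toV @^-1` Om)).
have L0 : 0 <= L by apply: fine_ge0.
pose C := 2 * B * L + 1.
have C0 : 0 < C by rewrite ltr_wpDl// !mulr_ge0.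
have [d d0 Dd] := compact_unif_continuous compactK cD (divr_gt0 eps0 C0).
exists d => // s t s0 st tT tsd; rewrite PhiE//.
set e := eps / C in Dd; have e0 : 0 < e by rewrite divr_gt0.
have sT : 0 <= s <= T by rewrite (ltW s0) (le_trans st).
have tT' : 0 <= t <= T by rewrite (le_trans (ltW s0) st).
have key x : Om x -> `|2 * (J t x - J s x) - (D t x + D s x) * (w t x - w s x)| <=
    2 * e * B * (t - s).
  move=> Ox; rewrite !wE//.
  rewrite (Rintegral_increment (within_cylinder_slice Ox cv) (ltW s0) st tT).
  rewrite /J (Rintegral_increment (within_cylinder_slice Ox cDv) (ltW s0) st tT).
  have sub (f : R -> R) : {within `[0, T], continuous f} -> {within `[s, t], continuous f}.
    by apply: continuous_within_sub; apply: subset_itv; rewrite bnd_simp// ltW.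
  have cv' := sub _ (within_cylinder_slice Ox cv).
  have cDv' := sub _ (within_cylinder_slice Ox cDv).
  have iv := continuous_integrable_oo cv'; have iDv := continuous_integrable_oo cDv'.
  rewrite -RintegralZl// -RintegralZl//.
  rewrite -RintegralB//; [|exact: integrableZlR|exact: integrableZlR].
  apply: le_norm_Rintegral_oo => //.
    move=> r; apply: cvgB; first by apply: cvgMr; exact: cDv'.
    by apply: cvgMr; exact: cv'.
  move=> r /andP[sr rt].
  have rT : 0 <= r <= T by rewrite (le_trans (ltW s0) sr) (le_trans rt).
  have near_ u : 0 <= u <= T -> `|r - u| < d -> `|D r x - D u x| <= e.
    move=> uT ru; apply/ltW/(Dd (r, x) (u, x)); [exact: inK|exact: inK|].
    by split; [|exact: ballxx].
  have nt := near_ t tT' _; have ns := near_ s sT _.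
  have {}nt : `|D r x - D t x| <= e.
    by apply: nt; rewrite distrC ger0_norm ?subr_ge0// (le_lt_trans _ tsd)// lerB.
  have {}ns : `|D r x - D s x| <= e.
    by apply: ns; rewrite ger0_norm ?subr_ge0// (le_lt_trans _ tsd)// lerB.
  have -> : 2 * (D r x * v r x) - (D t x + D s x) * v r x =
    ((D r x - D t x) + (D r x - D s x)) * v r x by ring.
  rewrite normrM ler_pM//; last by have [] := H (r, x) (inK rT Ox).
  by rewrite (le_trans (ler_normD _ _))// mulr_natl mulr2n lerD.
have itot : lam.-integrable (toV @^-1` Om) (EFin \o ((fun x =>
    2 * (J t x - J s x) - (D t x + D s x) * (w t x - w s x)) \o toV)).
  apply: (@section_integrable _ (2 * e * B * (t - s))) => // x Ox.
  have cJt := primitive_continuous tT' Ox cDv; have cJs := primitive_continuous sT Ox cDv.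
  have cDt := within_cylinder_section tT' Ox cD; have cDs := within_cylinder_section sT Ox cD.
  exact: (cvgB (cvgM (cvg_cst (2 : R)) (cvgB cJt cJs))
    (cvgM (cvgD cDt cDs) (cvgB (cw tT' Ox) (cw sT Ox)))).
apply: (le_trans (le_normr_Rintegral mOm itot)).
apply: (@le_trans _ _ (\int[lam]_(y in toV @^-1` Om) (2 * e * B * (t - s)))).
  apply: le_Rintegral => //; first exact: integrable_norm.
    by apply: (bounded_integrableR mOm finOm (C := `|2 * e * B * (t - s)|)) => //;
      exact: measurable_cst.
  by move=> y Oy; exact: key.
rewrite Rintegral_cst// -/L.
have -> : 2 * e * B * (t - s) * L = e * (2 * B * L) * (t - s) by ring.
rewrite ler_wpM2r ?subr_ge0//.
by rewrite /e mulrAC ler_pdivrMr// ler_wpM2l ?(ltW eps0)// lerDl.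
Qed.

(** Phi is constant on ]0, T] and Phi s = O(s), so Phi = 0: twice the work is the pairing
    of D t with w t. *)
Lemma work_le0 t : 0 < t <= T ->
  integral_Rn Om (fun x => \int[mu]_(s in `]0, t[) (D s x * v s x)) <= 0.
Proof.
move=> /[dup] tT /andP[t0 tT'].
suff P0 : Phi t = 0.
  have := neg tT; move: P0; rewrite /Phi; exact: work_algebra.
have [B B0 H] := bounds.
pose L := fine (lam (toV @^-1` Om)).
have L0 : 0 <= L by apply: fine_ge0.
apply/eqP; rewrite -normr_eq0 eq_le normr_ge0 andbT.
apply/ler_addgt0Pl => eps eps0; rewrite addr0.
pose C := 3 * (B * B) * L + 1.
have C0 : 0 < C by rewrite ltr_wpDl// !mulr_ge0.
pose s := Num.min t (eps / C).
have s0 : 0 < s by rewrite lt_min t0 divr_gt0.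
have st : s <= t by rewrite ge_min lexx.
have sT : 0 <= s <= T by rewrite (ltW s0) (le_trans st).
rewrite (small_increments_constant Phi_increment s0 st tT').
have b1 : `|integral_Rn Om (J s)| <= B * B * s * L.
  apply: (le_trans (le_normr_Rintegral mOm (iJ sT))).
  rewrite -Rintegral_cst//; apply: le_Rintegral => //.
  - by apply: integrable_norm; exact: iJ.
  - by apply: (bounded_integrableR mOm finOm (C := `|B * B * s|)) => //;
      exact: measurable_cst.
  - move=> y Oy; apply: (primitive_bound sT Oy cDv) => p Kp.
    by rewrite normrM; have [? ?] := H _ Kp; rewrite ler_pM.
have b2 : `|integral_Rn Om (fun x => D s x * w s x)| <= B * B * s * L.
  apply: (le_trans (le_normr_Rintegral mOm (iDw sT sT))).
  rewrite -Rintegral_cst//; apply: le_Rintegral => //.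
  - by apply: integrable_norm; exact: iDw.
  - by apply: (bounded_integrableR mOm finOm (C := `|B * B * s|)) => //;
      exact: measurable_cst.
  - move=> y Oy; rewrite /= normrM -mulrA ler_pM//; last exact: wC.
    by have [] := H (s, toV y) (inK sT Oy).
apply: (@le_trans _ _ (3 * (B * B * s * L))).
  by rewrite /Phi; exact: Phi_bound_algebra.
have -> : 3 * (B * B * s * L) = 3 * (B * B) * L * s by ring.
have : s <= eps / C by rewrite ge_min lexx orbT.
rewrite ler_pdivlMr// mulrC => h; apply: le_trans h.
by rewrite ler_wpM2r ?(ltW s0)// lerDl.
Qed.

End energy_identity.

(** * Time derivatives and the Caputo derivative *)

Section time_interval.
Context {R : realType}.
Local Notation mu := (@lebesgue_measure R).

Lemma is_derive_derive_in (T : R) (y : R -> R) (t : R) : 0 < t < T -> derivable_in T y t ->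
  is_derive t (1 : R) y (derive_in T y t).
Proof.
move=> /andP[t0 tT] dy.
have H : h^-1 *: ((y \o shift t) (h *: (1 : R)) - y t) @[h --> (0 : R)^'] --> derive_in T y t.
  move=> B /dy HB.
  have {}HB : \forall s \near t, s != t -> `[0, T]%classic s -> B (diff_quotient y t s).
    exact: HB.
  have tin : \forall s \near t, `[0, T]%classic s.
    have : \forall s \near t, s \in `]0, T[ by apply: near_in_itvoo; rewrite in_itv /= t0.
    by apply: filterS => s; exact: subset_itv_oo_cc.
  have : \forall s \near t, s != t -> B (diff_quotient y t s).
    by apply: filterS2 HB tin => s h sT st; exact: h.
  rewrite (near_shift 0 t) => HB'.
  have : \forall h \near (0 : R), h != 0 ->
      B (h^-1 *: ((y \o shift t) (h *: (1 : R)) - y t)).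
    apply: filterS HB' => h /= hB h0; move: hB; rewrite subr0 /diff_quotient addrK.
    by rewrite [h%:A]mulr1; apply; rewrite -subr_eq0 addrK.
  by [].
apply: DeriveDef; first by apply/cvg_ex; exists (derive_in T y t).
exact/cvg_lim.
Qed.

Lemma derive_in_primitive (T : R) (y : R -> R) (t : R) :
  (forall s, 0 <= s <= T -> derivable_in T y s) ->
  {within `[0, T], continuous y} -> {within `[0, T], continuous (derive_in T y)} ->
  0 <= t <= T -> y t - y 0 = \int[mu]_(s in `]0, t[) derive_in T y s.
Proof.
move=> dy cy cdy /andP[]; rewrite le_eqVlt => /predU1P[<- _|t0 tT].
  by rewrite subrr set_itvoo0 Rintegral_set0.
have sub : [set` `[0, t]] `<=` [set` `[0, T]] by apply: subset_itvl; rewrite bnd_simp.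
have cdy' := continuous_within_sub sub cdy; have cy' := continuous_within_sub sub cy.
rewrite Rintegral_oo_cc; last exact: continuous_integrable_cc.
have D s : s \in `]0, t[ -> is_derive s (1 : R) y (derive_in T y s).
  rewrite in_itv /= => /andP[s0 st].
  have sT : s < T by exact: lt_le_trans st tT.
  by apply: is_derive_derive_in; [rewrite s0 sT|apply: dy; rewrite !ltW].
rewrite /Rintegral (@continuous_FTC2 _ (derive_in T y) y)//.
- have [_ ? ?] := (continuous_within_itvP y t0).1 cy'.
  by split => // s /D[].
- by move=> s /D; rewrite derive1E => -[_ ->].
Qed.

Lemma clip_continuous (T : R) (f : R -> R) : 0 <= T -> {within `[0, T], continuous f} ->
  continuous (fun s => f (Num.max 0 (Num.min s T))).
Proof.
move=> T0 /subspace_continuousP cf s.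
have sT : `[0, T]%classic (Num.max 0 (Num.min s T)).
  by rewrite /= in_itv /= le_max lexx ge_max T0 ge_min lexx orbT.
have cclip : {for s, continuous (fun s => Num.max 0 (Num.min s T))}.
  by apply: continuous_max; [exact: cvg_cst|apply: continuous_min;
    [exact: cvg_id|exact: cvg_cst]].
move=> B /(cf _ sT) HB.
have {}HB : \forall r \near Num.max 0 (Num.min s T), `[0, T]%classic r -> B (f r) := HB.
have : \forall r \near s, B (f (Num.max 0 (Num.min r T))).
  have cc : \forall r \near s, `[0, T]%classic (Num.max 0 (Num.min r T)) ->
      B (f (Num.max 0 (Num.min r T))) := cclip _ HB.
  apply: filterS cc => r; apply.
  by rewrite /= in_itv /= le_max lexx ge_max T0 ge_min lexx orbT.
by [].
Qed.

Lemma continuous_integral_sqr_eq0 (T : R) (f : R -> R) t : {within `[0, T], continuous f} ->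
  0 < t <= T -> \int[mu]_(s in `]0, t[) (f s ^+ 2) <= 0 ->
  forall s, 0 < s < t -> f s = 0.
Proof.
move=> cf /andP[t0 tT] If r /andP[r0 rt].
apply/eqP/negPn/negP => fr0.
have cf2 : {within `[0, T], continuous (fun s => f s ^+ 2)}.
  by apply/subspace_continuousP => s sT; apply: cvg_sqr; exact: (subspace_continuousP _ _).1 cf s sT.
have rT : 0 <= r <= T by rewrite (ltW r0) (le_trans (ltW rt)).
pose e := f r ^+ 2 / 2.
have fr2 : 0 < f r ^+ 2 by rewrite exprn_even_gt0.
have e0 : 0 < e by rewrite divr_gt0.
have : \forall s \near r, `[0, T]%classic s -> e < f s ^+ 2.
  have /subspace_continuousP/(_ r) := cf2; rewrite /= in_itv => /(_ rT) /cvgr_gt; apply.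
  by rewrite ltr_pdivrMr// ltr_pMr// ltr1n.
move=> /nbhs_ballP[d /= d0 dP].
pose m := Num.min t (r + d).
have rm : r < m by rewrite lt_min rt ltrDl.
have mt : m <= t by rewrite ge_min lexx.
have pos a b : 0 <= \int[mu]_(s in `]a, b[) (f s ^+ 2).
  by apply: Rintegral_ge0 => s _; exact: sqr_ge0.
have : 0 < \int[mu]_(s in `]r, m[) (f s ^+ 2).
  apply: (@lt_le_trans _ _ (\int[mu]_(s in `]r, m[) e)).
    rewrite Rintegral_cst// mulr_gt0//.
    have m_ : lebesgue_measure [set` `]r, m[] = (m - r)%:E :> \bar R.
      by rewrite lebesgue_measure_itv /= lte_fin rm.
    by rewrite [X in 0 < X](congr1 fine m_) subr_gt0.
  have sub : {within `[r, m], continuous (fun s => f s ^+ 2)}.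
    by apply: continuous_within_sub cf2; apply: subset_itv; rewrite bnd_simp ?(ltW r0)// (le_trans mt).
  apply: le_Rintegral => //; last 1 first.
  - move=> s; rewrite /= in_itv /= => /andP[rs sm]; apply/ltW/dP.
      rewrite /ball /= distrC gtr0_norm ?subr_gt0// ltrBlDl.
      by move: sm; rewrite lt_min => /andP[].
    by rewrite /= in_itv /= (ltW (lt_trans r0 rs)) (le_trans (ltW sm)) ?(le_trans mt).
  - by apply/continuous_integrable_oo/continuous_subspaceT => ?; exact: cvg_cst.
  - exact: continuous_integrable_oo.
rewrite ltNge => /negP; apply.
have i1 := Rintegral_increment cf2 (ltW r0) (ltW rm) (le_trans mt tT).
have i2 := Rintegral_increment cf2 (ltW (lt_trans r0 rm)) mt tT.
have := pos m t; rewrite -i2 subr_ge0 => H.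
by rewrite -i1 subr_le0 (le_trans H)// (le_trans If).
Qed.

End time_interval.

Section caputo_difference.
Context {R : realType}.
Local Notation mu := (@lebesgue_measure R).
Variables (T alpha : R) (y1 y2 : R -> R).
Hypotheses (T0 : 0 < T) (alpha12 : 1 < alpha < 2).
Hypotheses (d1 : caputo_defined T alpha y1) (d2 : caputo_defined T alpha y2).

Let dy s := derive_in T y1 s - derive_in T y2 s.

Let dC t := caputo alpha y1 t - caputo alpha y2 t.

Hypotheses (dy0 : dy 0 = 0) (cdy : {within `[0, T], continuous dy}).

Let p s := y1^`(2)%classic s - y2^`(2)%classic s.

(* The memory estimates use velocities defined at all times, vanishing at negative
   ones; dy is extended by its end values. *)
Let v s := dy (Num.max 0 (Num.min s T)).

Let vE s : 0 <= s <= T -> v s = dy s.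
Proof. by move=> /andP[s0 sT]; rewrite /v (min_l sT) (max_r s0). Qed.

Let alpha01 : 0 < alpha - 1 < 1.
Proof. by case/andP: alpha12 => a1 a2; rewrite subr_gt0 a1 ltrBlDr. Qed.

Let ip : mu.-integrable `]0, T[ (EFin \o p).
Proof.
have [_ i1 _ _] := d1; have [_ i2 _ _] := d2.
by apply: (integrableBR _ i1 i2); exact: measurable_itv.
Qed.

Let vI t : 0 <= t <= T -> v t = \int[mu]_(s in `]0, t[) p s.
Proof.
move=> /[dup] tT /andP[t0 tT']; rewrite vE//.
have [_ i1 e1 _] := d1; have [_ i2 e2 _] := d2.
have sub : [set` `]0, t[] `<=` [set` `]0, T[] by apply: subset_itvl; rewrite bnd_simp.
have i1t : mu.-integrable `]0, t[ (EFin \o y1^`(2)%classic) by exact: integrableS i1.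
have i2t : mu.-integrable `]0, t[ (EFin \o y2^`(2)%classic) by exact: integrableS i2.
rewrite /p (RintegralB _ i1t i2t); last exact: measurable_itv.
rewrite /dy e1 ?in_itv// e2 ?in_itv//.
have := dy0; rewrite /dy; move: (derive_in _ _ _) (derive_in _ _ _) => a b.
by move=> /eqP; rewrite subr_eq0 => /eqP ->; rewrite opprD addrACA subrr add0r.
Qed.

Let kernelE y t : caputo_integrand alpha y t =
  fun s => y^`(2)%classic s * (t - s) `^ (- (alpha - 1)).
Proof. by apply/funext => s; rewrite /caputo_integrand powRN. Qed.

Let ik k t : 0 < t <= T -> mu.-integrable `]0, t[ (EFin \o
  (fun s => (if k then y1 else y2)^`(2)%classic s * (t - s) `^ (- (alpha - 1)))).
Proof.
move=> tT; rewrite -kernelE; case: k.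
  by have [_ _ _] := d1; apply; rewrite in_itv.
by have [_ _ _] := d2; apply; rewrite in_itv.
Qed.

Let ipk t : 0 < t <= T -> mu.-integrable `]0, t[
  (EFin \o (fun s => p s * (t - s) `^ (- (alpha - 1)))).
Proof.
move=> tT.
have e : (fun s => p s * (t - s) `^ (- (alpha - 1))) = (fun s =>
    y1^`(2)%classic s * (t - s) `^ (- (alpha - 1)) -
    y2^`(2)%classic s * (t - s) `^ (- (alpha - 1))).
  by apply/funext => s; rewrite mulrBl.
by rewrite e; apply: (integrableBR _ (ik true tT) (ik false tT)); exact: measurable_itv.
Qed.

Let dCE t : 0 < t <= T -> dC t = (Gamma (2 - alpha))^-1 *
  \int[mu]_(s in `]0, t[) (p s * (t - s) `^ (- (alpha - 1))).
Proof.
move=> tT; rewrite /dC /caputo -mulrBr !kernelE; congr (_ * _).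
rewrite -(RintegralB _ (ik true tT) (ik false tT)); last exact: measurable_itv.
by apply: eq_Rintegral => s _; rewrite mulrBl.
Qed.

Let v0 s : s <= 0 -> v s = 0.
Proof.
by move=> s0; rewrite /v (min_l (le_trans s0 (ltW T0))) max_l.
Qed.

(** The memory estimate with b = alpha - 1. The kernel acts on the pointwise second
    derivatives y1'' - y2'', whose primitive is the difference of the velocities by
    the absolute continuity contained in caputo_defined. *)
Lemma caputo_energy t : 0 < t <= T ->
  (Gamma (2 - alpha))^-1 * (t `^ (- (alpha - 1)) * \int[mu]_(s in `]0, t[) (dy s ^+ 2)) <=
  \int[mu]_(s in `]0, t[) (dC s * dy s).
Proof.
move=> /[dup] tT /andP[t0 tT'].
have sT s : s \in `]0%R, t[ -> 0 < s <= T.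
  by rewrite in_itv /= => /andP[-> st]; rewrite (le_trans (ltW st)).
have cv : continuous v by exact: clip_continuous (ltW T0) cdy.
have [iv E] := memory_energy alpha01 ip cv v0 vI ipk tT.
have G0 : 0 < (Gamma (2 - alpha))^-1.
  rewrite invr_gt0; apply: Gamma_gt0.
  by case/andP: alpha12 => a1 a2; rewrite subr_gt0 a2 ltrBlDr -[2]/(1 + 1) ltrD2l.
have -> : \int[mu]_(s in `]0, t[) (dC s * dy s) = (Gamma (2 - alpha))^-1 *
    \int[mu]_(s in `]0, t[) (v s *
      \int[mu]_(r in `]0, s[) (p r * (s - r) `^ (- (alpha - 1)))).
  rewrite -RintegralZl//; apply: eq_Rintegral => s; rewrite inE /= => /sT sT'.
  rewrite dCE// vE; last by case/andP: sT' => /ltW-> ->.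
  by rewrite mulrA mulrAC mulrC mulrA.
have e : \int[mu]_(s in `]0, t[) (v s ^+ 2) = \int[mu]_(s in `]0, t[) (dy s ^+ 2).
  apply: eq_Rintegral => s; rewrite inE => /sT sT'.
  by rewrite vE//; case/andP: sT' => /ltW-> ->.
by rewrite (ler_pM2l G0) -e; exact: E.
Qed.

Lemma caputo_eq0 t : (forall s, 0 <= s <= T -> dy s = 0) -> 0 < t <= T -> dC t = 0.
Proof.
move=> dyz tT; rewrite dCE// (memory_eq0 alpha01 ip v0 vI ipk _ tT) ?mulr0//.
move=> s; apply: dyz; rewrite le_max lexx ge_max (ltW T0) ge_min lexx orbT//.
Qed.

End caputo_difference.

(** * Uniqueness for the inverse problem *)

Lemma continuous_eq0_cc (R : realType) (T : R) (f : R -> R) : 0 < T ->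
  {within `[0, T], continuous f} -> (forall s, 0 < s < T -> f s = 0) ->
  forall s, 0 <= s <= T -> f s = 0.
Proof.
move=> T0 cf f0 s /[dup] sT /andP[s0 sT'].
apply/eqP/negPn/negP => fs0.
have fs : 0 < `|f s| by rewrite normr_gt0.
have : \forall r \near s, `[0, T]%classic r -> `|f s - f r| < `|f s|.
  have /subspace_continuousP/(_ s) := cf; rewrite /= in_itv => /(_ sT).
  by move=> /cvgrPdist_lt/(_ _ fs).
move=> /nbhs_ballP[d /= d0 dP].
pose l := Num.min 2^-1 (d / T).
have l0 : 0 < l by rewrite lt_min invr_gt0 ltr0n divr_gt0.
have l1 : l < 1 by rewrite gt_min invf_lt1 ?ltr1n ?ltr0n.
have lT : l * T <= d by rewrite -ler_pdivlMr// ge_min lexx orbT.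
have l1' : 0 < 1 - l by rewrite subr_gt0.
pose r := (1 - l) * s + l * (T / 2).
have rT : 0 < r < T.
  rewrite ltr_wpDl ?mulr_ge0 ?(ltW l1') ?mulr_gt0 ?divr_gt0//=.
  rewrite -[ltRHS](subrK (l * T)) -{1}[T]mul1r -mulrBl.
  rewrite ler_ltD//; first by rewrite ler_pM2l.
  by rewrite ltr_pM2l// ltr_pdivrMr// ltr_pMr// ltr1n.
have sr : `|s - r| < d.
  have -> : s - r = l * (s - T / 2) by rewrite /r mulrBl mulrBr mul1r; ring.
  apply: lt_le_trans lT; rewrite normrM (gtr0_norm l0) ltr_pM2l//.
  have T20 : 0 < T / 2 by rewrite divr_gt0.
  have T2 : T / 2 < T by rewrite ltr_pdivrMr// ltr_pMr// ltr1n.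
  rewrite ltr_norml; apply/andP; split; first by rewrite ltrBrDl (lt_le_trans _ s0)// subr_lt0.
  by rewrite ltrBlDr (le_lt_trans sT')// ltrDl.
have rin : `[0, T]%classic r by case/andP: rT => *; rewrite /= in_itv /= !ltW.
by have := dP _ sr rin; rewrite (f0 _ rT) subr0 ltxx.
Qed.

Lemma within_cylinder_at (R : realType) (n : nat) (Om : set 'rV[R]_n) (T t : R)
  (u : R -> 'rV[R]_n -> R) : 0 <= t <= T ->
  {within cylinder `[0, T] (closure Om), continuous (fun p => u p.1 p.2)} ->
  {within closure Om, continuous (u t)}.
Proof.
move=> tT /subspace_continuousP cu; apply/subspace_continuousP => x Ox.
have Kt : cylinder `[0, T] (closure Om) (t, x) by split => //; rewrite /= in_itv.
move=> B /(cu _ Kt) HB.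
have {}HB : \forall p \near (t, x), cylinder `[0, T] (closure Om) p -> B (u p.1 p.2) := HB.
have [r r0 rP] := near_prod_ball HB.
have : \forall y \near x, closure Om y -> B (u t y).
  have : \forall y \near x, ball x r y by exact: nbhsx_ballx.
  apply: filterS => y xy Oy.
  by apply: (rP t y (ballxx _ r0) xy); split => //; rewrite /= in_itv.
by [].
Qed.

Section uniqueness.
Context {R : realType} {n : nat}.
Local Notation Rn := 'rV[R]_n.
Local Notation toV := (@rV_of_tuple R n).
Local Notation lam := (lebesgue_tuple R n).
Local Notation mu := (@lebesgue_measure R).
Variables (alpha T delta : R) (Om : set Rn) (A : Rn -> 'M[R]_n).
Variables (c h phi psi : Rn -> R) (g : R -> R) (u : bool -> R -> Rn -> R) (f : bool -> R -> R).
Local Notation K := (cylinder `[0, T] (closure Om)).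
Hypotheses (alpha12 : 1 < alpha < 2) (T0 : 0 < T) (oOm : open Om) (bOm : bounded_set Om).
Hypothesis symA : forall x, Om x -> (A x)^T = A x.
Hypothesis delta0 : 0 < delta.
Hypothesis ellA : forall x xi : Rn, Om x ->
  delta * (\sum_i xi 0 i ^+ 2) <= \sum_i \sum_j A x i j * xi 0 i * xi 0 j.
Hypothesis c0 : forall x, Om x -> 0 <= c x.
Hypothesis hA : forall i j k, (forall x, Om x -> has_partial k (fun y => A y i j) x) /\
  holder_on Om (partial k (fun y => A y i j)).
Hypotheses (hc : holder_on Om c) (ch : {within closure Om, continuous h}).
Hypothesis uC : forall k, C_alpha_2 alpha T Om (u k).
Hypothesis uP : forall k, inverse_problem_1 alpha T Om A c h phi psi g (u k) (f k).

Let inK t x : 0 <= t <= T -> Om x -> K (t, x).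
Proof. by move=> tT Ox; split; [rewrite /= in_itv|exact: subset_closure]. Qed.

Let compactK : compact K.
Proof.
apply: compact_setX; first exact: segment_compact.
exact: compact_closure_rV.
Qed.

Let itvT (t : R) : 0 <= t <= T -> t \in `[0, T].
Proof. by rewrite in_itv. Qed.

Let itvW (t : R) : 0 < t <= T -> 0 <= t <= T.
Proof. by case/andP => /ltW -> ->. Qed.

Let cu k : {within K, continuous (fun p => u k p.1 p.2)}.
Proof. by have [[]] := uC k. Qed.

Let cdu k : {within K, continuous (fun p => derive_in T ((u k)^~ p.2) p.1)}.
Proof. by have [[]] := uC k. Qed.

Let dirichlet_u k t : 0 <= t <= T -> dirichlet_C2 Om (u k t).
Proof.
move=> tT; have [_ _ _ d2 c2] := uC k; have [_ _ u0 _] := uP k; split.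
- exact: within_cylinder_at tT (@cu k).
- by move=> x; apply: u0; exact: itvT.
- by move=> i j x Ox; apply: d2 => //; exact: itvT.
- move=> i j x Ox; have [G cG GE] := c2 i j.
  apply: (@continuous_near_eq _ _ _ (fun y => G (t, y))).
    apply: filterS (near_open oOm Ox) => y Oy.
    by apply: (GE (t, y)); split => //; exact: itvT.
  apply: (within_closure_continuous oOm) Ox.
  apply: (@within_cylinder_at _ _ Om T t (fun t y => G (t, y)) tT).
  by rewrite (_ : (fun p => G (p.1, p.2)) = G)//; apply/funext => -[].
- move=> i j; have [G cG GE] := c2 i j; have [C _ CG] := compact_bound compactK cG.
  exists C => x Ox; have -> := GE (t, x) (conj (itvT tT) Ox).
  by apply: CG; exact: inK.
Qed.

Let w t x := u true t x - u false t x.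

Let v t x := derive_in T ((u true)^~ x) t - derive_in T ((u false)^~ x) t.

Let F t := f true t - f false t.

Let cw : {within K, continuous (fun p => w p.1 p.2)}.
Proof. by move=> p; apply: cvgB; [exact: (@cu true)|exact: (@cu false)]. Qed.

Let cv : {within K, continuous (fun p => v p.1 p.2)}.
Proof. by move=> p; apply: cvgB; [exact: (@cdu true)|exact: (@cdu false)]. Qed.

Let wC2 t : 0 <= t <= T -> dirichlet_C2 Om (w t).
Proof. by move=> tT; apply: dirichlet_C2B => //; exact: dirichlet_u. Qed.

Let v0 x : Om x -> v 0 x = 0.
Proof.
move=> Ox; have i k : derive_in T ((u k)^~ x) 0 = psi x.
  by have [_ /(_ x (subset_closure Ox))[_ ->]] := uP k.
by rewrite /v !i subrr.
Qed.

Let wE t x : 0 <= t <= T -> Om x -> w t x = \int[mu]_(s in `]0, t[) v s x.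
Proof.
move=> tT Ox.
have cdux k : {within `[0, T], continuous (derive_in T ((u k)^~ x))}.
  exact: (within_cylinder_slice (u := fun t x => derive_in T ((u k)^~ x) t) Ox (@cdu k)).
have E k : u k t x - phi x = \int[mu]_(s in `]0, t[) derive_in T ((u k)^~ x) s.
  have [_ i _ _] := uP k; have [<- _] := i x (subset_closure Ox).
  apply: derive_in_primitive tT => //.
    have [[_ d _] _ _ _ _] := uC k => s sT; apply: d; [exact: itvT|exact: subset_closure].
  exact: within_cylinder_slice Ox (@cu k).
have I k : mu.-integrable `]0, t[ (EFin \o derive_in T ((u k)^~ x)).
  apply: continuous_integrable_oo; apply: continuous_within_sub (cdux k).
  by apply: subset_itvl; rewrite bnd_simp; case/andP: tT.
rewrite /v (RintegralB _ (I true) (I false)); last exact: measurable_itv.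
by rewrite -!E opprD addrACA opprK addNr addr0.
Qed.

Let dC x t := caputo alpha ((u true)^~ x) t - caputo alpha ((u false)^~ x) t.

Let caputo_extension : exists2 D : R -> Rn -> R,
  {within K, continuous (fun p => D p.1 p.2)} &
  forall t x, 0 < t <= T -> Om x -> dC x t = D t x.
Proof.
have [_ _ [G1 cG1 G1E] _ _] := uC true; have [_ _ [G2 cG2 G2E] _ _] := uC false.
exists (fun t x => G1 (t, x) - G2 (t, x)).
  have e G : (fun p : R * Rn => G (p.1, p.2) : R) = G by apply/funext => -[].
  move=> p; apply: cvgB.
    by have := @cG1 p; rewrite -{1}(e G1).
  by have := @cG2 p; rewrite -{1}(e G2).
move=> t x tT Ox; rewrite /dC; have Kt : cylinder `]0, T] Om (t, x) by split; rewrite /= ?in_itv.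
by have /= -> := G1E _ Kt; have /= -> := G2E _ Kt.
Qed.

Let equation t x : 0 < t <= T -> Om x ->
  dC x t = div_form_op A c (w t) x + F t * h x.
Proof.
move=> tT Ox; have e k : caputo alpha ((u k)^~ x) t =
    f k t * h x + div_form_op A c (u k t) x.
  by have [E _ _ _] := uP k; rewrite -E ?subrK// in_itv.
have D k := dirichlet_u k (itvW tT).
rewrite /dC !e (div_form_opB c oOm hA (D true) (D false) Ox).
by rewrite mulrBl opprD addrACA addrC.
Qed.

Let ch' x : Om x -> {for x, continuous h}.
Proof. exact: within_closure_continuous. Qed.

Let bounded_h : exists2 C, 0 <= C & forall x, Om x -> `|h x| <= C.
Proof.
have [C C0 CH] := compact_bound (compact_closure_rV bOm) ch.
by exists C => // x Ox; exact/CH/subset_closure.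
Qed.

Let bounded_on_K (q : R -> Rn -> R) : {within K, continuous (fun p => q p.1 p.2)} ->
  exists2 C, 0 <= C & forall t x, 0 <= t <= T -> Om x -> `|q t x| <= C.
Proof.
move=> cq; have [C C0 CH] := compact_bound compactK cq.
by exists C => // t x tT Ox; exact: (CH (t, x) (inK tT Ox)).
Qed.

Let integrable_hq (q : R -> Rn -> R) t : {within K, continuous (fun p => q p.1 p.2)} ->
  0 <= t <= T -> lam.-integrable (toV @^-1` Om) (EFin \o ((fun x => h x * q t x) \o toV)).
Proof.
move=> cq tT; have [C C0 HC] := bounded_h; have [B B0 HB] := bounded_on_K cq.
apply: (section_integrable (C := C * B) oOm bOm) => x Ox.
  exact: (cvgM (ch' Ox) (within_cylinder_section oOm tT Ox cq)).
by rewrite normrM; apply: ler_pM; rewrite ?normr_ge0//; [exact: HC|exact: HB].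
Qed.

(* Both solutions satisfy the same integral observation. *)
Let orthogonal t : 0 <= t <= T -> integral_Rn Om (fun x => h x * w t x) = 0.
Proof.
move=> tT; have I k := integrable_hq (@cu k) tT.
have obs k : integral_Rn Om (fun x => h x * u k t x) = g t.
  by have [_ _ _ E] := uP k; apply: E; exact: itvT.
transitivity (integral_Rn Om (fun x => h x * u true t x) -
              integral_Rn Om (fun x => h x * u false t x)); last by rewrite !obs subrr.
rewrite /integral_Rn -(RintegralB _ (I true) (I false)).
  by apply: eq_Rintegral => y _; rewrite /w mulrBr.
exact: open_measurable_rV.
Qed.

Section with_extension.
Variable D : R -> Rn -> R.
Hypothesis cD : {within K, continuous (fun p => D p.1 p.2)}.
Hypothesis DE : forall t x, 0 < t <= T -> Om x -> dC x t = D t x.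

Let elliptic_bounded t : 0 < t <= T -> exists2 M, 0 <= M & forall x, Om x ->
  `|div_form_op A c (w t) x| <= M.
Proof.
move=> tT; have [B B0 HB] := bounded_on_K cD; have [C C0 HC] := bounded_h.
exists (B + `|F t| * C); first by rewrite addr_ge0// mulr_ge0.
move=> x Ox; have -> : div_form_op A c (w t) x = D t x - F t * h x.
  by rewrite -(DE tT Ox) (equation tT Ox) addrK.
apply: (le_trans (ler_normB _ _)); apply: lerD; first exact: HB (itvW tT) Ox.
by rewrite normrM; apply: ler_wpM2l; [exact: normr_ge0|exact: HC].
Qed.

(* The source term drops out by orthogonality. *)
Let pairing_w t s : 0 < t <= T -> 0 <= s <= T ->
  integral_Rn Om (fun x => D t x * w s x) =
  integral_Rn Om (fun x => div_form_op A c (w t) x * w s x).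
Proof.
move=> tT sT; have [B B0 HB] := bounded_on_K cD; have [C C0 HC] := bounded_on_K cw.
have mOm : measurable (toV @^-1` Om) by exact: open_measurable_rV.
have iD : lam.-integrable (toV @^-1` Om) (EFin \o ((fun x => D t x * w s x) \o toV)).
  apply: (section_integrable (C := B * C) oOm bOm) => x Ox.
    exact: (cvgM (within_cylinder_section oOm (itvW tT) Ox cD)
                 (within_cylinder_section oOm sT Ox cw)).
  rewrite normrM; apply: ler_pM; rewrite ?normr_ge0//; [exact: HB (itvW tT) Ox|exact: HC].
have ih := integrableZlR (F t) mOm (integrable_hq cw sT).
transitivity (integral_Rn Om (fun x => D t x * w s x) -
    F t * integral_Rn Om (fun x => h x * w s x)).
  by rewrite (orthogonal sT) mulr0 subr0.
rewrite /integral_Rn -RintegralZl//; last exact: integrable_hq cw sT.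
rewrite -RintegralB//; apply: eq_Rintegral => y; rewrite inE => Oy.
by rewrite -(DE tT Oy) (equation tT Oy) mulrA -mulrBl addrK.
Qed.

Let TT : 0 < T <= T.
Proof. by rewrite T0 lexx. Qed.

Let caputo_u k x : Om x -> caputo_defined T alpha ((u k)^~ x).
Proof. by move=> Ox; have [_ /(_ x Ox)] := uC k. Qed.

Let cvx x : Om x -> {within `[0, T], continuous (v ^~ x)}.
Proof. by move=> Ox; exact: within_cylinder_slice Ox cv. Qed.

Let energy x : Om x ->
  (Gamma (2 - alpha))^-1 * (T `^ (- (alpha - 1)) * \int[mu]_(s in `]0, T[) (v s x ^+ 2)) <=
  \int[mu]_(s in `]0, T[) (D s x * v s x).
Proof.
move=> Ox; have E := caputo_energy T0 alpha12 (@caputo_u true x Ox) (@caputo_u false x Ox)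
  (v0 Ox) (cvx Ox) TT.
apply: (le_trans E); rewrite le_eqVlt; apply/orP; left; apply/eqP.
apply: eq_Rintegral => s; rewrite inE /= in_itv /= => /andP[s0 sT].
by rewrite -(DE _ Ox)// s0 ltW.
Qed.

Let energy_factor : 0 < (Gamma (2 - alpha))^-1 * T `^ (- (alpha - 1)).
Proof.
rewrite mulr_gt0 ?powR_gt0// invr_gt0; apply: Gamma_gt0.
by case/andP: alpha12 => a1 a2; rewrite subr_gt0 a2 ltrBlDr -[2]/(1 + 1) ltrD2l.
Qed.

(* The work at x is nonnegative by the memory estimate, and its integral over the
   domain is nonpositive by the energy identity. *)
Let work0 x : Om x -> \int[mu]_(s in `]0, T[) (D s x * v s x) = 0.
Proof.
have TT' := itvW TT.
have sym s t : 0 < s <= T -> 0 < t <= T ->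
    integral_Rn Om (fun x => D t x * w s x) = integral_Rn Om (fun x => D s x * w t x).
  move=> sT tT; rewrite (pairing_w tT (itvW sT)) (pairing_w sT (itvW tT)).
  have [M M0 HM] := elliptic_bounded tT; have [M' M'0 HM'] := elliptic_bounded sT.
  apply: (div_form_symmetric (M := M + M') oOm bOm symA delta0 ellA hA hc
    (wC2 (itvW tT)) (wC2 (itvW sT))) => y Oy.
    by apply: (le_trans (HM _ Oy)); rewrite lerDl.
  by apply: (le_trans (HM' _ Oy)); rewrite lerDr.
have neg t : 0 < t <= T -> integral_Rn Om (fun x => D t x * w t x) <= 0.
  move=> tT; rewrite (pairing_w tT (itvW tT)).
  have [M M0 HM] := elliptic_bounded tT.
  exact: (div_form_le0 oOm bOm delta0 ellA c0 hA hc (wC2 (itvW tT)) (wC2 (itvW tT)) HM HM).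
have W := work_le0 oOm bOm cD cv wE sym neg TT.
have cDv : {within K, continuous (fun p => D p.1 p.2 * v p.1 p.2)}.
  by move=> p; apply: cvgM; [exact: cD|exact: cv].
move: x; apply: (continuous_integral_eq0 oOm bOm _ _ _ W).
- by move=> x Ox; exact: (@primitive_continuous _ _ Om T oOm bOm
    (fun s x => D s x * v s x) T x TT' Ox cDv).
- move=> x Ox; apply: le_trans (energy Ox); rewrite mulrA.
  apply: mulr_ge0; first exact: ltW.
  by apply: Rintegral_ge0 => s _; exact: sqr_ge0.
- have [B B0 HB] := compact_bound compactK cDv.
  apply: (section_integrable (C := B * T) oOm bOm) => x Ox.
    exact: (@primitive_continuous _ _ Om T oOm bOm
      (fun s x => D s x * v s x) T x TT' Ox cDv).
  exact: (@primitive_bound _ _ Om T (fun s x => D s x * v s x) B T x TT' Ox cDv).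
Qed.

Let v_eq0 t x : 0 <= t <= T -> Om x -> v t x = 0.
Proof.
move=> tT Ox; apply: (continuous_eq0_cc T0 (cvx Ox)) tT.
apply: (continuous_integral_sqr_eq0 (cvx Ox) TT).
by have := energy Ox; rewrite (work0 Ox) mulrA (pmulr_rle0 _ energy_factor).
Qed.

Let w_eq0 t x : 0 <= t <= T -> Om x -> w t x = 0.
Proof.
move=> tT Ox; rewrite (wE tT Ox).
transitivity (\int[mu]_(s in `]0, t[) (cst 0 s : R)).
  apply: eq_Rintegral => s; rewrite inE /= in_itv /= => /andP[s0 st].
  by apply: v_eq0 => //; rewrite (ltW s0) (le_trans (ltW st)) //; case/andP: tT.
by rewrite Rintegral_cst ?mul0r//; exact: measurable_itv.
Qed.

(** In the domain w is the primitive of v = 0; on the boundary it vanishes by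
    hypothesis. *)
Lemma states_coincide t x : 0 <= t <= T -> closure Om x -> u true t x = u false t x.
Proof.
move=> tT Ox; have [Omx|nOmx] := pselect (Om x).
  by apply/eqP; rewrite -subr_eq0; apply/eqP; exact: w_eq0.
have bx : boundary Om x by split => //; rewrite (interior_id Om).1.
have u0 k : u k t x = 0 by have [_ _ + _] := uP k; apply=> //; exact: itvT.
by rewrite !u0.
Qed.

Lemma sources_coincide x : Om x -> h x != 0 -> forall t, 0 < t <= T -> F t = 0.
Proof.
move=> Ox hx0 t tT; apply/eqP; have := equation tT Ox.
have -> : dC x t = 0.
  apply: (caputo_eq0 T0 alpha12 (@caputo_u true x Ox) (@caputo_u false x Ox) (v0 Ox)) tT.
  by move=> s sT; exact: v_eq0.
have uD k := dirichlet_u k (itvW tT).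
rewrite (div_form_opB c oOm hA (uD true) (uD false) Ox).
rewrite (div_form_op_eq c oOm hA (uD false) _ Ox); last first.
  by move=> y Oy; apply: states_coincide (itvW tT) _; exact: subset_closure.
by rewrite subrr add0r => /esym/eqP; rewrite mulf_eq0 (negbTE hx0) orbF.
Qed.

End with_extension.

(** As h is continuous, it is nonzero somewhere in the open domain itself, where the
    equation holds; the equation gives f true = f false for t > 0, and continuity at
    t = 0. *)
Lemma inverse_problem_unique : (exists2 x, closure Om x & h x != 0) ->
  (forall k, {within `[0, T], continuous (f k)}) ->
  (forall t x, t \in `[0, T] -> closure Om x -> u true t x = u false t x) /\
  (forall t, t \in `[0, T] -> f true t = f false t).
Proof.
move=> [x Ox hx0] cf; have [D cD DE] := caputo_extension; split=> t.
  by move=> y; rewrite in_itv; exact: states_coincide cD DE t y.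
have [y [Oy hy0]] : exists y, Om y /\ h y != 0.
  have : \forall y \near x, closure Om y -> h y != 0.
    have hx : 0 < `|h x| by rewrite normr_gt0.
    have near_h : \forall y \near x, closure Om y -> `|h x - h y| < `|h x|.
      have /subspace_continuousP/(_ x Ox) := ch.
      by move=> /cvgrPdist_lt/(_ _ hx).
    apply: filterS near_h => y + Oy => /(_ Oy).
    by apply: contraTneq => ->; rewrite subr0 ltxx.
  move=> /Ox[y [Oy hy]]; exists y; split => //.
  exact/hy/subset_closure.
rewrite in_itv => tT; apply/eqP; rewrite -subr_eq0; apply/eqP.
have cF : {within `[0, T], continuous F}.
  by move=> s; apply: cvgB; [exact: (cf true)|exact: (cf false)].
apply: (continuous_eq0_cc T0 cF _ tT) => s /andP[s0 sT].
by apply: (sources_coincide cD DE Oy hy0); rewrite s0 ltW.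
Qed.

End uniqueness.

Theorem theorem4 (R : realType) (N : nat) (alpha T delta : R)
    (Om : set 'rV[R]_N) (A : 'rV[R]_N -> 'M[R]_N) (c : 'rV[R]_N -> R)
    (h phi psi : 'rV[R]_N -> R) (g : R -> R)
    (u1 u2 : R -> 'rV[R]_N -> R) (f1 f2 : R -> R) :
  (0 < N)%N ->
  1 < alpha < 2 ->
  0 < T ->
  bounded_smooth_domain Om ->
  (forall x, Om x -> (A x)^T = A x) ->
  0 < delta ->
  (forall (x xi : 'rV[R]_N), Om x ->
     delta * (\sum_i xi 0 i ^+ 2) <=
     \sum_i \sum_j A x i j * xi 0 i * xi 0 j) ->
  (forall x, Om x -> 0 <= c x) ->
  (forall i j k, (forall x, Om x -> has_partial k (fun y => A y i j) x) /\
     holder_on Om (partial k (fun y => A y i j))) ->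
  holder_on Om c ->
  {within closure Om, continuous h} ->
  (exists2 x, closure Om x & h x != 0) ->
  C_alpha_2 alpha T Om u1 -> {within `[0, T], continuous f1} ->
  inverse_problem_1 alpha T Om A c h phi psi g u1 f1 ->
  C_alpha_2 alpha T Om u2 -> {within `[0, T], continuous f2} ->
  inverse_problem_1 alpha T Om A c h phi psi g u2 f2 ->
  (forall t x, t \in `[0, T] -> closure Om x -> u1 t x = u2 t x) /\
  (forall t, t \in `[0, T] -> f1 t = f2 t).
Proof.
move=> _ alpha12 T0 [_ oOm _ bOm _] symA delta0 ellA c0 hA hc ch hx.
move=> uC1 cf1 uP1 uC2 cf2 uP2.
pose u (k : bool) := if k then u1 else u2.
pose f (k : bool) := if k then f1 else f2.
have uC k : C_alpha_2 alpha T Om (u k) by case: k; [exact: uC1|exact: uC2].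
have uP k : inverse_problem_1 alpha T Om A c h phi psi g (u k) (f k).
  by case: k; [exact: uP1|exact: uP2].
have cf k : {within `[0, T], continuous (f k)} by case: k; [exact: cf1|exact: cf2].
exact: (inverse_problem_unique alpha12 T0 oOm bOm symA delta0 ellA c0 hA hc ch
  uC uP hx cf).
Qed.
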